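(* For $g\in\prod_{i=1}^mL^+_\infty(D\times V)$, the two expectation semigroups $(\phi_t[g],t\ge0)$ (of the multi-species neutron random walk with potential $\beta$) and $(\psi_t[g],t\ge0)$ (of the multi-species neutron branching process) agree, i.e. $\phi_t[g](i,r,\upsilon)=\psi_t[g](i,r,\upsilon)$ for all $t\ge0$, $1\le i\le m$, $r\in D$, $\upsilon\in V$.
   Context: **Domain and types.** $D\subseteq\mathbb R^3$ is a smooth, open, (pathwise) connected, bounded domain whose boundary has zero Lebesgue measure. $V=\{\upsilon\in\mathbb R^3:\upsilon_{\min}\le|\upsilon|\le\upsilon_{\max}\}$ with $0<\upsilon_{\min}<\upsilon_{\max}<\infty$, with Lebesgue measure $\mathrm d\upsilon$. Types are $\{1,\dots,m\}$, $1\le\ell<m$: types $1,\dots,\ell$ are prompt emissions, types $\ell+1,\dots,m$ are isotopes. $\prod_{i=1}^mL^+_\infty(D\times V)$ is the set of vectors $g=(g(1,\cdot),\dots,g(m,\cdot))$ of non-negative, uniformly bounded measurable functions on $D\times V$. **Cross sections.** The following are non-negative, measurable and uniformly bounded: $\sigma^i_{\mathtt s},\sigma^i_{\mathtt f}$ on $D\times V$ ($1\le i\le\ell$); $\pi^i_{\mathtt s}$ on $D\times V\times V$ ($1\le i\le\ell$) with $\int_V\pi^i_{\mathtt s}(r,\upsilon,\upsilon')\,\mathrm d\upsilon'=1$; $\pi^{i,j}_{\mathtt f}$ on $D\times V\times V$ ($1\le i\le m$, $1\le j\le\ell$) with $\sum_{j=1}^\ell\int_V\pi^{i,j}_{\mathtt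 f}(r,\upsilon,\upsilon')\,\mathrm d\upsilon'<\infty$; $m^j$ on $D\times V$ ($\ell+1\le j\le m$). The functions $\sigma^i_{\mathtt s}\pi^i_{\mathtt s}$ ($1\le i\le\ell$) and $\sigma^1_{\mathtt f}m^j$ ($\ell+1\le j\le m$) are uniformly bounded away from $0$, and $0<\lambda_{\ell+1}<\dots<\lambda_m$. **Multi-species neutron branching process (MNBP).** A Markov branching process of typed emissions with configurations in $D\times V$; different emissions evolve independently given their starting configurations. - An emission of type $i\le\ell$ with configuration $(r,\upsilon)$ moves in a straight line with velocity $\upsilon$ until one of the following occurs. (a) It leaves $D$, and is killed. (b) A scattering event: independently of everything else, the scattering time satisfies $\Pr(T^i_{\mathtt s}>t)=\exp\{-\int_0^t\sigma^i_{\mathtt s}(r+\upsilon s,\upsilon)\,\mathrm ds\}$; if it occurs at $(r,\upsilon)$, the velocity becomes $\upsilon'$ chosen with density $\pi^i_{\mathtt s}(r,\upsilon,\upsilon')\,\mathrm d\upsilon'$. (c) A fission event: independently of everything else, the fission time satisfies $\Pr(T^i_{\mathtt f}>t)=\exp\{-\int_0^t\sigma^i_{\mathtt f}(r+\upsilon s,\upsilon)\,\mathrm ds\}$; if it occurs at $(r,\upsilon)$, the emission is removed and, for each $j\le\ell$, a random number $N^{i,j}\ge0$ of type $j$ emissions is released from $r$ with random, possibly correlated, velocities $\upsilon^{i,j}_k$, $k=1,\dots,N^{i,j}$, where $\mathrm E[\sum_{k=1}^{N^{i,j}}\mathbf 1_{(\upsilon^{i,j}_k\in A)}]=\int_A\pi^{i,j}_{\mathtt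 f}(r,\upsilon,\upsilon')\,\mathrm d\upsilon'$ for Borel $A\subseteq V$; if moreover $i=1$, for each $j\in\{\ell+1,\dots,m\}$ a random number of type $j$ isotopes with mean $m^j(r,\upsilon)$ is produced, each with configuration $(r,\upsilon)$. - An isotope of type $i>\ell$ with configuration $(r,\upsilon)$ stays at $r$ (keeping $\upsilon$ as a mark) for an exponential time of rate $\lambda_i$, then is removed and replaced by random numbers of prompt emissions of types $j\le\ell$ at $r$ with random velocities, whose mean measures are $\pi^{i,j}_{\mathtt f}(r,\upsilon,\upsilon')\,\mathrm d\upsilon'$. The random numbers of emissions of each type are bounded by a non-random constant $n_{\max}\ge1$; in particular $\int_V\pi^{i,j}_{\mathtt f}(r,\upsilon,\upsilon')\,\mathrm d\upsilon'\le n_{\max}$ and $m^j\le n_{\max}$. $X_t=(X_t(1,\cdot),\dots,X_t(m,\cdot))$, where $X_t(j,\cdot)$ is the sum of Dirac masses at the configurations of the type $j$ emissions alive at time $t$, and $\langle g,X_t\rangle=\sum_{j=1}^m\int_{D\times V}g(j,r,\upsilon)X_t(j,\mathrm dr,\mathrm d\upsilon)$. Then $\psi_t[g](i,r,\upsilon)=\mathbb E_{\delta_{(i,r,\upsilon)}}[\langle g,X_t\rangle]$, the expectation being for the process started from one type $i$ emission with configuration $(r,\upsilon)$. **Multi-species neutron random walk (MNRW) and $\phi$.** Define - $\alpha^i(r,\upsilon)=\mathbf 1_{(i\le\ell)}\sigma^i_{\mathtt s}(r,\upsilon)+\mathbf 1_{(i\le\ell)}\sigma^i_{\mathtt f}(r,\upsilon)\big(\sum_{j=1}^\ell\int_V\pi^{i,j}_{\mathtt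 f}(r,\upsilon,\upsilon')\,\mathrm d\upsilon'+\mathbf 1_{(i=1)}\sum_{j=\ell+1}^mm^j(r,\upsilon)\big)+\mathbf 1_{(i>\ell)}\lambda_i\sum_{j=1}^\ell\int_V\pi^{i,j}_{\mathtt f}(r,\upsilon,\upsilon')\,\mathrm d\upsilon'$; - the probability kernel $\pi^{i,j}(r,\upsilon,\mathrm d\upsilon')$ on $\{1,\dots,m\}\times V$ given, where $\alpha^i(r,\upsilon)>0$, by $\alpha^i(r,\upsilon)\pi^{i,j}(r,\upsilon,\mathrm d\upsilon')=\mathbf 1_{(1\le i=j\le\ell)}\sigma^i_{\mathtt s}(r,\upsilon)\pi^i_{\mathtt s}(r,\upsilon,\upsilon')\,\mathrm d\upsilon'+\mathbf 1_{(1\le i,j\le\ell)}\sigma^i_{\mathtt f}(r,\upsilon)\pi^{i,j}_{\mathtt f}(r,\upsilon,\upsilon')\,\mathrm d\upsilon'+\mathbf 1_{(i=1,\,j>\ell)}\sigma^1_{\mathtt f}(r,\upsilon)m^j(r,\upsilon)\,\delta_\upsilon(\mathrm d\upsilon')+\mathbf 1_{(i>\ell,\,j\le\ell)}\lambda_i\pi^{i,j}_{\mathtt f}(r,\upsilon,\upsilon')\,\mathrm d\upsilon'$ (irrelevant where $\alpha^i=0$); - $\beta^i(r,\upsilon)=\alpha^i(r,\upsilon)-\mathbf 1_{(i\le\ell)}\big(\sigma^i_{\mathtt s}(r,\upsilon)+\sigma^i_{\mathtt f}(r,\upsilon)\big)-\mathbf 1_{(i>\ell)}\lambda_i$. The MNRW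 $(J_t,R_t,\Upsilon_t)_{t\ge0}$ is the Markov process on $\{1,\dots,m\}\times D\times V$ with a cemetery state, with infinitesimal generator $$\mathcal L_if(r,\upsilon)=\mathbf 1_{(i\le\ell)}\,\upsilon\cdot\nabla f(i,r,\upsilon)+\alpha^i(r,\upsilon)\sum_{j=1}^m\int_V[f(j,r,\upsilon')-f(i,r,\upsilon)]\,\pi^{i,j}(r,\upsilon,\mathrm d\upsilon'),$$ i.e.: while of type $i\le\ell$ it moves in a straight line with its current velocity, while of type $i>\ell$ its position is motionless and its velocity is kept as a mark; from state $(i,r,\upsilon)$ it jumps at rate $\alpha^i(r,\upsilon)$ to $(j,r,\upsilon')$ with probability $\pi^{i,j}(r,\upsilon,\mathrm d\upsilon')$; and it is killed when its position leaves $D$, at time $\tau_D=\inf\{t>0:R_t\notin D\}$. With $\mathbf E_{(i,r,\upsilon)}$ the expectation for the MNRW started from $(i,r,\upsilon)$, $$\phi_t[g](i,r,\upsilon)=\mathbf E_{(i,r,\upsilon)}\Big[\mathrm e^{\int_0^t\beta^{J_s}(R_s,\Upsilon_s)\,\mathrm ds}\,g(J_t,R_t,\Upsilon_t)\,\mathbf 1_{(t<\tau_D)}\Big].$$ *)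

(* Defs.v *)
From HB Require Import structures.
From mathcomp Require Import all_boot all_order all_algebra.
From mathcomp Require Import all_classical all_reals all_analysis.
From mathcomp Require Import measurable_realfun.
Set Implicit Arguments.
Unset Strict Implicit.
Unset Printing Implicit Defensive.
Import Order.TTheory GRing.Theory Num.Theory numFieldNormedType.Exports.
Local Open Scope classical_set_scope.
Local Open Scope ring_scope.

(* Throughout, the types 1, ..., m of the text are the elements of 'I_m (so
   type 1 is the one of value 0); those of value < l are the prompt emissions
   and those of value >= l the isotopes. *)

Notation vec3 R := (R * R * R)%type.
(* (position, velocity) *)
Notation conf R := (vec3 R * vec3 R)%type.

(* [lebesgue_measure] lives on [measurableTypeR R], whose display is not the
   one of the canonical measurable structure of R (same Borel sets); [leb1] is
   its transfer to the latter, which is the one inherited by [vec3 R]. *)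
Definition leb1 (R : realType) : set R -> \bar R := @lebesgue_measure R.
Arguments leb1 {R}.

Section leb1_measure.
Variable R : realType.
Let leb1_0 : leb1 (set0 : set R) = 0%E.
Proof. exact: (@measure0 _ _ _ (@lebesgue_measure R)). Qed.
Let leb1_ge0 (A : set R) : (0 <= leb1 A)%E.
Proof. exact: (@measure_ge0 _ _ _ (@lebesgue_measure R)). Qed.
Let leb1_semi_sigma_additive : semi_sigma_additive (leb1 : set R -> \bar R).
Proof. exact: (@measure_semi_sigma_additive _ _ _ (@lebesgue_measure R)). Qed.
HB.instance Definition _ := isMeasure.Build _ R R (@leb1 R)
  leb1_0 leb1_ge0 leb1_semi_sigma_additive.
Let leb1_sigma_finite : sigma_finite setT (leb1 : set R -> \bar R).
Proof. exact: (@sigma_finiteT _ _ _ (@lebesgue_measure R)). Qed.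
HB.instance Definition _ := Measure_isSigmaFinite.Build _ R R (@leb1 R)
  leb1_sigma_finite.
End leb1_measure.

Definition leb3 (R : realType) : set (vec3 R) -> \bar R :=
  ((leb1 \x leb1) \x leb1)%E.
Arguments leb3 {R}.

Section leb3_measure.
Variable R : realType.
HB.instance Definition _ := Measure.copy (@leb3 R)
  (((@leb1 R \x @leb1 R) \x @leb1 R)%E : {measure set (vec3 R) -> \bar R}).
Let leb3_sigma_finite : sigma_finite setT (leb3 : set (vec3 R) -> \bar R).
Proof.
have /sigma_finiteP[F [TF ndF Foo]] := sigma_finiteT (@leb1 R).
exists (fun n => (F n `*` F n) `*` F n).
  rewrite -!setXTT TF predeqE => -[[x y] z]; split.
    move=> [/= [[i _ Fx] [j _ Fy]] [k _ Fz]].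
    exists (maxn (maxn i j) k) => //; split; first split => /=.
    - by move: x Fx; apply/subsetPset/ndF; rewrite -maxnA leq_maxl.
    - by move: y Fy; apply/subsetPset/ndF; rewrite maxnAC leq_maxr.
    - by move: z Fz; apply/subsetPset/ndF; rewrite leq_maxr.
  by move=> [n _ [/= [? ?] ?]]; split; [split|]; exists n.
move=> n; have [mF Fn] := Foo n.
split; first by do 2?apply: measurableX.
have mFF := measurableX mF mF.
have FF : ((@leb1 R \x @leb1 R) (F n `*` F n) < +oo)%E.
  by rewrite product_measure1E// lte_mul_pinfty// ge0_fin_numE.
rewrite /leb3 (product_measure1E (@leb1 R \x @leb1 R)%E _ mFF mF).
by rewrite lte_mul_pinfty// ge0_fin_numE.
Qed.
HB.instance Definition _ := Measure_isSigmaFinite.Build _ (vec3 R) R (@leb3 R)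
  leb3_sigma_finite.
End leb3_measure.

Section geometry.
Variable R : realType.
Implicit Types (D U : set (vec3 R)) (f rho : vec3 R -> R).

(* the norm carried by the product type [vec3 R] is the sup norm *)
Definition enorm (v : vec3 R) : R :=
  Num.sqrt (v.1.1 ^+ 2 + v.1.2 ^+ 2 + v.2 ^+ 2).

Definition shell (vmin vmax : R) : set (vec3 R) :=
  [set v | vmin <= enorm v <= vmax].

(* f is C^oo on the open set U *)
Definition smooth_on U f := forall (vs : seq (vec3 R)) (x : vec3 R), U x ->
  let h : vec3 R -> R :=
    foldr (fun (v : vec3 R) (h : vec3 R -> R) (y : vec3 R) => 'D_v h y) f vs in
  {for x, continuous h} /\ forall v : vec3 R, derivable h x v.

Definition boundary D : set (vec3 R) := closure D `\` D°.

(* D is locally a sublevel set of a smooth function without critical point *)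
Definition smooth_boundary D := forall x, boundary D x ->
  exists U rho, [/\ open U, U x, smooth_on U rho,
    forall y : vec3 R, U y -> exists v : vec3 R, 'D_v rho y != 0 &
    D `&` U = [set y | rho y < 0] `&` U].

Definition pathwise_connected D := forall x y, D x -> D y ->
  exists gamma : R -> vec3 R, [/\ {within `[0, 1], continuous gamma},
    gamma 0 = x, gamma 1 = y & forall t, 0 <= t <= 1 -> D (gamma t)].

Record admissible_domain D : Prop := {
  domain_open : open D ;
  domain_connected : pathwise_connected D ;
  domain_bounded : bounded_set D ;
  domain_smooth : smooth_boundary D ;
  domain_boundary_null : leb3 (boundary D) = 0%E }.

End geometry.

(* the cone L^+_oo(A) of non-negative, uniformly bounded measurable functions *)
Definition Lpos (R : realType) d (T : measurableType d) (A : set T)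
    (f : T -> R) : Prop :=
  [/\ measurable_fun A f, forall x, A x -> 0 <= f x &
      exists M : R, forall x, A x -> f x <= M].

Record cross_sections (R : realType) (m : nat) := CrossSections {
  sigma_s : 'I_m -> conf R -> R ;
  sigma_f : 'I_m -> conf R -> R ;
  pi_s : 'I_m -> conf R -> vec3 R -> R ;
  pi_f : 'I_m -> 'I_m -> conf R -> vec3 R -> R ;
  isotope_mean : 'I_m -> conf R -> R ;
  decay_rate : 'I_m -> R }.

(* Only the values on D x V (x V), and those at the type indices mentioned
   below, are meaningful. *)
Record admissible_cross_sections (R : realType) (m l : nat)
    (D V : set (vec3 R)) (xs : cross_sections R m) : Prop := {
  sigma_s_Lpos : forall i : 'I_m, (i < l)%N -> Lpos (D `*` V) (sigma_s xs i) ;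
  sigma_f_Lpos : forall i : 'I_m, (i < l)%N -> Lpos (D `*` V) (sigma_f xs i) ;
  pi_s_Lpos : forall i : 'I_m, (i < l)%N ->
    Lpos ((D `*` V) `*` V) (fun z : conf R * vec3 R => pi_s xs i z.1 z.2) ;
  pi_s_density : forall (i : 'I_m) (x : conf R), (i < l)%N -> (D `*` V) x ->
    (\int[leb3]_(v' in V) (pi_s xs i x v')%:E = 1)%E ;
  pi_f_Lpos : forall i j : 'I_m, (j < l)%N ->
    Lpos ((D `*` V) `*` V) (fun z : conf R * vec3 R => pi_f xs i j z.1 z.2) ;
  pi_f_finite : forall (i : 'I_m) (x : conf R), (D `*` V) x ->
    (\sum_(j < m | (j < l)%N) \int[leb3]_(v' in V) (pi_f xs i j x v')%:E
       < +oo)%E ;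
  isotope_mean_Lpos : forall j : 'I_m, (l <= j)%N ->
    Lpos (D `*` V) (isotope_mean xs j) ;
  scatter_away0 : forall i : 'I_m, (i < l)%N ->
    exists2 c : R, 0 < c & forall (x : conf R) (v' : vec3 R),
      (D `*` V) x -> V v' -> c <= sigma_s xs i x * pi_s xs i x v' ;
  isotope_away0 : forall i j : 'I_m, val i = 0%N -> (l <= j)%N ->
    exists2 c : R, 0 < c & forall x : conf R,
      (D `*` V) x -> c <= sigma_f xs i x * isotope_mean xs j x ;
  decay_rate_gt0 : forall i : 'I_m, (l <= i)%N -> 0 < decay_rate xs i ;
  decay_rate_lt : forall i j : 'I_m, (l <= i)%N -> (i < j)%N ->
    decay_rate xs i < decay_rate xs j }.

Section flights.
Variables (R : realType) (m l : nat) (D : set (vec3 R)).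
Implicit Types (i : 'I_m) (x : conf R).

(* configuration, at age s, of a particle of type i starting from x *)
Definition flight i x (s : R) : conf R :=
  if (i < l)%N then (x.1 + s *: x.2, x.2) else x.

Definition exit_time i x : \bar R :=
  ereal_inf [set s%:E | s in [set s : R | 0 <= s /\ ~ D (flight i x s).1]].

(* Probability that a clock of rate h along the flight has not rung at age s.
   The rates are extended by 0 outside D, which is immaterial since the
   particle is killed when it leaves D. *)
Definition survival (h : 'I_m -> conf R -> R) i x (s : R) : R :=
  expR (- \int[lebesgue_measure]_(u in `[0, s])
            (\1_D (flight i x u).1 * h i (flight i x u))).

(* State at time t of a particle described by e = Some (b, i, x), where b, i
   and x are its birth time, type and initial configuration (e = None if the
   particle never exists), and which is interrupted at age T unless it leaves D
   before; None if the particle is not there at time t. *)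
Definition observe (e : option (R * 'I_m * conf R)) (T : \bar R) (t : R) :
    option ('I_m * conf R) :=
  if e is Some (b, i, x) then
    if [&& b <= t, ((t - b)%:E < T)%E & ((t - b)%:E < exit_time i x)%E]
    then Some (i, flight i x (t - b)) else None
  else None.

(* End of a flight: age and configuration at the scattering event, or at the
   removal (fission or decay), whichever first, unless D is left before. *)
Inductive fate :=
  | Scattered of R & conf R
  | Removed of R & conf R
  | Left.

Definition fate_of i x (ts tf : \bar R) : fate :=
  if (ts < tf)%E && (ts < exit_time i x)%E
  then Scattered (fine ts) (flight i x (fine ts))
  else if (tf < exit_time i x)%E
  then Removed (fine tf) (flight i x (fine tf))
  else Left.

End flights.
Arguments Left {R}.

(* [F n] is the information before, [G n] the information after the durations
   of stage n have been drawn. *)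
Record staged_filtration d (T : measurableType d) (F G : nat -> set (set T)) :
    Prop := {
  F_sigma_algebra : forall n, sigma_algebra setT (F n) ;
  G_sigma_algebra : forall n, sigma_algebra setT (G n) ;
  F_sub_G : forall n, F n `<=` G n ;
  G_sub_F : forall n, G n `<=` F n.+1 ;
  F_measurable : forall n, F n `<=` measurable }.

(* Law of the emissions released when an emission of type i is removed at a
   configuration x: a random mark o is drawn from [offspring_law i x], and then
   [offspring_count j o] emissions of type j are released, the k-th one having
   velocity [offspring_velocity j k o] if j is prompt. The mark space O is
   arbitrary, so numbers and velocities may be correlated in any way. *)
Record offspring (R : realType) (m : nat) dO (O : measurableType dO) :=
  Offspring {
    offspring_law : 'I_m -> R.-pker (conf R) ~> O ;
    offspring_count : 'I_m -> O -> nat ;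
    offspring_velocity : 'I_m -> nat -> O -> vec3 R }.

(* types j that can be released at the removal of an emission of type i *)
Definition releases (m l : nat) (i j : 'I_m) : bool :=
  (j < l)%N || (val i == 0%N).

Record admissible_offspring (R : realType) (m l : nat) (D V : set (vec3 R))
    (xs : cross_sections R m) (nmax : nat) dO (O : measurableType dO)
    (off : offspring R m O) : Prop := {
  count_measurable : forall j : 'I_m,
    measurable_fun setT (offspring_count off j) ;
  velocity_measurable : forall (j : 'I_m) (k : nat),
    measurable_fun setT (offspring_velocity off j k) ;
  velocity_in_V : forall (j : 'I_m) (k : nat) (o : O), (j < l)%N ->
    V (offspring_velocity off j k o) ;
  prompt_mean : forall (i j : 'I_m) (x : conf R) (A : set (vec3 R)),
    (j < l)%N -> (D `*` V) x -> measurable A -> A `<=` V ->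
    (\int[offspring_law off i x]_o
        (\sum_(k < offspring_count off j o)
            \1_A (offspring_velocity off j k o))%:E
     = \int[leb3]_(v' in A) (pi_f xs i j x v')%:E)%E ;
  isotope_meanE : forall (i j : 'I_m) (x : conf R),
    val i = 0%N -> (l <= j)%N -> (D `*` V) x ->
    (\int[offspring_law off i x]_o (offspring_count off j o)%:R%:E
     = (isotope_mean xs j x)%:E)%E ;
  count_bounded : forall (i j : 'I_m) (x : conf R),
    releases l i j -> (D `*` V) x ->
    {ae offspring_law off i x, forall o, (offspring_count off j o <= nmax)%N} }.

Section branching_process.
Variables (R : realType) (m l : nat) (D V : set (vec3 R)).
Variables (xs : cross_sections R m) (dO : measure_display).
Variables (O : measurableType dO) (off : offspring R m O).
Variables (d : measure_display) (T : measurableType d).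

(* Ulam-Harris labels, the youngest letter first: [None :: p] is the emission
   p after it has scattered, [Some (j, k) :: p] is the k-th emission of type j
   released at the removal of p. *)
Definition label := seq (option ('I_m * nat)).
HB.instance Definition _ := Countable.on label.

Record mnbp_noise := MNBPNoise {
  scatter_clock : label -> T -> \bar R ;
  (* fission time for prompt emissions, decay time for isotopes *)
  removal_clock : label -> T -> \bar R ;
  scatter_velocity : label -> T -> vec3 R ;
  offspring_mark : label -> T -> O }.

(* isotopes never scatter *)
Definition scatter_rate (i : 'I_m) (x : conf R) : R :=
  if (i < l)%N then sigma_s xs i x else 0.
Definition removal_rate (i : 'I_m) (x : conf R) : R :=
  if (i < l)%N then sigma_f xs i x else decay_rate xs i.

Section realization.
Variables (z : mnbp_noise) (i0 : 'I_m) (x0 : conf R).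

(* birth time, type and initial configuration; None if never born *)
Fixpoint emission (u : label) (w : T) : option (R * 'I_m * conf R) :=
  match u with
  | [::] => Some (0, i0, x0)
  | a :: p =>
    if emission p w is Some (b, i, x) then
      match a, fate_of l D i x (scatter_clock z p w) (removal_clock z p w) with
      | None, Scattered s y =>
          Some (b + s, i, (y.1, scatter_velocity z p w))
      | Some (j, k), Removed s y =>
          if releases l i j && (k < offspring_count off j (offspring_mark z p w))%N
          then Some (b + s, j,
            (y.1, if (j < l)%N
                  then offspring_velocity off j k (offspring_mark z p w)
                  else y.2))
          else None
      | _, _ => None
      end
    else None
  end.

Definition emission_fate (u : label) (w : T) : fate R :=
  if emission u w is Some (_, i, x)
  then fate_of l D i x (scatter_clock z u w) (removal_clock z u w) else Left.

(* conditional probability that the clocks of u exceed s and t *)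
Definition clock_law (u : label) (s t : R) (w : T) : R :=
  if emission u w is Some (_, i, x)
  then survival l D scatter_rate i x s * survival l D removal_rate i x t
  else 1.

Definition outcome_in (B : set (vec3 R)) (C : set O) (u : label) (w : T) :
    Prop :=
  match emission_fate u w with
  | Scattered _ _ => B (scatter_velocity z u w)
  | Removed _ _ => C (offspring_mark z u w)
  | Left => False
  end.

(* conditional probability of [outcome_in B C u] *)
Definition outcome_law (B : set (vec3 R)) (C : set O) (u : label) (w : T) : R :=
  if emission u w is Some (_, i, _) then
    match emission_fate u w with
    | Scattered _ y => \int[leb3]_(v' in B `&` V) pi_s xs i y v'
    | Removed _ y => fine (offspring_law off i y C)
    | Left => 0
    end
  else 0.

Definition emission_at (u : label) (t : R) (w : T) : option ('I_m * conf R) :=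
  observe l D (emission u w)
    (mine (scatter_clock z u w) (removal_clock z u w)) t.

(* X_t(j, .) *)
Definition population (t : R) (j : 'I_m) (w : T) :
    set (conf R) -> \bar R :=
  mseries (fun n : nat =>
    if @pickle_inv label n is Some u then
      if emission_at u t w is Some (i, y) then
        if i == j then dirac y : {measure set (conf R) -> \bar R}
        else mzero
      else mzero
    else mzero) 0.
HB.instance Definition _ t j w := Measure.on (population t j w).

Definition pairing (g : 'I_m -> conf R -> R) (t : R) (w : T) : \bar R :=
  (\sum_(j < m) \int[population t j w]_(y in D `*` V) (g j y)%:E)%E.

End realization.

(* A realization, on the probability space (T, P), of the MNBP started from one
   emission of type i0 with configuration x0. The stages of the filtration are
   the generations of labels. Given [F n], the clocks of the emissions of
   generation n are independent, with laws depending only on the types and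
   initial configurations of these emissions; given moreover the clocks, the
   outcomes of their scattering, fission and decay events are independent. *)
Record mnbp (P : probability T R) (i0 : 'I_m) (x0 : conf R) := MNBP {
  mnbp_data :> mnbp_noise ;
  mnbp_F : nat -> set (set T) ;
  mnbp_G : nat -> set (set T) ;
  mnbp_filtration : staged_filtration mnbp_F mnbp_G ;
  scatter_clock_ge0 : forall u w, (0 <= scatter_clock mnbp_data u w)%E ;
  removal_clock_ge0 : forall u w, (0 <= removal_clock mnbp_data u w)%E ;
  scatter_velocity_in_V : forall u w, V (scatter_velocity mnbp_data u w) ;
  scatter_clock_G : forall u (B : set (\bar R)), measurable B ->
    mnbp_G (size u) (scatter_clock mnbp_data u @^-1` B) ;
  removal_clock_G : forall u (B : set (\bar R)), measurable B ->
    mnbp_G (size u) (removal_clock mnbp_data u @^-1` B) ;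
  scatter_velocity_F : forall u (B : set (vec3 R)), measurable B ->
    mnbp_F (size u).+1 (scatter_velocity mnbp_data u @^-1` B) ;
  offspring_mark_F : forall u (C : set O), measurable C ->
    mnbp_F (size u).+1 (offspring_mark mnbp_data u @^-1` C) ;
  mnbp_clocks : forall (n : nat) (L : seq label) (s t : label -> R) (A : set T),
    uniq L -> (forall u, u \in L -> size u = n) ->
    (forall u, u \in L -> 0 <= s u /\ 0 <= t u) ->
    mnbp_F n A ->
    (forall u w, u \in L -> A w -> emission mnbp_data i0 x0 u w <> None) ->
    P (A `&` [set w | forall u, u \in L ->
         ((s u)%:E < scatter_clock mnbp_data u w)%E /\
         ((t u)%:E < removal_clock mnbp_data u w)%E])
    = (\int[P]_(w in A)
         (\prod_(u <- L) clock_law mnbp_data i0 x0 u (s u) (t u) w)%:E)%E ;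
  mnbp_outcomes : forall (n : nat) (L : seq label) (B : label -> set (vec3 R))
      (C : label -> set O) (A : set T),
    uniq L -> (forall u, u \in L -> size u = n) ->
    (forall u, u \in L -> measurable (B u) /\ measurable (C u)) ->
    mnbp_G n A ->
    (forall u w, u \in L -> A w -> emission_fate mnbp_data i0 x0 u w <> Left) ->
    P (A `&` [set w | forall u, u \in L ->
         outcome_in mnbp_data i0 x0 (B u) (C u) u w])
    = (\int[P]_(w in A)
         (\prod_(u <- L) outcome_law mnbp_data i0 x0 (B u) (C u) u w)%:E)%E }.

(* psi_t[g](i0, x0) *)
Definition psi (P : probability T R) (i0 : 'I_m) (x0 : conf R)
    (X : mnbp P i0 x0) (t : R) (g : 'I_m -> conf R -> R) : \bar R :=
  (\int[P]_w pairing X i0 x0 g t w)%E.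

End branching_process.

Section random_walk.
Variables (R : realType) (m l : nat) (D V : set (vec3 R)).
Variables (xs : cross_sections R m).

Definition fission_yield (i j : 'I_m) (x : conf R) : R :=
  \int[leb3]_(v' in V) pi_f xs i j x v'.

Definition alpha (i : 'I_m) (x : conf R) : R :=
  (i < l)%N%:R * sigma_s xs i x
  + (i < l)%N%:R * sigma_f xs i x *
    (\sum_(j < m | (j < l)%N) fission_yield i j x
     + (val i == 0%N)%:R * \sum_(j < m | (l <= j)%N) isotope_mean xs j x)
  + (l <= i)%N%:R * decay_rate xs i * \sum_(j < m | (j < l)%N) fission_yield i j x.

Definition beta (i : 'I_m) (x : conf R) : R :=
  alpha i x - (i < l)%N%:R * (sigma_s xs i x + sigma_f xs i x)
  - (l <= i)%N%:R * decay_rate xs i.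

(* density and atomic part of alpha^i(x) pi^{i,j}(x, .) *)
Definition jump_density (i j : 'I_m) (x : conf R) (v' : vec3 R) : R :=
  ((i < l)%N && (i == j))%:R * (sigma_s xs i x * pi_s xs i x v')
  + ((i < l)%N && (j < l)%N)%:R * (sigma_f xs i x * pi_f xs i j x v')
  + ((l <= i)%N && (j < l)%N)%:R * (decay_rate xs i * pi_f xs i j x v').

Definition jump_atom (i j : 'I_m) (x : conf R) : R :=
  ((val i == 0%N) && (l <= j)%N)%:R * (sigma_f xs i x * isotope_mean xs j x).

Definition is_jump_kernel (pi : 'I_m -> 'I_m -> R.-ker (conf R) ~> vec3 R) :
    Prop :=
  forall (i : 'I_m) (x : conf R), (D `*` V) x ->
    (\sum_(j < m) pi i j x V = 1)%E /\
    (0 < alpha i x ->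
      forall (j : 'I_m) (B : set (vec3 R)), measurable B -> B `<=` V ->
        ((alpha i x)%:E * pi i j x B
         = \int[leb3]_(v' in B) (jump_density i j x v')%:E
           + (jump_atom i j x)%:E * dirac x.2 B)%E).

Variable pi : 'I_m -> 'I_m -> R.-ker (conf R) ~> vec3 R.
Variables (d : measure_display) (T : measurableType d).

(* waiting time before the (n+1)-st jump, new type and new velocity *)
Record mnrw_noise := MNRWNoise {
  sojourn : nat -> T -> \bar R ;
  new_type : nat -> T -> 'I_m ;
  new_velocity : nat -> T -> vec3 R }.

Section realization.
Variables (z : mnrw_noise) (i0 : 'I_m) (x0 : conf R).

(* time of the n-th jump, and state just after it; None if the walk is killed
   before, or makes fewer than n jumps *)
Fixpoint walk (n : nat) (w : T) : option (R * 'I_m * conf R) :=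
  if n is n'.+1 then
    if walk n' w is Some (b, i, x) then
      if (sojourn z n' w < exit_time l D i x)%E && (sojourn z n' w < +oo)%E
      then let s := fine (sojourn z n' w) in
           Some (b + s, new_type z n' w,
                 ((flight l i x s).1, new_velocity z n' w))
      else None
    else None
  else Some (0, i0, x0).

(* (J_t, R_t, Upsilon_t); None is the cemetery *)
Definition walk_at (t : R) (w : T) : option ('I_m * conf R) :=
  let leg n := observe l D (walk n w) (sojourn z n w) t in
  leg (xget 0%N [set n | leg n]).

Definition tau (w : T) : \bar R :=
  ereal_inf [set s%:E | s in [set s : R | 0 < s /\
    ~ (if walk_at s w is Some (_, y) then D y.1 else False)]].

(* a function on 'I_m x D x V vanishes at the cemetery *)
Definition at_walk (f : 'I_m -> conf R -> R) (t : R) (w : T) : R :=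
  if walk_at t w is Some (i, y) then f i y else 0.

Definition sojourn_law (n : nat) (t : R) (w : T) : R :=
  if walk n w is Some (_, i, x) then survival l D alpha i x t else 1.

Definition jump_law (n : nat) (j : 'I_m) (B : set (vec3 R)) (w : T) : \bar R :=
  if walk n w is Some (_, i, x)
  then pi i j (flight l i x (fine (sojourn z n w))) B else 0%E.

End realization.

(* A realization, on the probability space (T, P), of the MNRW started from
   (i0, x0), the stages of the filtration being the successive jumps. *)
Record mnrw (P : probability T R) (i0 : 'I_m) (x0 : conf R) := MNRW {
  mnrw_data :> mnrw_noise ;
  mnrw_F : nat -> set (set T) ;
  mnrw_G : nat -> set (set T) ;
  mnrw_filtration : staged_filtration mnrw_F mnrw_G ;
  sojourn_ge0 : forall n w, (0 <= sojourn mnrw_data n w)%E ;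
  new_velocity_in_V : forall n w, V (new_velocity mnrw_data n w) ;
  sojourn_G : forall n (B : set (\bar R)), measurable B ->
    mnrw_G n (sojourn mnrw_data n @^-1` B) ;
  new_type_F : forall n j, mnrw_F n.+1 (new_type mnrw_data n @^-1` [set j]) ;
  new_velocity_F : forall n (B : set (vec3 R)), measurable B ->
    mnrw_F n.+1 (new_velocity mnrw_data n @^-1` B) ;
  mnrw_sojourns : forall (n : nat) (t : R) (A : set T),
    0 <= t -> mnrw_F n A ->
    (forall w, A w -> walk mnrw_data i0 x0 n w <> None) ->
    P (A `&` [set w | (t%:E < sojourn mnrw_data n w)%E])
    = (\int[P]_(w in A) (sojourn_law mnrw_data i0 x0 n t w)%:E)%E ;
  mnrw_jumps : forall (n : nat) (j : 'I_m) (B : set (vec3 R)) (A : set T),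
    measurable B -> B `<=` V -> mnrw_G n A ->
    (forall w, A w -> walk mnrw_data i0 x0 n.+1 w <> None) ->
    P (A `&` [set w | new_type mnrw_data n w = j /\
                      B (new_velocity mnrw_data n w)])
    = (\int[P]_(w in A) jump_law mnrw_data i0 x0 n j B w)%E }.

(* phi_t[g](i0, x0) *)
Definition phi (P : probability T R) (i0 : 'I_m) (x0 : conf R)
    (Y : mnrw P i0 x0) (t : R) (g : 'I_m -> conf R -> R) : \bar R :=
  'E_P[fun w => expR (\int[lebesgue_measure]_(s in `[0, t])
                        at_walk Y i0 x0 beta s w)
                * at_walk Y i0 x0 g t w
                * (t%:E < tau Y i0 x0 w)%E%:R].

End random_walk.

(* Main.v *)
Require Import Defs.
From HB Require Import structures.
From mathcomp Require Import all_boot all_order all_algebra.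
From mathcomp Require Import all_classical all_reals all_analysis.
From mathcomp Require Import measurable_realfun ring lra.
Set Implicit Arguments.
Unset Strict Implicit.
Unset Printing Implicit Defensive.
Import Order.TTheory GRing.Theory Num.Theory numFieldNormedType.Exports.
Local Open Scope classical_set_scope.
Local Open Scope ring_scope.

(* Both semigroups are expanded over the events of the particle that is
   observed at time t. Let G_i(b, x) be the mean of g at time t over a particle
   of type i born at time b in the configuration x and observed before its
   first scattering, fission or decay (0 if b > t), and let K be the operator
   that takes H to the mean of H over the particles created by that first
   event. Conditioning on the n-th generation gives
     E[ sum over the emissions u of generation n.+1 of H(u) ]
       = E[ sum over the emissions u of generation n of (K H)(u) ],
   hence psi = sum_n (K^n G)_i0(0, x0). For the walk, exp(int beta) over one
   leg is the ratio of the survival probability of a clock of the total event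
   rate sigma_s + sigma_f (or lambda) to that of a clock of rate alpha. So
   weighting the n-th leg by this exponential over the first n legs turns a
   jump into the same operator K, because alpha * pi is the mean measure of the
   particles created by an event, and phi is the same series. As the two series
   agree term by term, no uniqueness of the solution of an evolution equation
   is needed, nor the absence of explosion. *)

(** * Laws on products *)

(** The two processes are specified only by probabilities of elementary events: clocks exceeding
    constant ages, and outcomes lying in given sets, intersected with events of [F n] or [G n]. No
    conditional expectation is formed. Each such identity is read as the equality of two measures on
    the rectangles of a product (information, age, velocity), and is extended to all non-negative
    measurable functions. Three obstacles shape the proof. The rates are only measurable, so the
    density of the first of two competing clocks cannot be found by differentiation. Of the released
    emissions only the mean measure is prescribed, summed over their rank [k], so identities for
    releases hold for the series over [k] and not term by term. The age [t - b] at which a particle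
    is observed is random, though known at its birth. Both processes are then treated by the same
    two statements on a single particle: [particle_race] for its first event and
    [observed_value_mean] for its observation at time [t]. The sums over legs and labels are taken
    in [0, +oo], where Tonelli requires no integrability. *)

Lemma ge0_integral_leb1 (R : realType) (A : set R) (f : R -> \bar R) :
  measurable A -> measurable_fun A f -> (forall x, A x -> (0 <= f x)%E) ->
  (\int[lebesgue_measure]_(x in A) f x = \int[leb1]_(x in A) f x)%E.
Proof.
move=> mA mf f0.
have mid : measurable_fun setT (idfun : measurableTypeR R -> R).
  exact: measurable_id.
have := @ge0_integral_pushforward _ _ _ _ _ _ mid lebesgue_measure A f mA mf.
move=> <-; last by move=> x /set_mem; exact: f0.
exact: eq_measure_integral.
Qed.

Section density.
Local Open Scope ereal_scope.
Context d (T : measurableType d) (R : realType).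
Variables (m : {measure set T -> \bar R}) (f : T -> R).
Hypotheses (mf : measurable_fun setT f) (f0 : forall x, (0 <= f x)%R).

(* the proofs are arguments because this is a measure only for such f *)
Definition density (_ : measurable_fun setT f) (_ : forall x, (0 <= f x)%R)
  (A : set T) : \bar R := \int[m]_(x in A) (f x)%:E.

Let nu := density mf f0.
Let mEf : measurable_fun setT (EFin \o f).
Proof. exact/measurable_EFinP. Qed.

Let nu0 : nu set0 = 0. Proof. exact: integral_set0. Qed.
Let nu_ge0 A : 0 <= nu A.
Proof. by apply: integral_ge0 => x _; rewrite lee_fin. Qed.
Let nu_sigma_additive : semi_sigma_additive nu.
Proof.
move=> F mF tF mUF.
rewrite [X in _ --> X](_ : _ = \sum_(0 <= n <oo) nu (F n)); last first.
  rewrite /nu /density ge0_integral_bigcup//; first exact: measurable_funTS.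
  by move=> x _; rewrite lee_fin.
exact: is_cvg_nneseries.
Qed.

HB.instance Definition _ := isMeasure.Build _ T R (density mf f0)
  nu0 nu_ge0 nu_sigma_additive.

Import HBNNSimple.

Let integral_density_nnsfun (g : {nnsfun T >-> R}) :
  \int[density mf f0]_x (g x)%:E = \int[m]_x ((g x)%:E * (f x)%:E).
Proof.
rewrite integralT_nnsfun sintegralE.
have mg r : measurable (g @^-1` [set r]) by exact: measurable_funPTI.
have mgf r : measurable_fun setT ((EFin \o f) \_ (g @^-1` [set r])).
  by apply: (measurable_restrictT _ _).1 => //; exact: measurable_funTS.
have gr0 r x : 0 <= r%:E * ((EFin \o f) \_ (g @^-1` [set r])) x.
  rewrite patchE; case: ifPn => [|_]; last by rewrite mule0.
  by rewrite inE/= => <-; rewrite mule_ge0// lee_fin.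
transitivity (\sum_(r \in range g)
    \int[m]_x (r%:E * ((EFin \o f) \_ (g @^-1` [set r])) x)).
  apply: eq_fsbigr => r /[1!inE] -[y _ <-].
  rewrite /= /density [in LHS]integral_mkcond ge0_integralZl_EFin ?lee_fin//.
  by move=> x _; rewrite patchE; case: ifP => //=; rewrite lee_fin.
rewrite -ge0_integral_fsum//; last first.
  by move=> r; apply: emeasurable_funM.
apply: eq_integral => x _.
rewrite (fsbigD1 (g x))//=; last by exists x.
rewrite [X in (_ + X)%R]fsbig1 ?addr0; last first.
  by move=> r [_ rg]; rewrite patchE memNset ?mule0//= => /esym.
by rewrite patchE mem_set.
Qed.

(** Both sides are monotone limits along the same simple functions, for which the identity is a
    finite sum. *)
Lemma integral_density (g : T -> \bar R) : measurable_fun setT g ->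
  (forall x, 0 <= g x) ->
  \int[density mf f0]_x g x = \int[m]_x (g x * (f x)%:E).
Proof.
move=> mg g0; pose g_ := nnsfun_approx measurableT mg.
have mg_ n : measurable_fun setT (EFin \o g_ n) by exact/measurable_EFinP.
have g_g x : EFin \o g_ ^~ x @ \oo --> g x by apply: cvg_nnsfun_approx.
have ndg x : nondecreasing_seq (g_ ^~ x).
  by move=> i j ij; exact/lefP/nd_nnsfun_approx.
transitivity (limn (fun n => \int[density mf f0]_x (g_ n x)%:E)).
  rewrite -monotone_convergence//.
  - by apply: eq_integral => x _; apply/esym/cvg_lim => //; exact: g_g.
  - by move=> n x _; rewrite lee_fin.
  - by move=> x _ i j ij; rewrite lee_fin; exact: ndg.
under eq_fun do rewrite integral_density_nnsfun.
rewrite -monotone_convergence//.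
- by apply: eq_integral => x _; apply/cvg_lim => //; apply: cvgeZr => //; exact: g_g.
- by move=> n; exact: emeasurable_funM (mg_ n) mEf.
- by move=> n x _; rewrite mule_ge0 ?lee_fin.
- by move=> x _ i j ij; rewrite lee_wpmul2r ?lee_fin//; exact: ndg.
Qed.

End density.

(** The second factor is tested on a generating pi-system [G] only, so that half-lines suffice when
    it is an age. Finiteness is asked on the strips [setT * g k], which exhaust the product. *)
Lemma eq_measure_prod (R : realType) d1 d2 (T1 : measurableType d1)
    (T2 : measurableType d2) (G : set (set T2)) (g : (set T2)^nat)
    (m1 m2 : {measure set (T1 * T2) -> \bar R}) :
  @measurable _ T2 = <<s G >> -> setI_closed G -> (forall i, G (g i)) ->
  \bigcup_k g k = setT ->
  (forall A C, measurable A -> G C -> m1 (A `*` C) = m2 (A `*` C)) ->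
  (forall k, m1 (setT `*` g k) < +oo)%E ->
  forall E, measurable E -> m1 E = m2 E.
Proof.
move=> mG GI Gg gT m12 m1oo.
have GT : <<s G >> `<=` measurable by rewrite mG.
have mprod : @measurable _ (T1 * T2)%type =
    <<s [set A `*` B | A in measurable & B in G] >>.
  rewrite measurable_prod_measurableType; apply/seteqP; split.
    apply: smallest_sub; first exact: smallest_sigma_algebra.
    move=> _ [A mA [B mB <-]].
    move: mB; rewrite mG => mB.
    pose H := [set A `*` B | A in @measurable _ T1 & B in G].
    (* For fixed [A], the sets [B] such that [A * B] is generated form a sigma-algebra that contains
       [G]. Complements are taken inside [A * setT], which is the union of the [A * g i]. *)
    suff : <<s G >> `<=` [set B | <<s H >> (A `*` B)] by exact.
    have HG C : G C -> <<s H >> (A `*` C).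
      by move=> GC; apply: sub_sigma_algebra; exists A => //; exists C.
    have HT : <<s H >> (A `*` setT).
      rewrite -gT setX_bigcupr; apply: sigma_algebra_bigcup => i; exact: HG.
    apply: smallest_sub => //; split => /=.
    - by rewrite setX0; exact: sigma_algebra0.
    - move=> C AC; rewrite [X in <<s H >> X](_ : _ = A `*` setT `\` A `*` C).
        exact: (@measurableD _ (g_sigma_algebraType H)).
      apply/seteqP; split => [[x y] [/= ? [_ ?]]|[x y] [/= [? _] nACxy]].
        by split => // -[].
      by split => //; split => // Cy; apply: nACxy.
    - by move=> F AF; rewrite setX_bigcupr; exact: sigma_algebra_bigcup.
  apply: smallest_sub; first exact: smallest_sigma_algebra.
  move=> _ [A mA [B GB <-]]; apply: sub_sigma_algebra; exists A => //.
  by exists B => //; apply: GT; exact: sub_sigma_algebra.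
apply: (measure_unique _ (fun k => setT `*` g k) mprod).
- move=> _ _ [A mA [B GB <-]] [A' mA' [B' GB' <-]].
  rewrite -setXI; exists (A `&` A'); first exact: measurableI.
  by exists (B `&` B') => //; exact: GI.
- by move=> i; exists setT => //; exists (g i).
- by rewrite -setX_bigcupr gT setXTT.
- by move=> _ [A mA [C GC <-]]; exact: m12.
- by [].
Qed.

(** The measure is the image under [X] of the measure of density [f]. It is given existentially,
    with its two defining formulas, because a density is a measure only together with the proofs
    about [f]. *)
Lemma weighted_pushforward (R : realType) d1 d2 (T1 : measurableType d1)
    (T2 : measurableType d2) (m : {measure set T1 -> \bar R}) (f : T1 -> R)
    (X : T1 -> T2) :
  measurable_fun setT f -> (forall x, 0 <= f x) -> measurable_fun setT X ->
  exists nu : {measure set T2 -> \bar R},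
    (forall A, nu A = \int[m]_(x in X @^-1` A) (f x)%:E)%E /\
    (forall Phi : T2 -> \bar R, measurable_fun setT Phi ->
      (forall z, 0 <= Phi z)%E ->
      \int[nu]_z Phi z = \int[m]_x (Phi (X x) * (f x)%:E))%E.
Proof.
move=> mf f0 mX.
unshelve (exists (pushforward (density m mf f0) X)); first exact: mX.
split=> // Phi mPhi Phi0.
rewrite (ge0_integral_pushforward mX)// preimage_setT.
by rewrite integral_density//; [exact: measurableT_comp|move=> x; exact: Phi0].
Qed.

Lemma nneseries_only0 (R : realType) (u : (\bar R)^nat) : (0 <= u 0%N)%E ->
  (forall k, (0 < k)%N -> u k = 0%E) -> (\sum_(k <oo) u k = u 0%N)%E.
Proof.
move=> u00 u0; rewrite nneseries_recl//.
  by rewrite eseries0 ?adde0// => k k0 _; exact: u0.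
by move=> [|k] _ //; rewrite u0.
Qed.

Section law.
Local Open Scope ereal_scope.
Context (R : realType) dT (T : measurableType dT) dE (E : measurableType dE).
Context dU (U : measurableType dU) dV (V : measurableType dV).
Variables (P : probability T R) (lam : {sigma_finite_measure set U -> \bar R}).
Variables (X : T -> E) (theta : T * U -> V) (rho : T * U -> R).
Hypotheses (mX : measurable_fun setT X) (mtheta : measurable_fun setT theta).
Hypotheses (mrho : measurable_fun setT rho) (rho0 : forall z, (0 <= rho z)%R).
Variables (G : set (set V)) (g : (set V)^nat).
Hypotheses (mG : @measurable _ V = <<s G >>) (GI : setI_closed G).
Hypotheses (Gg : forall k, G (g k)) (gT : \bigcup_k g k = setT).

Let law A C := \int[P]_(w in X @^-1` A)
  \int[lam]_(u in (fun u => theta (w, u)) @^-1` C) (rho (w, u))%:E.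

(* The kernel w |-> law of theta(w, u), u having density rho(w, .), is
   identified from its values on the rectangles. *)
Lemma law_measure (nu : {measure set (E * V) -> \bar R}) :
  (forall A C, measurable A -> G C -> nu (A `*` C) = law A C) ->
  (forall k, nu (setT `*` g k) < +oo) ->
  forall Phi : E * V -> \bar R, measurable_fun setT Phi ->
    (forall z, 0 <= Phi z) ->
  \int[nu]_z Phi z =
  \int[P]_w \int[lam]_u (Phi (X w, theta (w, u)) * (rho (w, u))%:E).
Proof.
move=> nuE nu_fin Phi mPhi Phi0.
have mXU : measurable_fun setT (fun z : T * U => (X z.1, theta z)).
  by apply: measurable_fun_pair => //; exact: measurableT_comp.
(* The right-hand side is an integral against the image under [(X, theta)] of the measure of density
   [rho] with respect to [P x lam]. It remains to compare this image with [nu] on rectangles. *)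
have [nu2 [nu2E nu2I]] := weighted_pushforward (P \x lam)%E mrho rho0 mXU.
have GT C : G C -> measurable C by rewrite mG; exact: sub_sigma_algebra.
have mrhoE : measurable_fun setT (EFin \o rho) by exact/measurable_EFinP.
have nu2X A C : measurable A -> measurable C -> nu2 (A `*` C) = law A C.
  move=> mA mC; rewrite nu2E integral_mkcond fubini_tonelli1; last 2 first.
  - apply: (measurable_restrictT _ _).1; last exact: measurable_funTS.
    by rewrite -[X in measurable X]setTI; apply: mXU => //; exact: measurableX.
  - by move=> z; rewrite erestrict_ge0// => y _; rewrite lee_fin.
  rewrite /law [RHS]integral_mkcond; apply: eq_integral => w _.
  rewrite /fubini_F !patchE; case: ifPn => [/set_mem Aw|/negP Aw].
    rewrite [RHS]integral_mkcond; apply: eq_integral => u _; rewrite !patchE.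
    by congr (if _ then _ else _); apply/idP/idP => /set_mem h;
      apply/mem_set => //; case: h.
  rewrite integral0_eq// => u _; rewrite patchE memNset// => -[Au _].
  by apply: Aw; exact: mem_set.
rewrite (eq_measure_integral nu2); last first.
  move=> A mA _; apply: (eq_measure_prod mG GI Gg gT) => //.
  by move=> B C mB GC; rewrite nuE// nu2X//; exact: GT.
rewrite nu2I// fubini_tonelli1//.
- by apply: emeasurable_funM => //; exact: measurableT_comp.
- by move=> z; rewrite mule_ge0// lee_fin.
Qed.

(** For released emissions, [Q k] is the event that the [k]-th one exists and [tau k] gives its
    data. Their individual laws are unknown and only the sum over [k] is prescribed. So the images
    of [P] restricted to the [Q k] are first added up, and [law_measure] is applied to the sum. *)
Lemma law_series (Q : (set T)^nat) (tau : (T -> V)^nat) :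
  (forall k, measurable (Q k)) -> (forall k, measurable_fun setT (tau k)) ->
  (forall A C, measurable A -> G C ->
     \sum_(k <oo) P (Q k `&` (X @^-1` A) `&` (tau k @^-1` C)) = law A C) ->
  (forall j, \sum_(k <oo) P (Q k `&` (tau k @^-1` g j)) < +oo) ->
  forall Phi : E * V -> \bar R, measurable_fun setT Phi ->
    (forall z, 0 <= Phi z) ->
  \sum_(k <oo) \int[P]_(w in Q k) Phi (X w, tau k w) =
  \int[P]_w \int[lam]_u (Phi (X w, theta (w, u)) * (rho (w, u))%:E).
Proof.
move=> mQ mtau PQ PQfin Phi mPhi Phi0.
have mXt k : measurable_fun setT (fun w => (X w, tau k w)).
  exact: measurable_fun_pair.
have mQ1 k : measurable_fun setT (\1_(Q k) : T -> R) by exact: measurable_indic.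
have Q0 k w : (0 <= (\1_(Q k) w : R))%R by [].
have [nu nuP] := choice (fun k => weighted_pushforward P (mQ1 k) (Q0 k) (mXt k)).
have mg j : measurable (g j) by rewrite mG; apply: sub_sigma_algebra.
have nuX k A C : measurable A -> measurable C ->
    nu k (A `*` C) = P (Q k `&` (X @^-1` A) `&` (tau k @^-1` C)).
  move=> mA mC; rewrite (nuP k).1 integral_indic//; last first.
    by rewrite -[X in measurable X]setTI; apply: (mXt k) => //; exact: measurableX.
  by congr (P _); rewrite -setIA.
rewrite -(@law_measure (mseries nu 0))//; last 2 first.
- move=> A C mA GC; rewrite -PQ//; apply: eq_eseriesr => k _.
  by rewrite nuX// mG; exact: sub_sigma_algebra.
- move=> j; rewrite (le_lt_trans _ (PQfin j))//.
  rewrite le_eqVlt; apply/orP; left; apply/eqP.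
  by apply: eq_eseriesr => k _; rewrite nuX// preimage_setT setIT.
rewrite ge0_integral_measure_series//; apply: eq_eseriesr => k _.
rewrite (nuP k).2// [LHS]integral_mkcond; apply: eq_integral => w _.
rewrite patchE indicE; case: ifPn => _; first by rewrite mule1.
by rewrite mule0.
Qed.

Lemma law_single (Q : set T) (tau : T -> V) :
  measurable Q -> measurable_fun setT tau ->
  (forall A C, measurable A -> G C ->
     P (Q `&` (X @^-1` A) `&` (tau @^-1` C)) = law A C) ->
  forall Phi : E * V -> \bar R, measurable_fun setT Phi ->
    (forall z, 0 <= Phi z) ->
  \int[P]_(w in Q) Phi (X w, tau w) =
  \int[P]_w \int[lam]_u (Phi (X w, theta (w, u)) * (rho (w, u))%:E).
Proof.
move=> mQ mtau PQ Phi mPhi Phi0.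
rewrite -(@law_series (fun k => if k == 0%N then Q else set0) (fun=> tau))//.
- rewrite nneseries_only0//=; first by apply: integral_ge0.
  by move=> -[|k]//= _; rewrite integral_set0.
- by move=> k; case: ifP.
- move=> A C mA GC; rewrite nneseries_only0//= ?PQ//.
  by move=> -[|k]//= _; rewrite !set0I measure0.
- move=> j; rewrite nneseries_only0//=; last by move=> -[|k]//= _; rewrite !set0I measure0.
  rewrite (le_lt_trans (probability_le1 _ _)) ?ltry//; apply: measurableI => //.
  rewrite -[X in measurable X]setTI; apply: mtau => //.
  by rewrite mG; apply: sub_sigma_algebra.
Qed.

End law.

(** * Survival functions *)

Lemma measurable_fst_section d1 d2 d3 (T1 : measurableType d1)
    (T2 : measurableType d2) (T3 : measurableType d3) (f : T1 * T2 -> T3) y :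
  measurable_fun setT f -> measurable_fun setT (fun x => f (x, y)).
Proof.
move=> mf; apply: (measurableT_comp mf).
exact: (measurable_fun_pair (@measurable_id _ _ setT) (measurable_cst y)).
Qed.

Lemma measurable_snd_section d1 d2 d3 (T1 : measurableType d1)
    (T2 : measurableType d2) (T3 : measurableType d3) (f : T1 * T2 -> T3) x :
  measurable_fun setT f -> measurable_fun setT (fun y => f (x, y)).
Proof.
move=> mf; apply: (measurableT_comp mf).
exact: (measurable_fun_pair (measurable_cst x) (@measurable_id _ _ setT)).
Qed.

Lemma measurable_fun_pair_comp d d1 d2 d3 (T : measurableType d)
    (T1 : measurableType d1) (T2 : measurableType d2) (T3 : measurableType d3)
    (f : T1 * T2 -> T3) (g1 : T -> T1) (g2 : T -> T2) :
  measurable_fun setT f -> measurable_fun setT g1 -> measurable_fun setT g2 ->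
  measurable_fun setT (fun x => f (g1 x, g2 x)).
Proof.
by move=> mf mg1 mg2; apply: (measurableT_comp mf); exact: measurable_fun_pair.
Qed.

Lemma measurable_in_set d (T : measurableType d) (A : set T) :
  measurable A -> measurable_fun setT (fun x => x \in A).
Proof.
move=> mA; apply: (measurable_fun_bool true).
by rewrite setTI [X in measurable X](_ : _ = A)//; apply/seteqP; split=> x /=; [move/set_mem|move/mem_set].
Qed.

(** Cut [[0, b]] into [n.+1] equal pieces: the increments add up to at most [C * b ^+ 2 / n.+1%:R],
    which tends to 0. *)
Lemma quadratic_increments (R : realType) (F : R -> R) (C : R) :
  (forall a b, 0 <= a <= b -> F b - F a <= C * (b - a) ^+ 2) ->
  forall b, 0 <= b -> F b <= F 0.
Proof.
move=> FC b b0.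
have step n k : F (b * (k%:R / n.+1%:R)) - F 0 <= k%:R * (C * (b / n.+1%:R) ^+ 2).
  elim: k => [|k IH]; first by rewrite mul0r mulr0 mul0r subrr.
  set x := b * (k%:R / n.+1%:R) in IH *.
  set y := b * (k.+1%:R / n.+1%:R).
  have yx : y - x = b / n.+1%:R.
    by rewrite /y /x -natr1; field; rewrite ?nat1r ?natr1 pnatr_eq0.
  have x0 : 0 <= x by rewrite mulr_ge0// divr_ge0.
  have xy : x <= y by rewrite -subr_ge0 yx divr_ge0.
  have := FC x y; rewrite yx x0 xy => /(_ isT) FCxy.
  by rewrite -(natr1 k) mulrDl mul1r; set q := C * _ in IH FCxy *; lra.
rewrite -subr_le0; apply/ler_addgt0Pr => e e0; rewrite add0r.
(* With this [n], the accumulated error [C * b ^+ 2 / n.+1%:R] is less than [e]. *)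
set n := Num.truncn (C * b ^+ 2 / e).
have := step n n.+1; rewrite divff ?pnatr_eq0// mulr1 => /le_trans; apply.
have : C * b ^+ 2 / e < n.+1%:R by exact: truncnS_gt.
rewrite ltr_pdivrMr// => Ce.
rewrite [leLHS](_ : _ = (C * b ^+ 2) / n.+1%:R); last first.
  by field; rewrite ?nat1r ?natr1 pnatr_eq0.
by rewrite ler_pdivrMr ?ltr0n// [leRHS]mulrC ltW.
Qed.

(* These are locked to keep unification from unfolding the integral. *)
HB.lock Definition cumulative_rate (R : realType) (k : R -> R) (s : R) : R :=
  \int[leb1]_(u in `[0, s]) k u.
HB.lock Definition survival_rate (R : realType) (k : R -> R) (s : R) : R :=
  expR (- cumulative_rate k s).

Section cumulative.
Context (R : realType).
Implicit Types (k Gam : R -> R).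

Variables (k : R -> R) (c : R).
Hypotheses (mk : measurable_fun setT k) (k0 : forall u, 0 <= k u).
Hypothesis kc : forall u, k u <= c.

Let mkE (A : set R) : measurable_fun A (EFin \o k).
Proof. by apply/measurable_EFinP; exact: measurable_funTS. Qed.

Lemma leb1_itv_oc (a b : R) : a <= b -> leb1 `]a, b] = (b - a)%:E.
Proof.
by move=> ab; rewrite /leb1 lebesgue_measure_itv/= lte_fin;
  case: ltgtP ab => // ->; rewrite subrr.
Qed.

Lemma integral_oc_le (f : R -> R) (M a b : R) : measurable_fun setT f ->
  a <= b -> (forall u, a <= u <= b -> 0 <= f u <= M) ->
  (\int[leb1]_(u in `]a, b]) (f u)%:E <= (M * (b - a))%:E)%E.
Proof.
move=> mf ab f0M.
rewrite EFinM -leb1_itv_oc// -integral_cst//.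
apply: ge0_le_integral => //.
- move=> x /=; rewrite in_itv/= => /andP[ax xb].
  by rewrite lee_fin; have /andP[] : 0 <= f x <= M by apply: f0M; rewrite xb ltW.
- by apply/measurable_EFinP; exact: measurable_funTS.
- move=> x /=; rewrite in_itv/= => /andP[ax xb].
  by rewrite lee_fin; have /andP[] : 0 <= f x <= M by apply: f0M; rewrite xb ltW.
Qed.

Lemma cumulative_fin (s : R) :
  (\int[leb1]_(u in `[0%R, s]) (k u)%:E \is a fin_num)%E.
Proof.
rewrite ge0_fin_numE; last by apply: integral_ge0 => x _; rewrite lee_fin.
apply: (@le_lt_trans _ _ (\int[leb1]_(u in `[0%R, s]) c%:E)%E).
  by apply: ge0_le_integral => // x _; rewrite lee_fin.
rewrite integral_cst//= /leb1 lebesgue_measure_itv/=.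
by case: ifP => _; rewrite ?mule0// -EFinB -EFinM ltry.
Qed.

Lemma cumulative_rateE s :
  (cumulative_rate k s)%:E = (\int[leb1]_(u in `[0%R, s]) (k u)%:E)%E.
Proof. by rewrite cumulative_rate.unlock /Rintegral fineK// cumulative_fin. Qed.

Lemma cumulative_rate_ge0 s : 0 <= cumulative_rate k s.
Proof. by rewrite -lee_fin cumulative_rateE integral_ge0// => x _; rewrite lee_fin. Qed.

Lemma cumulative_rate0 s : s <= 0 -> cumulative_rate k s = 0.
Proof.
move=> s0; apply: EFin_inj; rewrite cumulative_rateE.
rewrite -ge0_integral_leb1//; last by move=> x _; rewrite lee_fin.
rewrite (@integral_Sset1 _ _ _ 0)// => u /=; rewrite in_itv/= => /andP[u0 us].
by apply/eqP; rewrite eq_le u0 (le_trans us).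
Qed.

Lemma cumulative_rateD a b : 0 <= a <= b ->
  ((cumulative_rate k b)%:E =
  (cumulative_rate k a)%:E + \int[leb1]_(u in `]a, b]) (k u)%:E)%E.
Proof.
move=> /andP[a0 ab]; rewrite !cumulative_rateE -ge0_integral_setU//.
- congr integral; apply/seteqP; split=> x/=; rewrite !in_itv/=.
    by move=> /andP[-> ->]; rewrite andbT; case: leP; [left|right].
  by move=> [/andP[-> /le_trans->]//|/andP[/ltW/(le_trans a0)-> ->]].
- by move=> x _; rewrite lee_fin.
- rewrite disj_set2E; apply/eqP/seteqP; split=> x//=; rewrite !in_itv/=.
  by case=> /andP[_ xa] /andP[]; rewrite ltNge xa.
Qed.

Lemma cumulative_rate_oc a b : 0 <= a <= b ->
  ((cumulative_rate k b - cumulative_rate k a)%:E =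
  \int[leb1]_(u in `]a, b]) (k u)%:E)%E.
Proof. by move=> ab; rewrite EFinB (cumulative_rateD ab) addeAC subee// add0e. Qed.

Lemma cumulative_rateB a b : 0 <= a <= b ->
  0 <= cumulative_rate k b - cumulative_rate k a <= c * (b - a).
Proof.
move=> ab; have /andP[a0 ab'] := ab.
have E1 := cumulative_rate_oc ab.
rewrite -lee_fin E1 -lee_fin E1 integral_ge0 ?integral_oc_le//.
  by move=> u _; rewrite k0 kc.
by move=> u _; rewrite lee_fin.
Qed.

(** On []a, b]] the non-increasing factor [Gam] lies between [Gam b] and [Gam a]. The two bounds are
    the bracket to be fed to [eq_quadratic_increments]. *)
Lemma cumulative_rate_trap Gam a b : 0 <= a <= b ->
  measurable_fun setT Gam -> (forall u, 0 <= Gam u) ->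
  (forall u v, 0 <= u <= v -> Gam v <= Gam u) ->
  ((Gam b * (cumulative_rate k b - cumulative_rate k a))%:E <=
    \int[leb1]_(u in `]a, b]) (k u * Gam u)%:E <=
  (Gam a * (cumulative_rate k b - cumulative_rate k a))%:E)%E.
Proof.
move=> ab mG G0 dG; have /andP[a0 ab'] := ab.
have E1 := cumulative_rate_oc ab.
have mkG : measurable_fun `]a, b] (fun u => (k u * Gam u)%:E).
  by apply/measurable_EFinP/measurable_funTS; exact: measurable_funM.
have E2 x : (Gam x * (cumulative_rate k b - cumulative_rate k a))%:E =
    (\int[leb1]_(u in `]a, b]) (Gam x * k u)%:E)%E.
  rewrite EFinM E1 -ge0_integralZl_EFin// => u _; by rewrite lee_fin.
rewrite !E2; apply/andP; split; apply: ge0_le_integral => //.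
- by move=> u _; rewrite lee_fin mulr_ge0.
- by apply/measurable_EFinP/measurable_funTS; exact: measurable_funM.
- move=> u /=; rewrite in_itv/= => /andP[au ub].
  by rewrite lee_fin mulrC ler_wpM2l// dG// ub (le_trans a0)// ltW.
- by move=> u _; rewrite lee_fin mulr_ge0.
- by apply/measurable_EFinP/measurable_funTS; exact: measurable_funM.
- move=> u /=; rewrite in_itv/= => /andP[au ub].
  by rewrite lee_fin mulrC ler_wpM2r// dG// a0 ltW.
Qed.

End cumulative.

(* The rates are only measurable, so exp (- int k) need not be differentiable:
   its integral identities follow from bounds on the increments of both sides
   that agree up to O((b - a)^2). *)
Lemma eq_quadratic_increments (R : realType) (f r : R -> R) (C : R) :
  (forall a b, 0 <= a <= b -> exists m M, [/\ m <= f b - f a <= M,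
    m <= r b - r a <= M & M - m <= C * (b - a) ^+ 2]) ->
  f 0 = r 0 -> forall b, 0 <= b -> f b = r b.
Proof.
move=> fr fr0 b b0; apply/eqP; rewrite eq_le; apply/andP; split.
  have := @quadratic_increments _ (fun s => f s - r s) C _ b b0.
  rewrite fr0 subrr subr_le0; apply => x y /fr[m [M [/andP[? ?] /andP[? ?] ?]]].
  by lra.
have := @quadratic_increments _ (fun s => r s - f s) C _ b b0.
rewrite fr0 subrr subr_le0; apply => x y /fr[m [M [/andP[? ?] /andP[? ?] ?]]].
by lra.
Qed.

Section survival_rate.
Context (R : realType).
Variables (k : R -> R) (c : R).
Hypotheses (mk : measurable_fun setT k) (k0 : forall u, 0 <= k u).
Hypothesis kc : forall u, k u <= c.
Local Notation L := (cumulative_rate k).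
Local Notation G := (survival_rate k).

Lemma survival_rate_le1 s : G s <= 1.
Proof. by rewrite !survival_rate.unlock -expR0 ler_expR oppr_le0 (cumulative_rate_ge0 mk k0 kc). Qed.

Lemma survival_rate_gt0 s : 0 < G s. Proof. by rewrite survival_rate.unlock expR_gt0. Qed.

Lemma survival_rate0 s : s <= 0 -> G s = 1.
Proof. by move=> s0; rewrite !survival_rate.unlock (cumulative_rate0 mk k0 kc)// oppr0 expR0. Qed.

Lemma survival_rate_nonincreasing a b : 0 <= a <= b -> G b <= G a.
Proof.
move=> ab; rewrite !survival_rate.unlock ler_expR lerN2 -subr_ge0.
by have /andP[] := cumulative_rateB mk k0 kc ab.
Qed.

(** This is [1 + x <= expR x] at [x = L b - L a] and at its opposite, with
    [G a / G b = expR (L b - L a)]. It stands in for the mean value theorem. *)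
Lemma survival_rateB a b : 0 <= a <= b ->
  G b * (L b - L a) <= G a - G b <= G a * (L b - L a).
Proof.
move=> ab; have Gba : G b = G a * expR (- (L b - L a)).
  by rewrite !survival_rate.unlock -expRD; congr expR; lra.
have Gab : G a = G b * expR (L b - L a).
  by rewrite !survival_rate.unlock -expRD; congr expR; lra.
apply/andP; split.
  rewrite [in leRHS]Gab -[X in _ <= _ - X]mulr1 -mulrBr ler_wpM2l//.
    exact/ltW/survival_rate_gt0.
  have := expR_ge1Dx (L b - L a); lra.
rewrite [in leLHS]Gba -[X in X - _ <= _]mulr1 -mulrBr ler_wpM2l//.
  exact/ltW/survival_rate_gt0.
have := expR_ge1Dx (- (L b - L a)); lra.
Qed.

End survival_rate.

Section survival_integral.
Context (R : realType).

Lemma measurable_bool_set d (T : measurableType d) (b : T -> bool) :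
  measurable_fun setT b -> measurable [set x | b x].
Proof.
by move=> mb; rewrite -[X in measurable X]setTI; exact: (mb measurableT [set true]).
Qed.

Lemma measurable_cumulative_rate d (T : measurableType d) (h : T * R -> R) (c : R) :
  measurable_fun setT h -> (forall z, 0 <= h z) -> (forall z, h z <= c) ->
  measurable_fun setT (fun z : T * R => cumulative_rate (fun u => h (z.1, u)) z.2).
Proof.
move=> mh h0 hc; apply/measurable_EFinP.
(* The upper limit of integration is itself a variable. Moving it into the integrand makes the
   integral a section integral, measurable in both variables jointly by Tonelli. *)
pose F (p : (T * R) * R) : \bar R :=
  (if (0 <= p.2) && (p.2 <= p.1.2) then h (p.1.1, p.2) else 0)%:E.
rewrite [X in measurable_fun _ X](_ : _ = fubini_F leb1 F); last first.
  apply/funext => -[w s]/=.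
  rewrite (@cumulative_rateE _ _ c)//; last exact: measurableT_comp.
  rewrite integral_mkcond; apply: eq_integral => u _.
  rewrite /F patchE/=; case: (boolP (0 <= u <= s)) => us.
    by rewrite mem_set//= in_itv.
  by rewrite memNset//= in_itv/=; exact/negP.
apply: measurable_fun_fubini_tonelli_F => [|p].
  apply/measurable_EFinP; apply: measurable_fun_ifT => //.
  - apply: measurable_and; apply: measurable_fun_ler => //.
    by apply: measurableT_comp => //; exact: measurable_fst.
  - apply: measurableT_comp => //; apply: measurable_fun_pair => //.
    by apply: measurableT_comp => //; exact: measurable_fst.
by rewrite /F lee_fin; case: ifP.
Qed.

Lemma measurable_survival_rate d (T : measurableType d) (h : T * R -> R) (c : R) :
  measurable_fun setT h -> (forall z, 0 <= h z) -> (forall z, h z <= c) ->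
  measurable_fun setT (fun z : T * R => survival_rate (fun u => h (z.1, u)) z.2).
Proof.
move=> mh h0 hc; under eq_fun do rewrite survival_rate.unlock.
apply: measurableT_comp => //; apply: measurableT_comp => //.
exact: measurable_cumulative_rate hc.
Qed.

End survival_integral.

(** * Competing clocks *)

Section survival_integral1.
Context (R : realType).
Variables (k : R -> R) (c : R).
Hypotheses (mk : measurable_fun setT k) (k0 : forall u, 0 <= k u).
Hypothesis kc : forall u, k u <= c.
Local Notation L := (cumulative_rate k).
Local Notation G := (survival_rate k).

Lemma measurable_survival_rate1 : measurable_fun setT G.
Proof.
have mh : measurable_fun setT (fun z : R * R => k z.2) by exact: measurableT_comp.
exact: (measurable_snd_section (0 : R) (measurable_survival_rate mh (fun z => k0 z.2) (fun z => kc z.2))).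
Qed.

(** [k u * G u] is the density of the ringing time of a clock of rate [k]. Over [[a, b]] both sides
    increase by an amount between [G b * (L b - L a)] and [G a * (L b - L a)]. The gap is a product
    of two factors at most [c * (b - a)], whence the constant [c ^+ 2]. *)
Lemma survival_rate_integral s : 0 <= s ->
  cumulative_rate (fun u => k u * G u) s = 1 - G s.
Proof.
have mkG : measurable_fun setT (fun u => k u * G u).
  by apply: measurable_funM => //; exact: measurable_survival_rate1.
have kG0 u : 0 <= k u * G u by rewrite mulr_ge0// ltW// survival_rate_gt0.
have kGc u : k u * G u <= c.
  by rewrite (le_trans _ (kc u))// ler_piMr// (survival_rate_le1 mk k0 kc).
move: s; apply: (@eq_quadratic_increments _ _ _ (c ^+ 2)); last first.
  by rewrite (cumulative_rate0 mkG kG0 kGc)// (survival_rate0 mk k0 kc)// subrr.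
move=> a b ab; exists (G b * (L b - L a)), (G a * (L b - L a)).
have /andP[DL0 DLc] := cumulative_rateB mk k0 kc ab.
have /andP[GB1 GB2] := survival_rateB k ab.
split.
- rewrite -!lee_fin (cumulative_rate_oc mkG kG0 kGc ab).
  apply: (cumulative_rate_trap mk k0 kc ab) => //.
  + exact: measurable_survival_rate1.
  + by move=> u; exact/ltW/survival_rate_gt0.
  + by move=> u v uv; exact: (survival_rate_nonincreasing mk k0 kc).
- have -> : (1 - G b) - (1 - G a) = G a - G b by ring.
  by rewrite GB1 GB2.
- rewrite -mulrBl -exprMn expr2 ler_pM//.
    by rewrite subr_ge0 (survival_rate_nonincreasing mk k0 kc).
  rewrite (le_trans GB2)// (le_trans _ DLc)// ler_piMl//.
  exact: survival_rate_le1 mk k0 kc _.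
Qed.

End survival_integral1.

(** Half-lines of this form are stable under intersection and turn a law on the line into its
    distribution function, which is what [race_cdf] computes. *)
Lemma RgenNyC (R : realType) : @measurable _ R = <<s [set `]-oo, x]%classic | x in [set: R]] >>.
Proof.
have -> : @measurable _ R = (@ocitv R).-sigma.-measurable by [].
rewrite RGenOInfty.measurableE; apply/seteqP; split.
  apply: smallest_sub; first exact: smallest_sigma_algebra.
  move=> _ [x ->]; rewrite -setCitvl.
  apply: sigma_algebraC; apply: sub_sigma_algebra; by exists x.
apply: smallest_sub; first exact: smallest_sigma_algebra.
move=> _ [x _ <-]; rewrite -setCitvr.
by apply: sigma_algebraC; apply: sub_sigma_algebra; exists x.
Qed.

Section race.
Context (R : realType) dT (T : measurableType dT) (P : probability T R).
Variable F : set (set T).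
Hypotheses (sF : sigma_algebra setT F) (Fm : F `<=` measurable).
Local Notation TF := (g_sigma_algebraType F).
Variables (S S' : T -> \bar R) (h h' : T * R -> R) (c : R) (A0 : set T).
Hypotheses (mS : measurable_fun setT S) (mS' : measurable_fun setT S').
Hypothesis S0 : forall w, (0 <= S w)%E.
Hypotheses (mh : measurable_fun setT h) (mh' : measurable_fun setT h').
Hypotheses (h0 : forall z, 0 <= h z) (h'0 : forall z, 0 <= h' z).
Hypotheses (hc : forall z, h z <= c) (h'c : forall z, h' z <= c).
Local Notation G w := (survival_rate (fun u => h (w, u))).
Local Notation G' w := (survival_rate (fun u => h' (w, u))).
Hypothesis FA0 : F A0.
Hypothesis clocks : forall A a b, F A -> A `<=` A0 -> 0 <= a -> 0 <= b ->
  P (A `&` [set w | (a%:E < S w)%E /\ (b%:E < S' w)%E]) =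
  (\int[P]_(w in A) (G w a * G' w b)%:E)%E.
Variable Q : set T.
Hypotheses (mQ : measurable Q) (Qfin : forall w, Q w -> (S w < +oo)%E).
Hypothesis QS : forall w, Q w -> (S w <= S' w)%E.
Hypothesis SQ : forall w, (S w < S' w)%E -> Q w.

Let L w := cumulative_rate (fun u => h (w, u)).
Let mhw w : measurable_fun setT (fun u => h (w, u)).
Proof. exact: measurableT_comp. Qed.
Let mh'w w : measurable_fun setT (fun u => h' (w, u)).
Proof. exact: measurableT_comp. Qed.
Let h0w w u : 0 <= h (w, u). Proof. by []. Qed.
Let h'0w w u : 0 <= h' (w, u). Proof. by []. Qed.
Let hcw w u : h (w, u) <= c. Proof. by []. Qed.
Let h'cw w u : h' (w, u) <= c. Proof. by []. Qed.
Let Gam w s := G w s * G' w s.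
Let rho (z : T * R) := h z * Gam z.1 z.2.

Let mGam : measurable_fun setT (fun z : T * R => Gam z.1 z.2).
Proof.
apply: measurable_funM.
  exact: measurable_survival_rate mh h0 hc.
exact: measurable_survival_rate mh' h'0 h'c.
Qed.
Let mrho : measurable_fun setT rho.
Proof. exact: measurable_funM. Qed.
Let Gam_ge0 w s : 0 <= Gam w s.
Proof. by rewrite mulr_ge0// ltW// survival_rate_gt0. Qed.
Let Gam_le1 w s : Gam w s <= 1.
Proof.
by rewrite mulr_ile1// ?(ltW (survival_rate_gt0 _ _))//;
  [exact: (survival_rate_le1 (mhw w) (h0w w) (hcw w))|
  exact: (survival_rate_le1 (mh'w w) (h'0w w) (h'cw w))].
Qed.
Let rho0 z : 0 <= rho z. Proof. by rewrite mulr_ge0. Qed.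
Let rhoc z : rho z <= c.
Proof. by rewrite (le_trans _ (hc z))// ler_piMr. Qed.
Let rhow w := fun s => rho (w, s).
Let mrhow w : measurable_fun setT (rhow w).
Proof. exact: measurableT_comp. Qed.

Let bounded_integrable (B : set T) (u : T -> R) (K : R) : measurable B ->
  measurable_fun setT u -> (forall w, 0 <= u w <= K) ->
  P.-integrable B (EFin \o u).
Proof.
move=> mB mu uK; apply: (@le_integrable _ _ _ _ _ _ _ (cst K%:E)) => //.
- by apply/measurable_EFinP; exact: measurable_funTS.
- move=> w _ /=; have /andP[u0 uK'] := uK w.
  by rewrite lee_fin !ger0_norm// (le_trans u0).
- apply/integrableP; split => //=; rewrite integral_cst// /abse.
  by rewrite ltey_eq fin_numM// fin_num_measure.
Qed.

(** [Q] is only known to lie between [S < S'] and [S <= S'], so a tie may be awarded to either clock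
    and its probability never has to be evaluated. As functions of [b], both sides vary over
    [[a, b]] by an amount between the integrals over [A] of [Gam w b * (L w b - L w a)] and of
    [Gam w a * (L w b - L w a)]. *)
Lemma race_cdf (A : set T) (b : R) : F A -> A `<=` A0 -> 0 <= b ->
  fine (P (A `&` Q `&` [set w | (S w <= b%:E)%E])) =
  \int[P]_(w in A) cumulative_rate (rhow w) b.
Proof.
move=> FA AA0.
have mA : measurable A by exact: Fm.
have mSle (s : R) : measurable [set w | (S w <= s%:E)%E].
  by rewrite -[X in measurable X]setTI; exact: emeasurable_fun_infty_c.
have mSgt (s : R) : measurable [set w | (s%:E < S w)%E].
  by rewrite -[X in measurable X]setTI; exact: emeasurable_fun_o_infty.
have mS'gt (s : R) : measurable [set w | (s%:E < S' w)%E].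
  by rewrite -[X in measurable X]setTI; exact: emeasurable_fun_o_infty.
pose p X := fine (P X).
have pfin X : measurable X -> P X \is a fin_num by move=> mX; exact: fin_num_measure.
have pD X Y : measurable X -> measurable Y -> Y `<=` X -> p (X `\` Y) = p X - p Y.
  move=> mX mY YX; rewrite /p measureD ?(setIidr YX)//; last by rewrite ltey_eq pfin.
  by rewrite fineB// pfin.
have pS X Y : measurable X -> measurable Y -> X `<=` Y -> p X <= p Y.
  by move=> mX mY XY; rewrite fine_le ?pfin// le_measure// inE.
have c0 : 0 <= c by apply: (le_trans (h0 (point, 0))).
have DL w a s : 0 <= a <= s -> 0 <= L w s - L w a <= c * (s - a).
  exact: cumulative_rateB (mhw w) (h0w w) (hcw w) a s.
have mL s : measurable_fun setT (L ^~ s).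
  exact: (measurable_fst_section s (measurable_cumulative_rate mh h0 hc)).
have mGams s : measurable_fun setT (Gam ^~ s).
  exact: (measurable_fst_section s mGam).
have mC s : measurable_fun setT (fun w => cumulative_rate (rhow w) s).
  exact: (measurable_fst_section s (measurable_cumulative_rate mrho rho0 rhoc)).
have Gamdec w x y : 0 <= x <= y -> Gam w y <= Gam w x.
    move=> xy; apply: ler_pM; rewrite ?(ltW (survival_rate_gt0 _ _))//.
      exact: survival_rate_nonincreasing (mhw w) (h0w w) (hcw w) _ _ xy.
    exact: survival_rate_nonincreasing (mh'w w) (h'0w w) (h'cw w) _ _ xy.
(* Over [[a, b]] each of [G] and [G'] loses at most [c * (b - a)], so [Gam] loses at most twice
   that, and [L] gains at most [c * (b - a)]: the product gives [2 * c ^+ 2]. *)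
move: b; apply: (@eq_quadratic_increments _ _ _ (2 * c ^+ 2)).
  move=> a b ab; have /andP[a0 ab'] := ab.
  pose u x w := Gam w x * (L w b - L w a).
  have iu x : P.-integrable A (EFin \o u x).
    apply: (bounded_integrable mA (K := c * (b - a))).
      by apply: measurable_funM => //; exact: measurable_funB.
    move=> w; have /andP[L1 L2] := DL w _ _ ab.
    by rewrite mulr_ge0//= (le_trans _ L2)// ler_piMl.
  have iC x : 0 <= x -> P.-integrable A (EFin \o (fun w => cumulative_rate (rhow w) x)).
    move=> x0; apply: (bounded_integrable mA (K := c * x)) => // w.
    have := @cumulative_rateB _ _ _ (mrhow w) (fun=> rho0 _) (fun=> rhoc _) 0 x.
    rewrite lexx x0 => /(_ isT).
    by rewrite (@cumulative_rate0 _ _ _ (mrhow w) (fun=> rho0 _) (fun=> rhoc _) 0)// !subr0.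
  have iGG x y : P.-integrable A (EFin \o (fun w => G w x * G' w y)).
    apply: (bounded_integrable mA (K := 1)).
      apply: measurable_funM.
        exact: (measurable_fst_section x (measurable_survival_rate mh h0 hc)).
      exact: (measurable_fst_section y (measurable_survival_rate mh' h'0 h'c)).
    move=> w; rewrite mulr_ge0 ?(ltW (survival_rate_gt0 _ _))//=.
    by rewrite mulr_ile1 ?(ltW (survival_rate_gt0 _ _))//;
      [exact: (survival_rate_le1 (mhw w) (h0w w) (hcw w))|
      exact: (survival_rate_le1 (mh'w w) (h'0w w) (h'cw w))].
  have iB f g : P.-integrable A (EFin \o f) -> P.-integrable A (EFin \o g) ->
      P.-integrable A (EFin \o (fun w => f w - g w)).
    by move=> i_f i_g; exact: (integrableB mA i_f i_g).
  have pGG x y : 0 <= x -> 0 <= y ->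
      p (A `&` [set w | (x%:E < S w)%E /\ (y%:E < S' w)%E]) =
      \int[P]_(w in A) (G w x * G' w y).
    by move=> x0 y0; rewrite /p clocks.
  have mGG x y : measurable (A `&` [set w | (x%:E < S w)%E /\ (y%:E < S' w)%E]).
    by apply: measurableI => //; apply: measurableI; [exact: mSgt|exact: mS'gt].
  have mQle x : measurable (A `&` Q `&` [set w | (S w <= x%:E)%E]).
    by apply: measurableI; [exact: measurableI|exact: mSle].
  have b0 : 0 <= b by exact: le_trans ab'.
  exists (\int[P]_(w in A) u b w), (\int[P]_(w in A) u a w); split.
  - rewrite -/(p _) -/(p _) -pD//; last first.
      by move=> w [AQ Swa]; split => //=; apply: (le_trans Swa); rewrite lee_fin.
    apply/andP; split.
      (* Lower bound: if [a < S <= b < S'] then [S] rings strictly first, hence [Q] holds. *)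
      apply: (@le_trans _ _ (p ((A `&` [set w | (a%:E < S w)%E /\ (b%:E < S' w)%E]) `\`
          (A `&` [set w | (b%:E < S w)%E /\ (b%:E < S' w)%E])))).
        rewrite pD//; last first.
          move=> w [Aw [bS bS']]; split => //; split => //.
          by apply: le_lt_trans bS; rewrite lee_fin.
        rewrite !pGG// -RintegralB//.
        apply: le_Rintegral => //; first by apply: iB; exact: iGG.
        move=> w Aw; rewrite /u /Gam -mulrBl mulrAC ler_wpM2r//.
          exact/ltW/survival_rate_gt0.
        by have /andP[] := survival_rateB (fun u => h (w, u)) ab.
      apply: pS; [exact: measurableD|exact: measurableD|].
      move=> w [[Aw [aS bS']] /not_andP[//|nS]].
      have Sb : (S w <= b%:E)%E.
        by rewrite leNgt; apply/negP => bS; apply: nS.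
      split; last by move=> [_] /=; rewrite leNgt aS.
      by split => //; split => //; apply: SQ; exact: le_lt_trans bS'.
    (* Upper bound: on [Q], [a < S <= b] implies [a < S'], because [S <= S']. *)
    apply: (@le_trans _ _ (p ((A `&` [set w | (a%:E < S w)%E /\ (a%:E < S' w)%E]) `\`
        (A `&` [set w | (b%:E < S w)%E /\ (a%:E < S' w)%E])))).
      apply: pS; [exact: measurableD|exact: measurableD|].
      move=> w [[[Aw Qw] /= Sb] /not_andP[/(_ (conj Aw Qw))//|/negP Sa]].
      have {Sa} aS : (a%:E < S w)%E by rewrite ltNge.
      split; first by split => //; split => //; exact: lt_le_trans (QS Qw).
      by move=> [_ [bS _]]; move: bS; rewrite ltNge Sb.
    rewrite pD//; last first.
      move=> w [Aw [bS aS']]; split => //; split => //.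
      by apply: le_lt_trans bS; rewrite lee_fin.
    rewrite !pGG// -RintegralB//.
    apply: le_Rintegral => //; first by apply: iB; exact: iGG.
    move=> w Aw; rewrite /u /Gam -mulrBl [leRHS]mulrAC ler_wpM2r//.
      exact/ltW/survival_rate_gt0.
    by have /andP[] := survival_rateB (fun u => h (w, u)) ab.
  - rewrite -RintegralB ?iC//.
    have trap w := cumulative_rate_trap (mhw w) (h0w w) (hcw w) ab
      (measurable_snd_section w mGam)
      (Gam_ge0 w) (Gamdec w).
    have trapR w : u b w <= cumulative_rate (rhow w) b - cumulative_rate (rhow w) a <= u a w.
      rewrite -!lee_fin (cumulative_rate_oc (mrhow w) (fun=> rho0 _) (fun=> rhoc _) ab).
      exact: (trap w).
    apply/andP; split; apply: le_Rintegral => //; do ?[exact: iu|by apply: iB; exact: iC].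
      by move=> w _; have /andP[] := trapR w.
    by move=> w _; have /andP[] := trapR w.
  - rewrite -RintegralB//; [|exact: iu..].
    apply: (@le_trans _ _ (\int[P]_(w in A) (2 * c ^+ 2 * (b - a) ^+ 2))).
      apply: le_Rintegral => //.
      + by apply: iB; exact: iu.
      + apply: (bounded_integrable mA (K := 2 * c ^+ 2 * (b - a) ^+ 2)) => // w.
        by rewrite lexx andbT mulr_ge0 ?sqr_ge0// mulr_ge0 ?sqr_ge0.
      move=> w _; rewrite /u -mulrBl.
      have /andP[DL0 DLc] := DL w _ _ ab.
      have /andP[_ GB] := survival_rateB (fun u => h (w, u)) ab.
      have /andP[_ G'B] := survival_rateB (fun u => h' (w, u)) ab.
      have /andP[DL'0 DL'c] := cumulative_rateB (mh'w w) (h'0w w) (h'cw w) ab.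
      have Ga1 := survival_rate_le1 (mhw w) (h0w w) (hcw w).
      have G'a1 := survival_rate_le1 (mh'w w) (h'0w w) (h'cw w).
      have GBc : G w a - G w b <= c * (b - a).
        rewrite (le_trans GB)// (le_trans _ DLc)// ler_piMl//.
      have G'Bc : G' w a - G' w b <= c * (b - a).
        rewrite (le_trans G'B)// (le_trans _ DL'c)// ler_piMl//.
      have -> : 2 * c ^+ 2 * (b - a) ^+ 2 = (c * (b - a) + c * (b - a)) * (c * (b - a)).
        by ring.
      apply: ler_pM => //.
        by rewrite subr_ge0 Gamdec.
      rewrite /Gam (_ : _ - _ = (G w a - G w b) * G' w a + G w b * (G' w a - G' w b)); last first.
        by ring.
      apply: lerD.
        rewrite (le_trans _ GBc)// ler_piMr//.
        by rewrite subr_ge0; exact: survival_rate_nonincreasing (mhw w) (h0w w) (hcw w) _ _ ab.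
      rewrite (le_trans _ G'Bc)// ler_piMl//.
      by rewrite subr_ge0; exact: survival_rate_nonincreasing (mh'w w) (h'0w w) (h'cw w) _ _ ab.
    rewrite Rintegral_cst// ler_piMr//; first by rewrite mulr_ge0 ?sqr_ge0// mulr_ge0 ?sqr_ge0.
    by rewrite -lee_fin fineK ?pfin// probability_le1.
rewrite (_ : \int[P]_(w in A) _ = 0); last first.
  rewrite (_ : \int[P]_(w in A) _ = \int[P]_(w in A) 0).
    by rewrite Rintegral_cst// mul0r.
  apply: eq_Rintegral => w _.
  exact: (@cumulative_rate0 _ _ _ (mrhow w) (fun=> rho0 _) (fun=> rhoc _)).
(* At [b = 0] the claim is that [S] does not ring at age 0: both survival functions are 1 there, so
   [A'] has the same probability as [A]. *)
pose A' := A `&` [set w | (0%:E < S w)%E /\ (0%:E < S' w)%E].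
have mA' : measurable A'.
  by apply: measurableI => //; apply: measurableI; [exact: mSgt|exact: mS'gt].
apply/eqP; rewrite eq_le fine_ge0// andbT.
apply: (@le_trans _ _ (p (A `\` A'))).
  apply: pS; [|exact: measurableD|].
    by apply: measurableI; [exact: measurableI|exact: mSle].
  move=> w [[Aw _] Sw0]; split => //; move=> [_ [/= Sw _]].
  by move: Sw; rewrite ltNge Sw0.
rewrite pD//; last by move=> w [].
rewrite subr_le0 /p /A' clocks// (_ : (\int[P]_(w in A) _ = P A)%E)//.
rewrite (eq_integral (cst 1%E)) ?integral_cst ?mul1e// => w _.
rewrite (survival_rate0 (mhw w) (h0w w) (hcw w))//.
by rewrite (survival_rate0 (mh'w w) (h'0w w) (h'cw w))// mulr1.
Qed.

(* the first of two competing clocks, on the event Q that it is S *)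
Lemma race (Phi : TF * R -> \bar R) : measurable_fun setT Phi ->
  (forall z, 0 <= Phi z)%E ->
  (\int[P]_(w in A0 `&` Q) Phi (w, fine (S w)) =
   \int[P]_(w in A0) \int[leb1]_(s in `[0%R, +oo[)
     (Phi (w, s) * (h (w, s) * (G w s * G' w s))%:E))%E.
Proof.
move=> mPhi Phi0.
have mA0 : measurable A0 by exact: Fm.
have mid : measurable_fun setT (idfun : T -> TF).
  move=> _ B; rewrite setTI => mB; apply: Fm.
  by move: mB; rewrite /measurable/= sigma_algebra_id.
(* [law_single] integrates over all of [T] and of [R], so the density is extended by 0 off [A0] and
   at negative ages. *)
pose rho' (z : T * R) := if (z.1 \in A0) && (0 <= z.2) then rho z else 0.
have mrho' : measurable_fun setT rho'.
  apply: measurable_fun_ifT => //; apply: measurable_and.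
    apply: (@measurableT_comp _ _ _ _ _ _ (fun w => w \in A0)); last exact: measurable_fst.
    exact: measurable_in_set.
  exact: measurable_fun_ler.
have rho'0 z : 0 <= rho' z by rewrite /rho'; case: ifP.
have innerE w b : (\int[leb1]_(u in `]-oo, b]) (rho' (w, u))%:E =
    (if w \in A0 then cumulative_rate (rhow w) b else 0)%:E)%E.
  case: ifPn => wA0; last first.
    by rewrite integral0_eq// => u _; rewrite /rho'/= (negbTE wA0).
  rewrite (cumulative_rateE (mrhow w) (fun=> rho0 _) (fun=> rhoc _)).
  rewrite integral_mkcond [RHS]integral_mkcond; apply: eq_integral => u _.
  rewrite !patchE /rho'/= wA0/=; case: (boolP (u <= b)) => ub.
    rewrite mem_set/= ?in_itv//=; case: (boolP (0 <= u)) => u0.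
      by rewrite mem_set//= in_itv/= u0.
    by rewrite memNset//= in_itv/= (negbTE u0).
  by rewrite !memNset//= ?in_itv/= (negbTE ub)// andbF.
have c0 : 0 <= c by apply: (le_trans (h0 (point, 0))).
have cumc w b : 0 <= b -> 0 <= cumulative_rate (rhow w) b <= c * b.
  move=> b0.
  have := @cumulative_rateB _ _ _ (mrhow w) (fun=> rho0 _) (fun=> rhoc _) 0 b.
  rewrite lexx b0 => /(_ isT).
  by rewrite (@cumulative_rate0 _ _ _ (mrhow w) (fun=> rho0 _) (fun=> rhoc _) 0)// !subr0.
have mC s : measurable_fun setT (fun w => cumulative_rate (rhow w) s).
  exact: (measurable_fst_section s (measurable_cumulative_rate mrho rho0 rhoc)).
transitivity (\int[P]_w \int[leb1]_u (Phi (w, u) * (rho' (w, u))%:E))%E; last first.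
  rewrite [RHS]integral_mkcond; apply: eq_integral => w _; rewrite patchE.
  case: ifPn => wA0; last first.
    by rewrite integral0_eq// => u _; rewrite /rho'/= (negbTE wA0) mule0.
  rewrite [RHS]integral_mkcond; apply: eq_integral => u _; rewrite patchE /rho'/= wA0/=.
  case: (boolP (0 <= u)) => u0; first by rewrite mem_set//= in_itv/= u0.
  by rewrite memNset ?mule0//= in_itv/= andbT; exact/negP.
(* The age is tested on the half-lines []-oo, b]], on which the density formula is exactly
   [race_cdf]. *)
refine (@law_single R dT T _ TF _ R _ R P leb1 idfun snd rho' mid
  measurable_snd mrho' rho'0 _ (fun k => `]-oo, k%:R]%classic) (RgenNyC R)
  _ _ _ (A0 `&` Q) (fun w => fine (S w)) _ _ _ Phi mPhi Phi0).
- move=> _ _ [x _ <-] [y _ <-]; exists (Order.min x y) => //.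
  by apply/seteqP; split=> z/=; rewrite !in_itv/= le_min => /andP.
- by move=> k; exists k%:R.
- apply/seteqP; split=> // x _; exists (Num.truncn x).+1 => //=.
  by rewrite in_itv/= ltW// truncnS_gt.
- exact: measurableI.
- exact: measurableT_comp.
move=> A _ mA [b _ <-].
have {}mA : F A by move: mA; rewrite /measurable/= sigma_algebra_id.
under eq_integral do rewrite -[X in integral _ X _]/(`]-oo, b]%classic) innerE.
rewrite preimage_id.
have [b0|b0] := ltP b 0.
  rewrite [X in P X](_ : _ = set0); last first.
    apply/seteqP; split=> // w [_ /=]; rewrite in_itv/= leNgt.
    by rewrite (lt_le_trans b0)// fine_ge0.
  rewrite measure0 integral0_eq// => w _.
  by rewrite (@cumulative_rate0 _ _ _ (mrhow w) (fun=> rho0 _) (fun=> rhoc _) _ (ltW b0))//; case: ifP.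
have FAA0 : F (A `&` A0).
  have := @measurableI _ TF A A0; rewrite /measurable/= sigma_algebra_id//; exact.
transitivity (P (A `&` A0 `&` Q `&` [set w | (S w <= b%:E)%E])).
  congr (P _); apply/seteqP; split=> w.
    move=> [[[A0w Qw] Aw]] /=; rewrite in_itv/= => Swb; split => //.
    by rewrite -(fineK (_ : S w \is a fin_num)) ?lee_fin// ge0_fin_numE// Qfin.
  move=> [[[Aw A0w] Qw] /= Swb]; split => //; rewrite /= in_itv/=.
  by rewrite -lee_fin fineK// ge0_fin_numE// Qfin.
rewrite -[LHS]fineK; last first.
  apply: fin_num_measure; apply: measurableI.
    by apply: measurableI => //; exact: Fm.
  by rewrite -[X in measurable X]setTI; exact: emeasurable_fun_infty_c.
rewrite race_cdf//.
rewrite /Rintegral fineK; last first.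
  apply: integrable_fin_num; first exact: Fm.
  apply: (bounded_integrable (K := c * b)) => //; first exact: Fm.
  by move=> w; exact: cumc.
rewrite integral_mkcondr; apply: eq_integral => w _.
by rewrite patchE; case: ifP.
Qed.

End race.

Lemma cumulative_rateDr (R : realType) (k k' : R -> R) (c : R) s :
  measurable_fun setT k -> (forall u, 0 <= k u) -> (forall u, k u <= c) ->
  measurable_fun setT k' -> (forall u, 0 <= k' u) -> (forall u, k' u <= c) ->
  cumulative_rate (fun u => k u + k' u) s = cumulative_rate k s + cumulative_rate k' s.
Proof.
move=> mk k0 kc mk' k'0 k'c; apply: EFin_inj.
rewrite EFinD (cumulative_rateE mk k0 kc) (cumulative_rateE mk' k'0 k'c).
rewrite (@cumulative_rateE _ _ (c + c)); last 3 first.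
- exact: measurable_funD.
- by move=> u; rewrite addr_ge0.
- by move=> u; rewrite lerD.
under eq_integral do rewrite EFinD.
by rewrite ge0_integralD//; do ?[by apply/measurable_EFinP; exact: measurable_funTS|
  by move=> u _; rewrite lee_fin].
Qed.

Lemma survival_rateDr (R : realType) (k k' : R -> R) (c : R) s :
  measurable_fun setT k -> (forall u, 0 <= k u) -> (forall u, k u <= c) ->
  measurable_fun setT k' -> (forall u, 0 <= k' u) -> (forall u, k' u <= c) ->
  survival_rate (fun u => k u + k' u) s = survival_rate k s * survival_rate k' s.
Proof.
move=> *; rewrite !survival_rate.unlock (@cumulative_rateDr _ _ _ c)//.
by rewrite opprD expRD.
Qed.

Lemma survival_rate_cst0 (R : realType) (s : R) : survival_rate (fun=> 0) s = 1 :> R.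
Proof.
rewrite survival_rate.unlock cumulative_rate.unlock.
by rewrite /Rintegral integral0 oppr0 expR0.
Qed.

(** * Clocks stopped at an age known in advance *)

Section sub_sigma_algebra.
Local Open Scope ereal_scope.
Context (R : realType) dT (T : measurableType dT) (P : probability T R).
Variable F : set (set T).
Hypotheses (sF : sigma_algebra setT F) (Fm : F `<=` measurable).
Local Notation TF := (g_sigma_algebraType F).

Lemma sub_measurableE (A : set TF) : measurable A <-> F A.
Proof. by rewrite /measurable/= sigma_algebra_id. Qed.

Lemma sub_measurable_fun d (U : measurableType d) (f : T -> U) :
  measurable_fun setT (f : TF -> U) -> measurable_fun setT f.
Proof.
by move=> mf mT B mB; apply: Fm; apply/sub_measurableE; exact: mf.
Qed.

(** The hypothesis says that [f1] and [f2] have the same conditional expectation given [F]. They are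
    then interchangeable against any [F]-measurable factor, since they induce the same measure on
    [TF]. *)
Lemma eq_weights (f1 f2 : T -> R) :
  measurable_fun setT f1 -> (forall x, 0 <= f1 x)%R ->
  measurable_fun setT f2 -> (forall x, 0 <= f2 x)%R ->
  (forall B, F B -> \int[P]_(w in B) (f1 w)%:E = \int[P]_(w in B) (f2 w)%:E) ->
  forall Phi : T -> \bar R, measurable_fun setT (Phi : TF -> \bar R) ->
  (forall z, 0 <= Phi z) ->
  \int[P]_w (Phi w * (f1 w)%:E) = \int[P]_w (Phi w * (f2 w)%:E).
Proof.
move=> mf1 f10 mf2 f20 f12 Phi mPhi Phi0.
have mid : measurable_fun setT (idfun : T -> TF).
  by apply: sub_measurable_fun; exact: measurable_id.
have [nu1 [nu1E nu1I]] := weighted_pushforward P mf1 f10 mid.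
have [nu2 [nu2E nu2I]] := weighted_pushforward P mf2 f20 mid.
rewrite -nu1I// -nu2I//; apply: eq_measure_integral => A mA _.
by rewrite nu1E nu2E preimage_id f12//; exact/sub_measurableE.
Qed.

(** The law of a clock is prescribed at constant ages only, whereas a particle is observed at an age
    that depends on its birth time. An [F]-measurable age behaves like a constant: [race] against a
    clock that never rings gives the density of [kappa] given [F], which is then integrated up to
    [t w]. *)
Lemma survival_at (kappa : T -> \bar R) (h : T * R -> R) (c : R) (A0 : set T) :
  measurable_fun setT kappa -> (forall w, 0 <= kappa w) ->
  measurable_fun setT h -> (forall z, 0 <= h z)%R -> (forall z, h z <= c)%R ->
  F A0 ->
  (forall A a, F A -> A `<=` A0 -> (0 <= a)%R ->
     P (A `&` [set w | a%:E < kappa w]) =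
     \int[P]_(w in A) (survival_rate (fun u => h (w, u)) a)%:E) ->
  forall (t : T -> R) (Phi : T -> \bar R),
  measurable_fun setT (t : TF -> R) -> (forall w, A0 w -> 0 <= t w)%R ->
  measurable_fun setT (Phi : TF -> \bar R) -> (forall z, 0 <= Phi z) ->
  \int[P]_(w in A0 `&` [set w | (t w)%:E < kappa w]) Phi w =
  \int[P]_(w in A0) (Phi w * (survival_rate (fun u => h (w, u)) (t w))%:E).
Proof.
move=> mk k0 mh h0 hc FA0 kE t Phi mt t0 mPhi Phi0.
have mA0 := Fm FA0.
pose G w := survival_rate (fun u => h (w, u)).
have mt' : measurable_fun setT t by exact: sub_measurable_fun.
have mG : measurable_fun setT (fun w => G w (t w)).
  exact: (measurable_fun_pair_comp (measurable_survival_rate mh h0 hc)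
    (@measurable_id _ _ setT) mt').
have mE : measurable [set w | (t w)%:E < kappa w].
  rewrite -[X in measurable X]setTI; apply: measurable_lte => //.
  exact/measurable_EFinP.
pose f1 := (\1_(A0 `&` [set w | (t w)%:E < kappa w]) : T -> R).
pose f2 w : R := (\1_A0 w * G w (t w))%R.
transitivity (\int[P]_w (Phi w * (f1 w)%:E)).
  rewrite integral_mkcond; apply: eq_integral => w _; rewrite patchE /f1 indicE.
  by case: ifP => _; rewrite ?mule1 ?mule0.
transitivity (\int[P]_w (Phi w * (f2 w)%:E)); last first.
  rewrite [RHS]integral_mkcond; apply: eq_integral => w _; rewrite patchE /f2 indicE.
  by case: ifP => _; rewrite ?mul1r ?mul0r ?mule0.
apply: eq_weights => //.
- by apply: measurable_indic; exact: measurableI.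
- by apply: measurable_funM => //; exact: measurable_indic.
- by move=> w; rewrite mulr_ge0 ?(ltW (survival_rate_gt0 _ _)).
move=> B FB.
pose B0 := B `&` A0.
have FB0 : F B0.
  by apply/sub_measurableE; apply: measurableI; exact/sub_measurableE.
have B0A0 : B0 `<=` A0 by move=> w [].
have mB0 := Fm FB0; have mB := Fm FB.
(* Test function of the event that the clock has rung by the age [t w], on [B0]. *)
pose Psi (z : TF * R) : \bar R := if (z.1 \in B0) && (z.2 <= t z.1)%R then 1 else 0.
have mPsi : measurable_fun setT Psi.
  apply: measurable_fun_ifT => //; apply: measurable_and.
    apply: (@measurableT_comp _ _ _ _ _ _ (fun w : TF => w \in B0)); last exact: measurable_fst.
    by apply: measurable_in_set; exact/sub_measurableE.
  by apply: measurable_fun_ler => //; apply: measurableT_comp => //; exact: measurable_fst.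
have Psi0 z : 0 <= Psi z by rewrite /Psi; case: ifP.
pose Q := [set w | kappa w < +oo].
have mQ : measurable Q.
  by rewrite -[X in measurable X]setTI; exact: emeasurable_fun_infty_o.
(* [race] wants one bound for both rates; this one visibly dominates the null rate of the clock at
   infinity too. *)
have c0 (z : T * R) : (0 <= Num.max c 0%R)%R by rewrite le_max lexx orbT.
have hc0 z : (h z <= Num.max c 0%R)%R by rewrite le_max hc.
have clocks A a b : F A -> A `<=` A0 -> (0 <= a)%R -> (0 <= b)%R ->
    P (A `&` [set w | a%:E < kappa w /\ b%:E < +oo]) =
    \int[P]_(w in A) (survival_rate (fun u => h (w, u)) a *
      survival_rate (fun=> 0) b)%:E.
  move=> FA AA0 a0 _; rewrite (_ : [set w | _ /\ _] = [set w | a%:E < kappa w]).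
    rewrite kE//; apply: eq_integral => w _.
    by rewrite survival_rate_cst0 mulr1.
  by apply/seteqP; split=> w /= => [[]//|]; split => //; rewrite ltry.
pose z0 (_ : T * R) : R := 0%R.
have mz0 : measurable_fun setT z0 by exact: measurable_cst.
have z00 z : (0 <= z0 z)%R by exact: lexx.
have moo : measurable_fun setT (fun _ : T => +oo : \bar R) by exact: measurable_cst.
have := @race _ _ T P F sF Fm kappa (fun=> +oo) h z0 (Num.max c 0%R) A0 mk
  moo k0 mh mz0 h0 z00 hc0 c0 FA0 clocks Q mQ (fun=> id)
  (fun w _ => leey (kappa w)) (fun=> id) Psi mPsi Psi0.
have G1 w s : (G w s <= 1)%R.
  by apply: (@survival_rate_le1 _ _ c) => //; exact: measurable_snd_section w mh.
have -> : \int[P]_(w in A0 `&` Q) Psi (w, fine (kappa w)) =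
    P (B0 `&` [set w | kappa w <= (t w)%:E]).
  rewrite -[RHS]mul1e -integral_cst; last first.
    apply: measurableI => //; rewrite -[X in measurable X]setTI.
    by apply: measurable_lee => //; exact/measurable_EFinP.
  rewrite [LHS]integral_mkcond [RHS]integral_mkcond; apply: eq_integral => w _.
  rewrite !patchE /Psi/=; case: ifPn => [/set_mem[A0w Qw]|nQ].
    have Ew : (kappa w <= (t w)%:E) = (fine (kappa w) <= t w)%R.
      by rewrite -lee_fin fineK// ge0_fin_numE.
    case: ifPn => [/andP[/set_mem B0w tw]|tw].
      by rewrite mem_set//; split => //=; rewrite Ew.
    rewrite memNset// => -[B0w]; rewrite /= Ew => ktw.
    by move: tw; rewrite mem_set//= ktw.
  rewrite memNset// => -[B0w /= ktw]; move: nQ; rewrite mem_set//; split.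
    exact: B0A0.
  by rewrite /Q/= (le_lt_trans ktw)// ltry.
have -> : \int[P]_(w in A0) \int[leb1]_(s in `[0%R, +oo[)
    (Psi (w, s) * (h (w, s) * (survival_rate (fun u => h (w, u)) s * survival_rate (fun=> 0) s))%:E)
    = \int[P]_(w in B0) (1 - G w (t w))%:E.
  rewrite integral_mkcond [RHS]integral_mkcond; apply: eq_integral => w _.
  rewrite !patchE /Psi/=; case: (boolP (w \in B0)) => B0w /=; last first.
    by case: ifP => // _; rewrite integral0_eq// => s _; rewrite mul0e.
  have A0w : w \in A0 by apply/mem_set/B0A0/set_mem.
  rewrite A0w -(survival_rate_integral (measurable_snd_section w mh) (fun u => h0 (w, u)) (fun u => hc (w, u)) (t0 _ (set_mem A0w))).
  have mhG : measurable_fun setT (fun u => h (w, u) * G w u)%R.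
    apply: measurable_funM; first exact: measurable_snd_section.
    exact: measurable_survival_rate1 (measurable_snd_section w mh) (fun u => h0 (w, u)) (fun u => hc (w, u)).
  rewrite (@cumulative_rateE _ _ c mhG); last 2 first.
  - by move=> u; rewrite mulr_ge0// ltW// survival_rate_gt0.
  - by move=> u; rewrite (le_trans _ (hc (w, u)))// ler_piMr.
  rewrite integral_mkcond [RHS]integral_mkcond; apply: eq_integral => s _.
  rewrite !patchE survival_rate_cst0 mulr1; case: ifPn => [/set_mem/=|s0].
    rewrite in_itv/= andbT => s0; case: (leP s (t w)) => st.
      by rewrite mem_set ?mul1e//= in_itv/= s0.
    by rewrite memNset ?mul0e//= in_itv/= s0/=; apply/negP; rewrite -ltNge.
  rewrite memNset//= in_itv/= => /andP[s0' _].
  by move: s0; rewrite mem_set//= in_itv/= s0'.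
move=> E1.
have -> : \int[P]_(w in B) (f1 w)%:E = P (B0 `&` [set w | (t w)%:E < kappa w]).
  rewrite integral_indic//; last exact: measurableI.
  by rewrite setIC setIA.
have -> : \int[P]_(w in B) (f2 w)%:E = \int[P]_(w in B0) (G w (t w))%:E.
  rewrite integral_mkcondr; apply: eq_integral => w _; rewrite patchE /f2 indicE.
  by case: ifP; rewrite ?mul1r ?mul0r.
(* [race] has evaluated the event [kappa <= t w]. Survival is its complement in [B0], and [E2] and
   [E3] split [P B0] in the same way on both sides. *)
have E2 : P (B0 `&` [set w | (t w)%:E < kappa w]) + P (B0 `&` [set w | kappa w <= (t w)%:E]) = P B0.
  rewrite -measureU//.
  - rewrite -setIUr (_ : _ `|` _ = setT) ?setIT//.
    by apply/seteqP; split=> // w _ /=; case: (leP (kappa w) (t w)%:E); [right|left].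
  - exact: measurableI.
  - apply: measurableI => //; rewrite -[X in measurable X]setTI.
    by apply: measurable_lee => //; exact/measurable_EFinP.
  - apply/seteqP; split=> // w [[_ /= tk] [_ /=]]; by rewrite leNgt tk.
have E3 : \int[P]_(w in B0) (G w (t w))%:E + \int[P]_(w in B0) (1 - G w (t w))%:E = P B0.
  rewrite -ge0_integralD//.
  - under eq_integral do rewrite -EFinD subrKC.
    by rewrite integral_cst// mul1e.
  - by move=> w _; rewrite lee_fin ltW// survival_rate_gt0.
  - by apply/measurable_EFinP; exact: measurable_funTS.
  - by move=> w _; rewrite lee_fin subr_ge0 G1.
  - by apply/measurable_EFinP/measurable_funTS; exact: measurable_funB.
have pfin : P (B0 `&` [set w | kappa w <= (t w)%:E]) \is a fin_num.
  apply: fin_num_measure; apply: measurableI => //.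
  rewrite -[X in measurable X]setTI; apply: measurable_lee => //.
  exact/measurable_EFinP.
by move: E2; rewrite -E3 -E1 => E2; rewrite -[LHS](addeK _ pfin) E2 addeK.
Qed.

End sub_sigma_algebra.

(** * Exit times *)

(** [vec3 R] and [conf R] carry product sigma-algebras and product topologies. Open sets are
    measurable there because of a countable base of measurable sets. The property is stated for an
    arbitrary neighbourhood system [nb] so that it passes to products. *)
Definition measurable_base d (T : measurableType d) (nb : T -> set (set T)) :=
  exists B : nat -> set T, (forall n, measurable (B n)) /\
    forall x U, nb x U -> exists n, B n x /\ B n `<=` U.

Lemma measurable_base_R (R : realType) : measurable_base (nbhs : R -> set (set R)).
Proof.
pose B0 (p : rat * rat) : set R := `]ratr p.1, ratr p.2[%classic.
exists (fun n => if unpickle n is Some p then B0 p else set0); split.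
  by move=> n; case: unpickle => [p|]; [exact: measurable_itv|].
move=> x U /nbhs_ballP[e/= e0 xeU].
have [a /[!in_itv]/= /andP[ax1 ax2]] := @rat_in_itvoo R (x - e) x ltac:(by rewrite ltrBlDr ltrDl).
have [b /[!in_itv]/= /andP[bx1 bx2]] := @rat_in_itvoo R x (x + e) ltac:(by rewrite ltrDl).
exists (pickle (a, b)); rewrite pickleK; split; first by rewrite /B0/= in_itv/= ax2 bx1.
move=> y; rewrite /B0/= in_itv/= => /andP[ay yb]; apply: xeU => /=.
rewrite /ball/= ltr_norml; apply/andP; split; lra.
Qed.

Lemma measurable_base_prod d1 d2 (T1 : measurableType d1) (T2 : measurableType d2)
    nb1 nb2 : @measurable_base _ T1 nb1 -> @measurable_base _ T2 nb2 ->
  @measurable_base _ (T1 * T2)%type (fun z => filter_prod (nb1 z.1) (nb2 z.2)).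
Proof.
move=> [B1 [mB1 B1U]] [B2 [mB2 B2U]].
exists (fun n => if unpickle n is Some (p, q) then B1 p `*` B2 q else set0); split.
  by move=> n; case: unpickle => [[p q]|]; [exact: measurableX|].
move=> [x y] U /= [[U1 U2] /= [nU1 nU2] U12U].
have [p [B1x B1U1]] := B1U _ _ nU1; have [q [B2y B2U2]] := B2U _ _ nU2.
exists (pickle (p, q)); rewrite pickleK; split => // -[x' y'] [/= ? ?].
by apply: U12U; split; [exact: B1U1|exact: B2U2].
Qed.

Lemma measurable_base_open d (T : measurableType d) nb (U : set T) :
  measurable_base nb -> (forall x, U x -> nb x U) -> measurable U.
Proof.
move=> [B [mB BU]] oU.
rewrite [X in measurable X](_ : _ = \bigcup_n (if `[< B n `<=` U >] then B n else set0)).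
  by apply: bigcup_measurable => n _; case: ifP.
apply/seteqP; split=> [x Ux|x [n _]].
  have [n [Bx BnU]] := BU x U (oU x Ux).
  by exists n => //; case: asboolP.
by case: asboolP => // BnU /BnU.
Qed.

Section open_measurable.
Variable R : realType.

Lemma open_vec3_measurable (U : set (vec3 R)) : open U -> measurable U.
Proof.
move=> oU; apply: (@measurable_base_open _ _ (fun x : vec3 R => nbhs x)).
  have bR := measurable_base_R R.
  exact: (measurable_base_prod (measurable_base_prod bR bR) bR).
by move=> x Ux; exact: open_nbhs_nbhs.
Qed.

Lemma open_conf_time_measurable (U : set (conf R * R)) : open U -> measurable U.
Proof.
move=> oU; apply: (@measurable_base_open _ _ (fun x : conf R * R => nbhs x)).
  have bR := measurable_base_R R.
  have b3 := measurable_base_prod (measurable_base_prod bR bR) bR.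
  exact: (measurable_base_prod (measurable_base_prod b3 b3) bR).
by move=> x Ux; exact: open_nbhs_nbhs.
Qed.

Lemma measurable_enorm : measurable_fun setT (@enorm R).
Proof.
have m1 : measurable_fun setT (fun v : vec3 R => v.1.1) by exact: measurableT_comp.
have m2 : measurable_fun setT (fun v : vec3 R => v.1.2) by exact: measurableT_comp.
have m3 : measurable_fun setT (fun v : vec3 R => v.2) by exact: measurable_snd.
have ms : measurable_fun setT (Num.sqrt : R -> R).
  by apply: continuous_measurable_fun; exact: sqrt_continuous.
apply: (measurableT_comp ms); apply: measurable_funD; last exact: measurable_funX.
by apply: measurable_funD; exact: measurable_funX.
Qed.

Lemma measurable_shell (vmin vmax : R) : measurable (shell vmin vmax).
Proof.
apply: measurable_bool_set; apply: measurable_and; apply: measurable_fun_ler => //;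
  exact: measurable_enorm.
Qed.

(** Each coordinate is bounded by the Euclidean norm, so the shell lies in a cube of half-side
    [vmax]. *)
Lemma leb3_shell_fin (vmin vmax : R) : (leb3 (shell vmin vmax) < +oo)%E.
Proof.
pose I := `[- vmax, vmax]%classic.
have mI : measurable I by exact: measurable_itv.
have Ifin : (leb1 I < +oo)%E.
  by rewrite /leb1 lebesgue_measure_itv/=; case: ifP => _; rewrite ltry.
apply: (@le_lt_trans _ _ (leb3 ((I `*` I) `*` I))).
  apply: le_measure; rewrite ?inE.
  - exact: measurable_shell.
  - by apply: measurableX => //; exact: measurableX.
  move=> [[x y] z]; rewrite /shell /enorm/= => /andP[_ nv].
  set q := x ^+ 2 + _ + _ in nv.
  have vm0 : 0 <= vmax by rewrite (le_trans _ nv)// sqrtr_ge0.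
  have sq (a : R) : a ^+ 2 <= q -> I a.
    move=> aq; rewrite /I/= in_itv/= -ler_norml -sqrtr_sqr (le_trans _ nv)//.
    by rewrite ler_sqrt// (le_trans _ aq)// sqr_ge0.
  have [x0 y0 z0] := And3 (sqr_ge0 x) (sqr_ge0 y) (sqr_ge0 z).
  split; first by split; apply: sq; rewrite /q; lra.
  by apply: sq; rewrite /q; lra.
have mII := measurableX mI mI.
have IIfin : ((@leb1 R \x @leb1 R) (I `*` I) < +oo)%E.
  by rewrite product_measure1E// lte_mul_pinfty// ge0_fin_numE.
rewrite /leb3 (product_measure1E (@leb1 R \x @leb1 R)%E _ mII mI).
by rewrite lte_mul_pinfty// ge0_fin_numE.
Qed.

End open_measurable.

Section exit_time.
Variables (R : realType) (m l : nat) (D : set (vec3 R)).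
Hypothesis oD : open D.
Implicit Types (i : 'I_m) (x : conf R).

Lemma flight_snd i x (s : R) : (flight l i x s).2 = x.2.
Proof. by rewrite /flight; case: ifP. Qed.

Lemma exit_time_ge0 i x : (0 <= exit_time l D i x)%E.
Proof. by apply: le_ereal_inf_tmp => _ [s [s0 _] <-]; rewrite lee_fin. Qed.

(** The strict inequality comes from [D] being open: a flight that is in [D] up to the age [s]
    included stays there a little longer, so the infimum exceeds [s]. *)
Lemma lt_exit_timeP i x (s : R) : 0 <= s ->
  (s%:E < exit_time l D i x)%E <-> (forall u, 0 <= u <= s -> D (flight l i x u).1).
Proof.
move=> s0; split=> [sT u /andP[u0 us]|Dx].
  apply/not_notP => nD; move: sT; rewrite ltNge => /negP; apply.
  apply: (@le_trans _ _ u%:E); last by rewrite lee_fin.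
  by apply: ereal_inf_lbound; exists u.
have cf : {for s, continuous (fun u => (flight l i x u).1)}.
  rewrite /flight; case: (i < l)%N => /=; last by apply: (@cst_continuous _ _ x.1 s).
  apply: cvgD; first exact: cvg_cst.
  by apply: cvgZr_tmp.
have : \forall u \near s, D (flight l i x u).1.
  apply: (cf D); apply: open_nbhs_nbhs; split => //.
  by apply: Dx; rewrite s0 lexx.
move=> /nbhs_ballP[e/= e0 seD].
apply: (@lt_le_trans _ _ (s + e)%:E); first by rewrite lte_fin ltrDl.
apply: le_ereal_inf_tmp => _ [u [u0 nD] <-]; rewrite lee_fin leNgt; apply/negP => use.
apply: nD; have [us|su] := leP u s; first by apply: Dx; rewrite u0.
apply: seD; rewrite /ball/= distrC ger0_norm ?subr_ge0 1?ltW//.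
by rewrite ltrBlDl.
Qed.

Lemma flight_in i x s : 0 <= s -> (s%:E < exit_time l D i x)%E -> D (flight l i x s).1.
Proof. by move=> s0 /lt_exit_timeP; apply => //; rewrite s0 lexx. Qed.

Lemma measurable_flight i :
  measurable_fun setT (fun z : conf R * R => flight l i z.1 z.2).
Proof.
rewrite /flight; case: (i < l)%N; last exact: measurable_fst.
have m11 (p : conf R * R -> vec3 R) (q : conf R * R -> vec3 R) :
    measurable_fun setT p -> measurable_fun setT q ->
    measurable_fun setT (fun z => p z + z.2 *: q z).
  move=> mp mq.
  have mT (f g : conf R * R -> R) : measurable_fun setT f -> measurable_fun setT g ->
      measurable_fun setT (fun z : conf R * R => f z + z.2 * g z).
    move=> mf mg; apply: measurable_funD => //; apply: measurable_funM => //.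
  have c11 (f : conf R * R -> vec3 R) : measurable_fun setT f ->
      measurable_fun setT (fun z => (f z).1.1).
    by move=> mf; do 2?apply: measurableT_comp => //.
  have c12 (f : conf R * R -> vec3 R) : measurable_fun setT f ->
      measurable_fun setT (fun z => (f z).1.2).
    by move=> mf; do 2?apply: measurableT_comp => //.
  have c2 (f : conf R * R -> vec3 R) : measurable_fun setT f ->
      measurable_fun setT (fun z => (f z).2).
    by move=> mf; do 2?apply: measurableT_comp => //.
  apply: measurable_fun_pair; first apply: measurable_fun_pair.
  - exact: (mT _ _ (c11 _ mp) (c11 _ mq)).
  - exact: (mT _ _ (c12 _ mp) (c12 _ mq)).
  - exact: (mT _ _ (c2 _ mp) (c2 _ mq)).
have m12 : measurable_fun setT (fun z : conf R * R => z.1.2).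
  by apply: measurableT_comp => //; exact: measurable_fst.
apply: measurable_fun_pair => //; apply: m11 => //.
by apply: measurableT_comp => //; exact: measurable_fst.
Qed.

Lemma measurable_lt_exit_time i :
  measurable_fun setT (fun z : conf R * R => (z.2%:E < exit_time l D i z.1)%E).
Proof.
apply: (measurable_fun_bool true); rewrite setTI.
(* U is open because the flight up to the age z.2 is compact *)
pose U := [set z : conf R * R | forall u, `[0, 1]%classic u ->
  D (flight l i z.1 (u * z.2)).1].
have oU : open U.
  rewrite openE => z Uz; rewrite /interior.
  have /compact_near_coveringP cov : compact `[0, 1 : R]%classic by exact: segment_compact.
  (* For each [u] the position stays in [D] for all pairs near [(u, z)]. Compactness of [[0, 1]]
     turns this into one neighbourhood of [z] valid for all [u]. Ages are rescaled to [[0, 1]] so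
     that this compact set does not depend on [z]. *)
  apply: (cov _ (nbhs z) (fun z' u => D (flight l i z'.1 (u * z'.2)).1)) => u u01.
  have cg : {for (u, z), continuous (fun p : R * (conf R * R) =>
      (flight l i p.2.1 (p.1 * p.2.2)).1)}.
    have c2 : {for (u, z), continuous (fun p : R * (conf R * R) => p.2)} by exact: cvg_snd.
    have c21 : {for (u, z), continuous (fun p : R * (conf R * R) => p.2.1)}.
      exact: (cvg_comp _ _ c2 (@cvg_fst _ _ _ _ _)).
    have c22 : {for (u, z), continuous (fun p : R * (conf R * R) => p.2.2)}.
      exact: (cvg_comp _ _ c2 (@cvg_snd _ _ _ _ _)).
    have c211 : {for (u, z), continuous (fun p : R * (conf R * R) => p.2.1.1)}.
      exact: (cvg_comp _ _ c21 (@cvg_fst _ _ _ _ _)).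
    have c212 : {for (u, z), continuous (fun p : R * (conf R * R) => p.2.1.2)}.
      exact: (cvg_comp _ _ c21 (@cvg_snd _ _ _ _ _)).
    rewrite /flight; case: (i < l)%N => //=.
    apply: cvgD; first exact: c211.
    apply: cvgZ; last exact: c212.
    by apply: cvgM; [exact: cvg_fst|exact: c22].
  by apply: (cg D); apply: open_nbhs_nbhs; split => //; exact: Uz.
(* Negative ages are set apart: the comparison always holds there, exit times being non-negative. *)
rewrite [X in measurable X](_ : _ = [set z | z.2 < 0] `|` ([set z | 0 <= z.2] `&` U)).
  apply: measurableU.
    by apply: measurable_bool_set; apply: measurable_fun_ltr => //; exact: measurable_snd.
  apply: measurableI; last exact: open_conf_time_measurable.
  by apply: measurable_bool_set; apply: measurable_fun_ler => //; exact: measurable_snd.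
apply/seteqP; split=> -[x s] /=.
  move=> sT; have [s0|s0] := ltP s 0; [by left|right; split => // u].
  rewrite /= in_itv/= => /andP[u0 u1].
  by apply: (lt_exit_timeP i x s0).1 => //; rewrite mulr_ge0// ler_piMl.
move=> [s0|[s0 Uxs]].
  by rewrite (lt_le_trans _ (exit_time_ge0 i x))// lte_fin.
apply/(lt_exit_timeP i x s0) => u /andP[u0 us].
have [se|sn] := eqVneq s 0.
  have -> : u = 0 * s by apply/eqP; rewrite mul0r eq_le u0 -se us.
  by apply: Uxs; rewrite /= in_itv/= lexx ler01.
have sp : 0 < s by rewrite lt0r sn.
have -> : u = (u / s) * s by rewrite divfK.
by apply: Uxs; rewrite /= in_itv/= divr_ge0// ler_pdivrMr// mul1r.
Qed.

End exit_time.

(** * Cross sections *)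

Definition bounded_nonneg (R : realType) d (T : measurableType d) (f : T -> R) :=
  [/\ measurable_fun setT f, forall x, 0 <= f x & exists c, forall x, f x <= c].

Section bounded_nonneg.
Context (R : realType) d (T : measurableType d).
Implicit Types f g : T -> R.

Lemma bounded_nonnegD f g : bounded_nonneg f -> bounded_nonneg g ->
  bounded_nonneg (fun x => f x + g x).
Proof.
move=> [mf f0 [c fc]] [mg g0 [c' gc]]; split; first exact: measurable_funD.
  by move=> x; rewrite addr_ge0.
by exists (c + c') => x; rewrite lerD.
Qed.

Lemma bounded_nonnegM f g : bounded_nonneg f -> bounded_nonneg g ->
  bounded_nonneg (fun x => f x * g x).
Proof.
move=> [mf f0 [c fc]] [mg g0 [c' gc]]; split; first exact: measurable_funM.
  by move=> x; rewrite mulr_ge0.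
by exists (c * c') => x; rewrite ler_pM.
Qed.

Lemma bounded_nonneg_cst (k : R) : 0 <= k -> bounded_nonneg (fun _ : T => k).
Proof. by move=> k0; split => //; exists k. Qed.

Lemma bounded_nonneg_sum (I : Type) (r : seq I) (p : pred I) (F : I -> T -> R) :
  (forall i, p i -> bounded_nonneg (F i)) ->
  bounded_nonneg (fun x => \sum_(i <- r | p i) F i x).
Proof.
move=> bF; elim: r => [|i r IH].
  by under eq_fun do rewrite big_nil; exact: bounded_nonneg_cst.
under eq_fun do rewrite big_cons.
by case: (boolP (p i)) => // pi; apply: bounded_nonnegD => //; exact: bF.
Qed.

Lemma bounded_nonneg_comp d' (T' : measurableType d') f (g : T' -> T) :
  bounded_nonneg f -> measurable_fun setT g -> bounded_nonneg (fun x => f (g x)).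
Proof.
move=> [mf f0 [c fc]] mg; split => //; first exact: measurableT_comp.
by exists c.
Qed.

(** The data of the model are meaningful on [D * V] only. Extended by 0 they are measurable
    everywhere and can be composed with flights freely. Nothing changes along the processes, which
    stay in [D * V] by [walk_valid] and [emission_valid]. *)
Definition zero_off (A : set T) f (x : T) : R := if x \in A then f x else 0.

Lemma zero_offE (A : set T) f x : A x -> zero_off A f x = f x.
Proof. by move=> Ax; rewrite /zero_off mem_set. Qed.

Lemma zero_off_out (A : set T) f x : ~ A x -> zero_off A f x = 0.
Proof. by move=> Ax; rewrite /zero_off memNset. Qed.

Lemma bounded_nonneg_zero_off (A : set T) f : measurable A -> Lpos A f ->
  bounded_nonneg (zero_off A f).
Proof.
move=> mA [mf f0 [c fc]]; split.
- exact: (measurable_restrictT f mA).1 mf.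
- by move=> x; rewrite /zero_off; case: ifPn => // /set_mem; exact: f0.
exists (Num.max c 0) => x; rewrite /zero_off le_max; case: ifPn => [/set_mem Ax|].
  by rewrite fc.
by rewrite lexx orbT.
Qed.

End bounded_nonneg.

Section model.
Variables (R : realType) (m l : nat) (hl : (1 <= l < m)%N).
Variables (D : set (vec3 R)) (oD : open D) (vmin vmax : R).
Local Notation V := (shell vmin vmax).
Variable xs : cross_sections R m.
Hypothesis hxs : admissible_cross_sections l D V xs.
Local Notation DV := (D `*` V).
Local Notation flight := (flight l).

Lemma measurable_D : measurable D. Proof. exact: open_vec3_measurable. Qed.
Lemma measurable_DV : measurable (DV : set (conf R)).
Proof. by apply: measurableX; [exact: measurable_D|exact: measurable_shell]. Qed.
Lemma measurable_DVV : measurable ((DV `*` V) : set (conf R * vec3 R)).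
Proof. by apply: measurableX; [exact: measurable_DV|exact: measurable_shell]. Qed.

Definition scat i : conf R -> R := zero_off DV (scatter_rate l xs i).
Definition remo i : conf R -> R := zero_off DV (removal_rate l xs i).
Definition imean j : conf R -> R := zero_off DV (isotope_mean xs j).
Definition pfis i j : conf R * vec3 R -> R :=
  zero_off (DV `*` V) (fun z => pi_f xs i j z.1 z.2).
Definition pscat i : conf R * vec3 R -> R :=
  zero_off (DV `*` V) (fun z => pi_s xs i z.1 z.2).
Definition yield i j (x : conf R) : R := \int[leb3]_v' pfis i j (x, v').

Lemma bounded_scat i : bounded_nonneg (scat i).
Proof.
apply: bounded_nonneg_zero_off; first exact: measurable_DV.
rewrite /scatter_rate; case: (ltnP i l) => il; first exact: sigma_s_Lpos hxs _ il.
by split => //; exists 0.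
Qed.

Lemma bounded_remo i : bounded_nonneg (remo i).
Proof.
apply: bounded_nonneg_zero_off; first exact: measurable_DV.
rewrite /removal_rate; case: (ltnP i l) => il; first exact: sigma_f_Lpos hxs _ il.
split => //; last by exists (decay_rate xs i).
by move=> x _; apply/ltW/(decay_rate_gt0 hxs).
Qed.

Lemma bounded_imean (j : 'I_m) : (l <= j)%N -> bounded_nonneg (imean j).
Proof.
move=> jl; apply: bounded_nonneg_zero_off; first exact: measurable_DV.
exact: isotope_mean_Lpos hxs _ jl.
Qed.

Lemma bounded_pfis (i j : 'I_m) : (j < l)%N -> bounded_nonneg (pfis i j).
Proof.
move=> jl; apply: bounded_nonneg_zero_off; first exact: measurable_DVV.
exact: pi_f_Lpos hxs _ _ jl.
Qed.

Lemma bounded_pscat (i : 'I_m) : (i < l)%N -> bounded_nonneg (pscat i).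
Proof.
move=> il; apply: bounded_nonneg_zero_off; first exact: measurable_DVV.
exact: pi_s_Lpos hxs _ il.
Qed.

Lemma pfisE i j x v : DV x -> V v -> pfis i j (x, v) = pi_f xs i j x v.
Proof. by move=> DVx Vv; rewrite /pfis zero_offE. Qed.

Lemma integral_pfis i j x (C : set (vec3 R)) : DV x -> C `<=` V ->
  (\int[leb3]_(v' in C) (pfis i j (x, v'))%:E = \int[leb3]_(v' in C) (pi_f xs i j x v')%:E)%E.
Proof.
by move=> DVx CV; apply: eq_integral => v /set_mem Cv; rewrite pfisE//; exact: CV.
Qed.

(** The extended kernel is bounded and vanishes for velocities off the shell, which has finite
    volume. The integral is therefore finite and [fine] loses nothing. *)
Lemma yieldE (i j : 'I_m) x : (j < l)%N ->
  ((yield i j x)%:E = \int[leb3]_v' (pfis i j (x, v'))%:E)%E.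
Proof.
move=> jl; have [mp p0 [c pc]] := bounded_pfis i jl.
rewrite /yield /Rintegral fineK//.
rewrite ge0_fin_numE; last by apply: integral_ge0 => v _; rewrite lee_fin.
rewrite (_ : integral _ _ _ = (\int[leb3]_(v' in V) (pfis i j (x, v'))%:E)%E).
  apply: (@le_lt_trans _ _ (\int[leb3]_(v' in V) (Num.max c 0)%:E)%E).
    apply: ge0_le_integral => //.
    - exact: measurable_shell.
    - by move=> v _; rewrite lee_fin.
    - apply/measurable_EFinP/measurable_funTS; exact: (measurable_snd_section x mp).
    - by move=> v _; rewrite lee_fin le_max pc.
  rewrite integral_cst//; last exact: measurable_shell.
  by rewrite lte_mul_pinfty ?leb3_shell_fin// lee_fin le_max lexx orbT.
rewrite [RHS]integral_mkcond; apply: eq_integral => v _; rewrite patchE.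
case: ifPn => // /negP Vv; rewrite /pfis zero_off_out// => -[_ /mem_set].
exact: Vv.
Qed.

Lemma bounded_yield (i j : 'I_m) : (j < l)%N -> bounded_nonneg (yield i j).
Proof.
move=> jl; have [mp p0 [c pc]] := bounded_pfis i jl; split.
- apply/measurable_EFinP; rewrite [X in measurable_fun _ X](_ : _ =
    fubini_F leb3 (EFin \o pfis i j)); last first.
    by apply/funext => x /=; rewrite yieldE.
  apply: measurable_fun_fubini_tonelli_F; first exact/measurable_EFinP.
  by move=> z; rewrite lee_fin.
- by move=> x; rewrite -lee_fin yieldE// integral_ge0// => v _; rewrite lee_fin.
have Vfin : leb3 V \is a fin_num by rewrite ge0_fin_numE// leb3_shell_fin.
exists (Num.max c 0 * fine (leb3 V)) => x.
rewrite -lee_fin yieldE//.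
rewrite (_ : integral _ _ _ = (\int[leb3]_(v' in V) (pfis i j (x, v'))%:E)%E).
  rewrite EFinM fineK// -integral_cst//; last exact: measurable_shell.
  apply: ge0_le_integral => //.
  - exact: measurable_shell.
  - by move=> v _; rewrite lee_fin.
  - apply/measurable_EFinP/measurable_funTS; exact: (measurable_snd_section x mp).
  - by move=> v _; rewrite lee_fin le_max pc.
rewrite [RHS]integral_mkcond; apply: eq_integral => v _; rewrite patchE.
case: ifPn => // /negP Vv; rewrite /pfis zero_off_out// => -[_ /mem_set].
exact: Vv.
Qed.

(** Since [removal_rate] covers both fission and decay, the separate terms of [alpha] for prompt
    emissions and for isotopes merge into one. *)
Definition alp (i : 'I_m) (x : conf R) : R := scat i x + remo i x *
  (\sum_(j < m | (j < l)%N) yield i j x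
   + (val i == 0%N)%:R * \sum_(j < m | (l <= j)%N) imean j x).

Lemma bounded_alp i : bounded_nonneg (alp i).
Proof.
apply: bounded_nonnegD; first exact: bounded_scat.
apply: bounded_nonnegM; first exact: bounded_remo.
apply: bounded_nonnegD.
  by apply: bounded_nonneg_sum => j jl; exact: bounded_yield.
apply: bounded_nonnegM; first exact: bounded_nonneg_cst.
by apply: bounded_nonneg_sum => j jl; exact: bounded_imean.
Qed.

Lemma fission_yieldE i j x : DV x -> fission_yield V xs i j x = yield i j x.
Proof.
move=> DVx; rewrite /fission_yield /yield /Rintegral; congr fine.
rewrite -(integral_pfis i j DVx)// [LHS]integral_mkcond; apply: eq_integral => v _.
rewrite patchE; case: ifPn => // /negP Vv; rewrite /pfis zero_off_out// => -[_ /mem_set].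
exact: Vv.
Qed.

Lemma alphaE i x : DV x -> alpha l V xs i x = alp i x.
Proof.
move=> DVx; rewrite /alpha /alp /scat /remo !zero_offE// /scatter_rate /removal_rate.
under eq_bigr do rewrite fission_yieldE//.
under [X in _ = _ + _ * (_ + _ * X)]eq_bigr do rewrite /imean zero_offE//.
case: (ltnP i l) => il; rewrite ?mul1r ?mul0r ?add0r ?addr0//.
(* The remaining case is that of an isotope, which cannot be of type 1 because [1 <= l]. *)
rewrite [(val i == 0)%N](_ : _ = false) ?mul0r ?addr0//.
apply/negP => /eqP i0; move: il; rewrite i0 leqn0 => /eqP l0.
by move: hl; rewrite l0.
Qed.

Lemma betaE i x : DV x -> beta l V xs i x = alp i x - scat i x - remo i x.
Proof.
move=> DVx; rewrite /beta alphaE// /scat /remo !zero_offE// /scatter_rate /removal_rate.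
by case: (ltnP i l) => il; rewrite ?mul1r ?mul0r ?subr0// opprD addrA.
Qed.

Lemma alp_out i x : ~ DV x -> alp i x = 0.
Proof. by move=> nx; rewrite /alp /scat /remo !zero_off_out// mul0r addr0. Qed.

Definition along (h : conf R -> R) (i : 'I_m) (z : conf R * R) : R :=
  h (flight i z.1 z.2).

Lemma bounded_along h i : bounded_nonneg h -> bounded_nonneg (along h i).
Proof. by move=> bh; apply: bounded_nonneg_comp => //; exact: measurable_flight. Qed.

(** [survival] cuts its rate off outside [D], whereas [k] is cut off outside [D * V]. Along a flight
    this is the same, because the velocity is kept and lies in [V]. *)
Lemma survivalE (h : 'I_m -> conf R -> R) (k : conf R -> R) i x s :
  bounded_nonneg k -> (forall y, DV y -> h i y = k y) ->
  (forall y, ~ DV y -> k y = 0) -> V x.2 ->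
  survival l D h i x s = survival_rate (fun u => along k i (x, u)) s.
Proof.
move=> bk hk k0 Vx; have [mk k_0 _] := bounded_along i bk.
rewrite /survival survival_rate.unlock cumulative_rate.unlock.
congr (expR (- _)); rewrite /Rintegral; congr fine.
rewrite -ge0_integral_leb1//.
- apply: eq_integral => u _; congr EFin; rewrite /along/= indicE.
  have [Du|nDu] := pselect (D (flight i x u).1).
    by rewrite mem_set// mul1r hk//; split => //; rewrite flight_snd.
  by rewrite memNset// mul0r k0// => -[].
- apply/measurable_EFinP/measurable_funTS.
  exact: (measurable_snd_section x mk).
- by move=> u _; rewrite lee_fin.
Qed.

End model.

(** * The operator K *)

Section jumps.
Variables (R : realType) (m l : nat) (hl : (1 <= l < m)%N).
Variables (D : set (vec3 R)) (oD : open D) (vmin vmax : R).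
Local Notation V := (shell vmin vmax).
Variable xs : cross_sections R m.
Hypothesis hxs : admissible_cross_sections l D V xs.
Local Notation DV := (D `*` V).
Local Notation flight := (flight l).
Local Notation scat := (scat l D vmin vmax xs).
Local Notation remo := (remo l D vmin vmax xs).
Local Notation imean := (imean D vmin vmax xs).
Local Notation pfis := (pfis D vmin vmax xs).
Local Notation pscat := (pscat D vmin vmax xs).
Local Notation alp := (alp l D vmin vmax xs).

Definition scat_density (i : 'I_m) (z : conf R * vec3 R) : R := scat i z.1 * pscat i z.
Definition fission_density (i j : 'I_m) (z : conf R * vec3 R) : R :=
  if (j < l)%N then remo i z.1 * pfis i j z else 0.
Definition isotope_rate (i j : 'I_m) (x : conf R) : R :=
  if (val i == 0%N) && (l <= j)%N then remo i x * imean j x else 0.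
Definition total_density (i j : 'I_m) (z : conf R * vec3 R) : R :=
  (if i == j then scat_density i z else 0) + fission_density i j z.
Definition total_rate (i : 'I_m) (x : conf R) : R := scat i x + remo i x.

Lemma scat_isotope (i : 'I_m) x : (l <= i)%N -> scat i x = 0.
Proof.
move=> il; rewrite /scat /zero_off /scatter_rate ltnNge il/=.
by case: ifP.
Qed.

Lemma bounded_scat_density i : bounded_nonneg (scat_density i).
Proof.
have [il|il] := ltnP i l; last first.
  rewrite (_ : scat_density i = fun=> 0); first exact: bounded_nonneg_cst.
  by apply/funext => z; rewrite /scat_density scat_isotope// mul0r.
apply: (@bounded_nonnegM _ _ _ (fun z => scat i z.1) (pscat i)); last exact: (bounded_pscat oD hxs il).
by apply: (bounded_nonneg_comp (bounded_scat oD hxs i)); exact: measurable_fst.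
Qed.

Lemma bounded_fission_density i j : bounded_nonneg (fission_density i j).
Proof.
rewrite /fission_density; case: (ltnP j l) => jl; last exact: bounded_nonneg_cst.
apply: (@bounded_nonnegM _ _ _ (fun z => remo i z.1) (pfis i j)); last exact: (bounded_pfis oD hxs i jl).
by apply: (bounded_nonneg_comp (bounded_remo oD hxs i)); exact: measurable_fst.
Qed.

Lemma bounded_isotope_rate i j : bounded_nonneg (isotope_rate i j).
Proof.
rewrite /isotope_rate; case: (boolP ((val i == 0%N) && (l <= j)%N)) => [/andP[_ jl]|_].
  by apply: (@bounded_nonnegM _ _ _ (remo i) (imean j)); [exact: (bounded_remo oD hxs i)|exact: (bounded_imean oD hxs jl)].
exact: bounded_nonneg_cst.
Qed.

Lemma bounded_total_density i j : bounded_nonneg (total_density i j).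
Proof.
apply: (@bounded_nonnegD _ _ _ (fun z => if i == j then scat_density i z else 0)
  (fission_density i j)); last exact: bounded_fission_density.
by case: (i == j); [exact: bounded_scat_density|exact: bounded_nonneg_cst].
Qed.

Lemma bounded_total_rate i : bounded_nonneg (total_rate i).
Proof. by apply: (@bounded_nonnegD _ _ _ (scat i) (remo i)); [exact: (bounded_scat oD hxs i)|exact: (bounded_remo oD hxs i)]. Qed.

Lemma jump_densityE i j x v : DV x -> V v ->
  jump_density l xs i j x v = total_density i j (x, v).
Proof.
move=> DVx Vv; rewrite /jump_density /total_density /scat_density /fission_density/=.
rewrite /scat /remo /pscat /pfis !zero_offE// /scatter_rate /removal_rate.
by case: (ltnP i l) => il; case: (ltnP j l) => jl; case: (i == j);
  rewrite /= ?mul1r ?mul0r ?addr0 ?add0r.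
Qed.

Lemma jump_atomE i j x : DV x -> jump_atom l xs i j x = isotope_rate i j x.
Proof.
move=> DVx; rewrite /jump_atom /isotope_rate.
case: (boolP ((val i == 0%N) && (l <= j)%N)) => [/andP[/eqP i0 _]|_]; last by rewrite mul0r.
rewrite mul1r /remo /imean !zero_offE// /removal_rate i0.
by have /andP[-> _] := hl.
Qed.

(** The lower bound on [sigma_s * pi_s] forces [sigma_s > 0], and scattering is one of the
    contributions to [alp]. *)
Lemma alp_prompt_gt0 (i : 'I_m) x : (i < l)%N -> DV x -> 0 < alp i x.
Proof.
move=> il DVx; have [c c0 sc] := scatter_away0 hxs il.
have [_ Vx] := DVx.
have s0 : 0 < scat i x.
  have [_ /(_ x) s0 _] := bounded_scat oD hxs i.
  rewrite lt0r s0 andbT; apply/eqP => s00.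
  have := sc _ _ DVx Vx; move: s00; rewrite /scat zero_offE// /scatter_rate il => ->.
  by rewrite mul0r leNgt c0.
rewrite (lt_le_trans s0)// /alp lerDl.
have [_ r0 _] := bounded_remo oD hxs i.
rewrite mulr_ge0// addr_ge0//.
  apply: sumr_ge0 => j jl; by have [_ + _] := bounded_yield oD hxs i jl; apply.
rewrite mulr_ge0//; apply: sumr_ge0 => j jl.
by have [_ + _] := bounded_imean oD hxs jl; apply.
Qed.

(** Where [alp] vanishes the kernel is arbitrary, so the right-hand side has to vanish as well. By
    [alp_prompt_gt0] this concerns isotopes only. For these [alp] is the decay rate times the total
    yield, which dominates the integral of [total_density i j] for each prompt [j]. *)
Lemma jumpE (pi : 'I_m -> 'I_m -> R.-ker (conf R) ~> vec3 R) i j x C :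
  is_jump_kernel l D V xs pi -> DV x -> measurable C -> C `<=` V ->
  ((alp i x)%:E * pi i j x C = \int[leb3]_(v' in C) (total_density i j (x, v'))%:E
     + (isotope_rate i j x)%:E * dirac x.2 C)%E.
Proof.
move=> hpi DVx mC CV; have [_ piE] := hpi i x DVx.
have [_ alp0 _] := bounded_alp oD hxs i.
have [ap|] := ltP 0 (alp i x).
  have := piE; rewrite (alphaE hl (D := D))// => /(_ ap j C mC CV) ->.
  rewrite jump_atomE//; congr (_ + _)%E.
  by apply: eq_integral => v /set_mem Cv; rewrite jump_densityE//; exact: CV.
move=> a0; have {a0} a0 : alp i x = 0 by apply/eqP; rewrite eq_le a0 alp0.
rewrite a0 mul0e.
have [il|il] := ltnP i l.
  by have := alp_prompt_gt0 il DVx; rewrite a0 ltxx.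
rewrite /isotope_rate (_ : val i == 0%N = false) ?mul0e ?adde0; last first.
  by apply/negP => /eqP i0; move: il; rewrite i0 leqn0 => /eqP l0; move: hl; rewrite l0.
have [_ r0 _] := bounded_remo oD hxs i.
have [jl|jl] := ltnP j l; last first.
  apply/esym/integral0_eq => v _; rewrite /total_density /fission_density ltnNge jl/= addr0.
  by case: ifP => // _; rewrite /scat_density scat_isotope// mul0r.
have [mp p0 _] := bounded_pfis oD hxs i jl.
have ry0 : remo i x * yield D vmin vmax xs i j x = 0.
  apply/eqP; rewrite eq_le mulr_ge0 ?andbT//; last first.
    by have [_ + _] := bounded_yield oD hxs i jl; apply.
  rewrite -a0 /alp scat_isotope// add0r ler_wpM2l//.
  rewrite (bigD1 j)//= -addrA lerDl addr_ge0//.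
    apply: sumr_ge0 => k /andP[kl _].
    by have [_ + _] := bounded_yield oD hxs i kl; apply.
  rewrite mulr_ge0//; apply: sumr_ge0 => k kl.
  by have [_ + _] := bounded_imean oD hxs kl; apply.
apply/esym/eqP; rewrite eq_le integral_ge0 ?andbT; last first.
  by move=> v _; rewrite lee_fin; have [_ + _] := bounded_total_density i j; apply.
have -> : (\int[leb3]_(v' in C) (total_density i j (x, v'))%:E =
           \int[leb3]_(v' in C) ((remo i x)%:E * (pfis i j (x, v'))%:E))%E.
  apply: eq_integral => v _; rewrite /total_density /scat_density scat_isotope//.
  by rewrite mul0r if_same add0r /fission_density jl EFinM.
have mpx := measurable_snd_section x mp.
rewrite ge0_integralZl_EFin//; last 2 first.
- by move=> v _; rewrite lee_fin.
- by apply/measurable_EFinP/measurable_funTS.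
rewrite -[leRHS]/(0%:E) -ry0 EFinM lee_wpmul2l ?lee_fin// (yieldE oD hxs)//.
by apply: ge0_subset_integral => //; [exact/measurable_EFinP|move=> v _; rewrite lee_fin].
Qed.

Definition surv (i : 'I_m) (x : conf R) (s : R) : R :=
  if (s%:E < exit_time l D i x)%E
  then survival_rate (fun u => along l (total_rate i) i (x, u)) s else 0.

Lemma measurable_surv i : measurable_fun setT (fun z : conf R * R => surv i z.1 z.2).
Proof.
apply: measurable_fun_ifT => //; first exact: measurable_lt_exit_time.
have [mt t0 [c tc]] := bounded_along l i (bounded_total_rate i).
exact: measurable_survival_rate mt t0 tc.
Qed.

Lemma surv_ge0 i x s : 0 <= surv i x s.
Proof. by rewrite /surv; case: ifP => // _; rewrite ltW// survival_rate_gt0. Qed.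

(** * The two kinds of terms of the operator *)

Definition flight_density (q : conf R * vec3 R -> R) (i : 'I_m)
    (h : R * conf R -> \bar R) (z : R * conf R) : \bar R :=
  (\int[leb1]_(s in `[0%R, +oo[) ((surv i z.2 s)%:E *
     \int[leb3]_v ((q (flight i z.2 s, v))%:E *
       h ((z.1 + s)%R, ((flight i z.2 s).1, v)))))%E.

(** A particle created without change of velocity takes over the whole configuration
    [flight i z.2 s]. This is how isotopes are born. In both operators [q] already contains the rate
    of the event, so [surv] is the only other weight of the age [s]. *)
Definition flight_atom (q : conf R -> R) (i : 'I_m)
    (h : R * conf R -> \bar R) (z : R * conf R) : \bar R :=
  (\int[leb1]_(s in `[0%R, +oo[) ((surv i z.2 s)%:E *
     ((q (flight i z.2 s))%:E * h ((z.1 + s)%R, flight i z.2 s))))%E.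

Lemma measurable_flight_post (i : 'I_m) : measurable_fun setT
  (fun z : (R * conf R) * R => flight i z.1.2 z.2).
Proof.
have m12 : measurable_fun setT (fun z : (R * conf R) * R => z.1.2).
  by apply: measurableT_comp => //; exact: measurable_fst.
exact: (measurable_fun_pair_comp (@measurable_flight R m l i) m12 measurable_snd).
Qed.

Lemma measurable_surv_post (i : 'I_m) : measurable_fun setT
  (fun z : (R * conf R) * R => (surv i z.1.2 z.2)%:E).
Proof.
apply/measurable_EFinP.
have m12 : measurable_fun setT (fun z : (R * conf R) * R => z.1.2).
  by apply: measurableT_comp => //; exact: measurable_fst.
exact: (measurable_fun_pair_comp (measurable_surv i) m12 measurable_snd).
Qed.

Lemma measurable_time_integral d (T : measurableType d) (f : T * R -> \bar R) :
  measurable_fun setT f -> (forall z, 0 <= f z)%E ->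
  measurable_fun setT (fun w => \int[leb1]_(s in `[0%R, +oo[) f (w, s))%E.
Proof.
move=> mf f0; pose f' z : \bar R := if 0 <= z.2 then f z else 0%E.
rewrite [X in measurable_fun _ X](_ : _ = fubini_F leb1 f'); last first.
  apply/funext => w; rewrite integral_mkcond; apply: eq_integral => s _.
  by rewrite patchE /f'/= mem_setE in_itv/= andbT.
apply: measurable_fun_fubini_tonelli_F; last by move=> z; rewrite /f'; case: ifP.
by apply: measurable_fun_ifT => //; exact: measurable_fun_ler.
Qed.

Section flight_operators.
Variables (i : 'I_m) (h : R * conf R -> \bar R).
Hypotheses (mh : measurable_fun setT h) (h0 : forall z, (0 <= h z)%E).

Let mpost (q : conf R * vec3 R -> R) : bounded_nonneg q ->
  measurable_fun setT (fun z : ((R * conf R) * R) * vec3 R =>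
    (q (flight i z.1.1.2 z.1.2, z.2))%:E *
    h ((z.1.1.1 + z.1.2)%R, ((flight i z.1.1.2 z.1.2).1, z.2)))%E.
Proof.
move=> [mq _ _].
have mfl : measurable_fun setT (fun z : ((R * conf R) * R) * vec3 R =>
    flight i z.1.1.2 z.1.2).
  exact: (measurableT_comp (measurable_flight_post i) measurable_fst).
apply: emeasurable_funM.
  apply/measurable_EFinP; exact: (measurable_fun_pair_comp mq mfl measurable_snd).
apply: (measurableT_comp mh); apply: measurable_fun_pair.
  apply: measurable_funD; last by apply: measurableT_comp => //; exact: measurable_fst.
  by do 2?[apply: measurableT_comp => //]; exact: measurable_fst.
apply: measurable_fun_pair => //.
exact: (measurableT_comp measurable_fst mfl).
Qed.

Lemma measurable_flight_post_state : measurable_fun setT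
  (fun z : (R * conf R) * R => h ((z.1.1 + z.2)%R, flight i z.1.2 z.2)).
Proof.
apply: (measurableT_comp mh); apply: measurable_fun_pair; last exact: measurable_flight_post.
by apply: measurable_funD => //; apply: measurableT_comp => //; exact: measurable_fst.
Qed.

Lemma measurable_flight_inner q : bounded_nonneg q ->
  measurable_fun setT (fun z : (R * conf R) * R => \int[leb3]_v
    ((q (flight i z.1.2 z.2, v))%:E * h ((z.1.1 + z.2)%R, ((flight i z.1.2 z.2).1, v))))%E.
Proof.
move=> bq; have [_ q0 _] := bq.
apply: (@measurable_fun_fubini_tonelli_F _ _ _ _ _ leb3 (fun z : ((R * conf R) * R) * vec3 R =>
    (q (flight i z.1.1.2 z.1.2, z.2))%:E *
    h ((z.1.1.1 + z.1.2)%R, ((flight i z.1.1.2 z.1.2).1, z.2)))%E) => [|z].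
  exact: mpost.
by rewrite mule_ge0// lee_fin.
Qed.

Lemma flight_inner_ge0 q z : bounded_nonneg q -> (0 <= \int[leb3]_v
    ((q (flight i z.1.2 z.2, v))%:E * h ((z.1.1 + z.2)%R, ((flight i z.1.2 z.2).1, v))))%E.
Proof. by move=> [_ q0 _]; apply: integral_ge0 => v _; rewrite mule_ge0// lee_fin. Qed.

Lemma flight_density_ge0 q z : bounded_nonneg q -> (0 <= flight_density q i h z)%E.
Proof.
move=> bq; apply: integral_ge0 => s _; rewrite mule_ge0 ?lee_fin ?surv_ge0//.
exact: (flight_inner_ge0 (z, s)).
Qed.

Lemma flight_atom_ge0 q z : bounded_nonneg q -> (0 <= flight_atom q i h z)%E.
Proof.
move=> [_ q0 _]; apply: integral_ge0 => s _; rewrite mule_ge0 ?lee_fin ?surv_ge0//.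
by rewrite mule_ge0 ?lee_fin.
Qed.

Lemma measurable_flight_density q : bounded_nonneg q ->
  measurable_fun setT (flight_density q i h).
Proof.
move=> bq; apply: (@measurable_time_integral _ _ (fun z : (R * conf R) * R => (surv i z.1.2 z.2)%:E *
     \int[leb3]_v ((q (flight i z.1.2 z.2, v))%:E *
       h ((z.1.1 + z.2)%R, ((flight i z.1.2 z.2).1, v))))%E) => [|z].
  by apply: emeasurable_funM; [exact: measurable_surv_post|exact: measurable_flight_inner].
by rewrite mule_ge0 ?lee_fin ?surv_ge0// flight_inner_ge0.
Qed.

Lemma measurable_flight_atom q : bounded_nonneg q ->
  measurable_fun setT (flight_atom q i h).
Proof.
move=> [mq q0 _]; apply: (@measurable_time_integral _ _ (fun z : (R * conf R) * R => (surv i z.1.2 z.2)%:E *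
     ((q (flight i z.1.2 z.2))%:E * h ((z.1.1 + z.2)%R, flight i z.1.2 z.2)))%E) => [|z].
  apply: emeasurable_funM; first exact: measurable_surv_post.
  apply: emeasurable_funM.
    by apply/measurable_EFinP; exact: (measurableT_comp mq (measurable_flight_post i)).
  exact: measurable_flight_post_state.
by rewrite mule_ge0 ?lee_fin ?surv_ge0// mule_ge0 ?lee_fin.
Qed.

Lemma flight_densityD q q' z : bounded_nonneg q -> bounded_nonneg q' ->
  flight_density (fun y => q y + q' y) i h z =
  (flight_density q i h z + flight_density q' i h z)%E.
Proof.
move=> bq bq'; have [_ q0 _] := bq; have [_ q'0 _] := bq'.
have mI q1 (bq1 : bounded_nonneg q1) :=
  measurable_snd_section z (measurable_flight_inner bq1).
have mS := measurable_snd_section z (measurable_surv_post i).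
rewrite /flight_density -ge0_integralD//; first last.
- by apply: measurable_funTS; apply: emeasurable_funM => //; exact: mI.
- by move=> s _; rewrite mule_ge0 ?lee_fin ?surv_ge0//; exact: (flight_inner_ge0 (z, s)).
- by apply: measurable_funTS; apply: emeasurable_funM => //; exact: mI.
- by move=> s _; rewrite mule_ge0 ?lee_fin ?surv_ge0//; exact: (flight_inner_ge0 (z, s)).
apply: eq_integral => s _; rewrite -ge0_muleDr; last 2 first.
- exact: (flight_inner_ge0 (z, s)).
- exact: (flight_inner_ge0 (z, s)).
congr (_ * _)%E.
have mP q1 (bq1 : bounded_nonneg q1) := measurable_snd_section (z, s) (mpost bq1).
rewrite -ge0_integralD//.
- apply: eq_integral => v _; rewrite -ge0_muleDl ?lee_fin//.
- by move=> v _; rewrite mule_ge0 ?lee_fin.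
- exact: mP.
- by move=> v _; rewrite mule_ge0 ?lee_fin.
- exact: mP.
Qed.

Lemma flight_density0 z : flight_density (fun=> 0) i h z = 0%E.
Proof.
rewrite /flight_density integral0_eq// => s _.
by rewrite integral0_eq ?mule0// => v _; rewrite mul0e.
Qed.

Lemma flight_atom0 z : flight_atom (fun=> 0) i h z = 0%E.
Proof.
by rewrite /flight_atom integral0_eq// => s _; rewrite mul0e mule0.
Qed.

End flight_operators.

(* K H in the notation of the header *)
Definition next_event (H : 'I_m -> R * conf R -> \bar R) (i : 'I_m) (z : R * conf R) : \bar R :=
  (\sum_(j < m) (flight_density (total_density i j) i (H j) z +
                 flight_atom (isotope_rate i j) i (H j) z))%E.

Lemma next_event_ge0 H i z : (forall j z, (0 <= H j z)%E) -> (0 <= next_event H i z)%E.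
Proof.
move=> H0; apply: sume_ge0 => j _; apply: adde_ge0.
  by apply: flight_density_ge0 => //; exact: bounded_total_density.
by apply: flight_atom_ge0 => //; exact: bounded_isotope_rate.
Qed.

Lemma measurable_next_event H i : (forall j, measurable_fun setT (H j)) ->
  (forall j z, (0 <= H j z)%E) -> measurable_fun setT (next_event H i).
Proof.
move=> mH H0; apply: emeasurable_sum => j; apply: emeasurable_funD.
  by apply: measurable_flight_density => //; exact: bounded_total_density.
by apply: measurable_flight_atom => //; exact: bounded_isotope_rate.
Qed.

(** The walk merges scattering and fission into one jump, as in [next_event]. In the branching
    process they are two kinds of events with different labels, so the scattering term has to be set
    apart. *)
Lemma next_eventE H i z : (forall j, measurable_fun setT (H j)) ->
  (forall j z, (0 <= H j z)%E) ->
  next_event H i z = (flight_density (scat_density i) i (H i) z +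
    \sum_(j < m) (flight_density (fission_density i j) i (H j) z +
                  flight_atom (isotope_rate i j) i (H j) z))%E.
Proof.
move=> mH H0; rewrite /next_event.
have E j : flight_density (total_density i j) i (H j) z =
    ((if i == j then flight_density (scat_density i) i (H i) z else 0) +
     flight_density (fission_density i j) i (H j) z)%E.
  case: eqP => [<-|ij].
    rewrite (_ : total_density i i = fun y => scat_density i y + fission_density i i y).
      by rewrite flight_densityD//; [exact: bounded_scat_density|exact: bounded_fission_density].
    by apply/funext => y; rewrite /total_density eqxx.
  rewrite add0e (_ : total_density i j = fission_density i j)//.
  by apply/funext => y; rewrite /total_density (introF eqP ij) add0r.
transitivity (\sum_(j < m) ((if i == j then flight_density (scat_density i) i (H i) z else 0) +
    (flight_density (fission_density i j) i (H j) z +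
     flight_atom (isotope_rate i j) i (H j) z)))%E.
  apply: eq_bigr => j _; rewrite E.
  move: (flight_density (scat_density i) i (H i) z) => a.
  move: (flight_density (fission_density i j) i (H j) z) => b.
  by move: (flight_atom (isotope_rate i j) i (H j) z) => b'; rewrite addeA.
rewrite big_split/=; move: (\sum_(j < m) (_ + _))%E => b.
move: (flight_density (scat_density i) i (H i) z) => a; congr (_ + _)%E.
rewrite (bigD1 i)//= eqxx big1 ?adde0// => j /negbTE ji.
by rewrite eq_sym ji.
Qed.

End jumps.

(** * Laws of events *)

(** Reference measure for the pair (age at an event, velocity created by it). *)
Definition leb13 (R : realType) : set (R * vec3 R) -> \bar R := (leb1 \x leb3)%E.
Arguments leb13 {R}.

Section leb13_measure.
Variable R : realType.
HB.instance Definition _ := Measure.copy (@leb13 R)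
  ((@leb1 R \x @leb3 R)%E : {measure set (R * vec3 R) -> \bar R}).
Let leb13_sigma_finite : sigma_finite setT (leb13 : set (R * vec3 R) -> \bar R).
Proof.
have /sigma_finiteP[F [TF ndF Foo]] := sigma_finiteT (@leb1 R).
have /sigma_finiteP[F' [TF' ndF' Foo']] := sigma_finiteT (@leb3 R).
exists (fun n => F n `*` F' n).
  rewrite -(@setXTT R (vec3 R)) TF TF' predeqE => -[x y]; split.
    move=> [/= [i _ Fx] [j _ Fy]]; exists (maxn i j) => //; split => /=.
    - by move: x Fx; apply/subsetPset/ndF; rewrite leq_maxl.
    - by move: y Fy; apply/subsetPset/ndF'; rewrite leq_maxr.
  by move=> [n _ [/= ? ?]]; split; exists n.
move=> n; have [mF Fn] := Foo n; have [mF' Fn'] := Foo' n.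
split; first exact: measurableX.
rewrite /leb13 product_measure1E// lte_mul_pinfty// ge0_fin_numE//.
Qed.
HB.instance Definition _ := Measure_isSigmaFinite.Build _ (R * vec3 R)%type R (@leb13 R)
  leb13_sigma_finite.
End leb13_measure.

Lemma measurable_rectangles d1 d2 (T1 : measurableType d1) (T2 : measurableType d2) :
  setI_closed [set A `*` B | A in @measurable _ T1 & B in @measurable _ T2].
Proof.
move=> _ _ [A mA [B mB <-]] [A' mA' [B' mB' <-]].
by rewrite -setXI; exists (A `&` A'); [exact: measurableI|];
  exists (B `&` B') => //; exact: measurableI.
Qed.

Section event_laws.
Local Open Scope ereal_scope.
Context (R : realType) dT (T : measurableType dT) (P : probability T R).
Variable F : set (set T).
Hypotheses (sF : sigma_algebra setT F) (Fm : F `<=` measurable).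
Local Notation TF := (g_sigma_algebraType F).
Variables (Q : (set T)^nat) (S : T -> R) (vel : (T -> vec3 R)^nat).
Hypotheses (mQ : forall k, measurable (Q k)) (mS : measurable_fun setT S).
Hypothesis mvel : forall k, measurable_fun setT (vel k).
Hypothesis Qfin : \sum_(k <oo) P (Q k) < +oo.
Variable g : TF * R -> R.
Hypotheses (mg : measurable_fun setT g) (g0 : forall z, (0 <= g z)%R).

Let mid : measurable_fun setT (idfun : T -> TF).
Proof. by apply: (sub_measurable_fun sF Fm); exact: measurable_id. Qed.

Let midR : measurable_fun setT (idfun : T * R -> TF * R).
Proof.
rewrite (_ : idfun = fun z : T * R => (z.1 : TF, z.2)); last by apply/funext => -[].
by apply: measurable_fun_pair => //; exact: (measurableT_comp mid measurable_fst).
Qed.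

Let g_pos (z : T * R) : R := if (0 <= z.2)%R then g z else 0%R.
Let mg_pos : measurable_fun setT g_pos.
Proof.
apply: measurable_fun_ifT => //; first exact: measurable_fun_ler.
exact: (measurableT_comp mg midR).
Qed.
Let g_pos0 z : (0 <= g_pos z)%R. Proof. by rewrite /g_pos; case: ifP. Qed.

Let rect_generate : @measurable _ (R * vec3 R)%type =
  <<s [set A `*` B | A in @measurable _ R & B in @measurable _ (vec3 R)] >>.
Proof. exact: measurable_prod_measurableType. Qed.

Let Qfin' (j : nat) : \sum_(k <oo) P (Q k `&` ((fun w => (S w, vel k w)) @^-1` setT)) < +oo.
Proof. by under eq_eseriesr do rewrite preimage_setT setIT. Qed.

Let integral_leb13 (f : R * vec3 R -> \bar R) : measurable_fun setT f ->
  (forall u, 0 <= f u) ->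
  \int[leb13]_u f u = \int[leb1]_s \int[leb3]_v f (s, v).
Proof.
move=> mf f0; rewrite (eq_measure_integral (leb1 \x leb3))//.
by rewrite (fubini_tonelli1 f).
Qed.

(** [law_series] with reference measure [leb13] and the product of [g] and [q] as density. The
    finiteness [Qfin] is what makes the values on rectangles determine the measure. *)
Lemma event_law_density (q : conf R * vec3 R -> R) (y : TF * R -> conf R) :
  measurable_fun setT q -> (forall z, (0 <= q z)%R) -> measurable_fun setT y ->
  (forall A I B, F A -> measurable I -> measurable B ->
    \sum_(k <oo) P (Q k `&` A `&` [set w | I (S w) /\ B (vel k w)]) =
    \int[P]_(w in A) \int[leb1]_(s in `[0%R, +oo[ `&` I) ((g (w, s))%:E *
      \int[leb3]_(v in B) (q (y (w, s), v))%:E)) ->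
  forall Phi : TF * (R * vec3 R) -> \bar R, measurable_fun setT Phi ->
    (forall z, 0 <= Phi z) ->
  \sum_(k <oo) \int[P]_(w in Q k) Phi (w, (S w, vel k w)) =
  \int[P]_w \int[leb1]_(s in `[0%R, +oo[) ((g (w, s))%:E *
      \int[leb3]_v ((q (y (w, s), v))%:E * Phi (w, (s, v)))).
Proof.
move=> mq q0 my QE Phi mPhi Phi0.
pose rho (z : T * (R * vec3 R)) : R := (g_pos (z.1, z.2.1) * q (y (z.1, z.2.1), z.2.2))%R.
have mw1 : measurable_fun setT (fun z : T * (R * vec3 R) => (z.1, z.2.1)).
  by apply: measurable_fun_pair => //; exact: measurableT_comp.
have mrho : measurable_fun setT rho.
  apply: measurable_funM; first exact: (measurableT_comp mg_pos mw1).
  apply: (measurableT_comp mq); apply: measurable_fun_pair.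
    exact: (measurableT_comp my (measurableT_comp midR mw1)).
  by apply: measurableT_comp => //; exact: measurable_snd.
have rho0 z : (0 <= rho z)%R by rewrite mulr_ge0.
rewrite (@law_series R _ T _ TF _ (R * vec3 R)%type _ (R * vec3 R)%type P leb13 idfun snd
  rho mid measurable_snd mrho rho0 _ (fun=> setT) rect_generate
  (@measurable_rectangles _ _ R (vec3 R)) _ _ Q (fun k w => (S w, vel k w)) mQ _ _ Qfin' Phi mPhi Phi0).
- apply: eq_integral => w _; rewrite integral_leb13; last 2 first.
  + apply: emeasurable_funM; first exact: (measurable_snd_section (w : TF) mPhi).
    by apply/measurable_EFinP; exact: (measurable_snd_section w mrho).
  + by move=> u; rewrite mule_ge0// lee_fin.
  rewrite [RHS]integral_mkcond; apply: eq_integral => s _.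
  rewrite patchE mem_setE in_itv/= andbT /rho/= /g_pos/=; case: ifP => s0; last first.
    by rewrite integral0_eq// => v _; rewrite mul0r mule0.
  rewrite -ge0_integralZl_EFin//.
  + by apply: eq_integral => v _; rewrite EFinM muleC muleA.
  + by move=> v _; rewrite mule_ge0 ?lee_fin.
  + apply: emeasurable_funM.
      by apply/measurable_EFinP; exact: (measurable_snd_section (y (w, s)) mq).
    exact: (measurable_snd_section s (measurable_snd_section (w : TF) mPhi)).
- by move=> k; exists setT => //; exists setT => //; rewrite setXTT.
- by apply/seteqP; split => // x _; exists 0%N.
- by move=> k; exact: measurable_fun_pair.
move=> A _ mA [I mI [B mB <-]].
have FA : F A by move: mA => /(sub_measurableE sF).
rewrite (QE _ _ _ FA mI mB).
apply: eq_integral => w _.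
pose f (u : R * vec3 R) : \bar R := if u \in I `*` B then (rho (w, u))%:E else 0.
have mf : measurable_fun setT f.
  apply: measurable_fun_ifT => //; first by apply: measurable_in_set; exact: measurableX.
  by apply/measurable_EFinP; exact: (measurable_snd_section w mrho).
rewrite [RHS]integral_mkcond (_ : integral _ _ _ = \int[leb13]_u f u)//.
rewrite integral_leb13//; last by move=> u; rewrite /f; case: ifP; rewrite ?lee_fin.
rewrite [LHS]integral_mkcond; apply: eq_integral => s _; rewrite patchE /f.
have [[s0 Is]|nI] := pselect (([set` `[0%R, +oo[] `&` I) s); last first.
  rewrite memNset// integral0_eq// => v _; case: ifPn => // /set_mem[Is _].
  rewrite /rho/= /g_pos/=; case: ifP => s0; last by rewrite mul0r.
  by exfalso; apply: nI; split => //=; rewrite in_itv/= s0.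
rewrite mem_set//; move: s0; rewrite /= in_itv/= andbT => s0.
rewrite -ge0_integralZl_EFin//.
- rewrite [LHS]integral_mkcond; apply: eq_integral => v _; rewrite patchE.
  have [Bv|nB] := pselect (B v).
    by rewrite !mem_set// /rho/= /g_pos/= s0.
  by rewrite !memNset// => -[].
- by move=> v _; rewrite lee_fin.
- by apply/measurable_EFinP/measurable_funTS; exact: (measurable_snd_section (y (w, s)) mq).
Qed.


(** The velocity [theta w] is a function of the information, so the law has no density in the
    velocity: the reference measure is on ages alone, transported by [(w, s) -> (s, theta w)]. *)
Lemma event_law_atom (theta : TF -> vec3 R) :
  measurable_fun setT theta ->
  (forall A I B, F A -> measurable I -> measurable B ->
    \sum_(k <oo) P (Q k `&` A `&` [set w | I (S w) /\ B (vel k w)]) =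
    \int[P]_(w in A) \int[leb1]_(s in `[0%R, +oo[ `&` I)
      ((g (w, s))%:E * (\1_B (theta w))%:E)) ->
  forall Phi : TF * (R * vec3 R) -> \bar R, measurable_fun setT Phi ->
    (forall z, 0 <= Phi z) ->
  \sum_(k <oo) \int[P]_(w in Q k) Phi (w, (S w, vel k w)) =
  \int[P]_w \int[leb1]_(s in `[0%R, +oo[) ((g (w, s))%:E * Phi (w, (s, theta w))).
Proof.
move=> mth QE Phi mPhi Phi0.
have mth' : measurable_fun setT (theta : T -> vec3 R) by exact: (sub_measurable_fun sF Fm).
have mtheta : measurable_fun setT (fun z : T * R => (z.2, theta z.1)).
  by apply: measurable_fun_pair => //; exact: measurableT_comp.
rewrite (@law_series R _ T _ TF _ R _ (R * vec3 R)%type P leb1 idfun (fun z => (z.2, theta z.1))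
  g_pos mid mtheta mg_pos g_pos0 _ (fun=> setT) rect_generate
  (@measurable_rectangles _ _ R (vec3 R)) _ _ Q (fun k w => (S w, vel k w)) mQ _ _ Qfin' Phi mPhi Phi0).
- apply: eq_integral => w _; rewrite [RHS]integral_mkcond; apply: eq_integral => s _.
  rewrite patchE mem_setE in_itv/= andbT /g_pos/=; case: ifP => _; first by rewrite muleC.
  by rewrite mule0.
- by move=> k; exists setT => //; exists setT => //; rewrite setXTT.
- by apply/seteqP; split => // x _; exists 0%N.
- by move=> k; exact: measurable_fun_pair.
move=> A _ mA [I mI [B mB <-]].
have FA : F A by move: mA => /(sub_measurableE sF).
rewrite (QE _ _ _ FA mI mB).
apply: eq_integral => w _.
rewrite [LHS]integral_mkcond [RHS]integral_mkcond; apply: eq_integral => s _.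
rewrite !patchE indicE /g_pos/=.
have [Is|nI] := pselect (I s); last first.
  by rewrite !memNset// => -[].
have [Bt|nB] := pselect (B (theta w)); last first.
  rewrite (memNset nB) mule0 if_same memNset// => -[_ /=]; exact: nB.
rewrite (mem_set Bt) mule1 [X in if X then _ else _](_ : _ = (0 <= s)%R).
  by rewrite mem_set//; case: ifP.
by apply/idP/idP => [/set_mem[]|s0]; rewrite ?inE /= in_itv/= andbT// => ->.
Qed.

End event_laws.

(** * Particles *)

Lemma measurable_fun_cases (I : finType) d1 d2 (T : measurableType d1)
    (U : measurableType d2) (p : I -> T -> bool) (f : I -> T -> U) (g : T -> U) (c : U) :
  (forall i, measurable [set w | p i w]) -> (forall i, measurable_fun setT (f i)) ->
  (forall i w, p i w -> g w = f i w) -> (forall w, (forall i, ~~ p i w) -> g w = c) ->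
  measurable_fun setT g.
Proof.
move=> mp mf gf gc _ B mB; rewrite setTI.
have fU (E : I -> set T) : (forall i, measurable (E i)) ->
    measurable [set w | exists i, E i w].
  move=> mE; rewrite [X in measurable X](_ : _ = \bigcup_(i in [set: I]) E i).
    by apply: fin_bigcup_measurable => // i _.
  by apply/seteqP; split=> w [i]; [exists i|move=> _ Ei; exists i].
rewrite (_ : g @^-1` B = [set w | exists i, ([set w | p i w] `&` f i @^-1` B) w] `|`
    (~` [set w | exists i, p i w] `&` [set w | B c])).
  apply: measurableU.
    apply: fU => i; apply: measurableI => //.
    by rewrite -[X in measurable X]setTI; exact: mf.
  apply: measurableI; first by apply: measurableC; exact: fU.
  have [Bc|nBc] := pselect (B c).
    by rewrite (_ : [set w | B c] = setT)//; apply/seteqP; split.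
  by rewrite (_ : [set w | B c] = set0)//; apply/seteqP; split.
apply/seteqP; split=> w.
  move=> /= Bgw; have [[i piw]|npw] := pselect (exists i, p i w).
    by left; exists i; split => //=; rewrite -(gf i).
  right; split => //=; rewrite -(gc w)// => i; apply/negP => piw.
  by apply: npw; exists i.
move=> [[i [/= piw Bf]]|[/= npw Bc]]; first by rewrite (gf i).
by rewrite gc// => i; apply/negP => piw; apply: npw; exists i.
Qed.

Lemma integral_cases (I : finType) d (T : measurableType d) (R : realType)
    (mu : {measure set T -> \bar R}) (E : set T) (p : I -> T -> bool) (f : T -> \bar R) :
  (forall i, measurable [set w | p i w]) -> measurable_fun setT f -> (forall w, 0 <= f w)%E ->
  (forall i w, p i w -> E w) -> (forall i j w, p i w -> p j w -> i = j) ->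
  (forall w, E w -> (forall i, ~~ p i w) -> f w = 0%E) ->
  (\int[mu]_(w in E) f w = \sum_i \int[mu]_(w in [set w | p i w]) f w)%E.
Proof.
move=> mp mf f0 pE pu fE.
under eq_bigr do rewrite integral_mkcond.
rewrite -ge0_integral_sum//; last 2 first.
- by move=> i; apply/(measurable_restrictT _ _).1 => //; exact: measurable_funTS.
- by move=> i w _; apply: erestrict_ge0.
rewrite [LHS]integral_mkcond; apply: eq_integral => w _; rewrite patchE.
have [[i piw]|npw] := pselect (exists i, p i w).
  rewrite (bigD1 i)//= patchE !mem_set//; last exact: (pE i).
  rewrite big1 ?adde0// => j ji; rewrite patchE memNset//= => pjw.
  by move/eqP: ji; apply; exact: pu pjw piw.
have np i : ~~ p i w by apply/negP => piw; apply: npw; exists i.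
rewrite big1; last by move=> i _; rewrite patchE memNset//=; exact/negP.
by case: ifPn => // /set_mem Ew; exact: fE.
Qed.

(** Lebesgue measure is determined by its values on intervals, which are invariant under
    translation. It is used to restart the time of a leg at 0. *)
Lemma lebesgue_translate (R : realType) (f : R -> \bar R) (b t : R) :
  measurable_fun setT f -> (forall u, 0 <= f u)%E ->
  (\int[lebesgue_measure]_(s in `[b, t[) f (s - b)%R =
   \int[lebesgue_measure]_(u in `[0%R, (t - b)%R[) f u)%E.
Proof.
move=> mf f0.
pose phi : measurableTypeR R -> measurableTypeR R := fun u : R => u + b.
have mphi : measurable_fun setT phi.
  by apply: measurable_funD; [exact: measurable_id|exact: measurable_cst].
have muE (A : set (measurableTypeR R)) : measurable A ->
    lebesgue_measure A = pushforward lebesgue_measure phi A.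
  apply: (@lebesgue_measure_unique R (pushforward lebesgue_measure phi)) => X [[x y] _ <-]/=.
  rewrite /pushforward/= (_ : _ @^-1` _ = `]x - b, y - b]%classic).
    rewrite !lebesgue_measure_itv/= !lte_fin ltrD2r; case: ifP => // _.
    by rewrite -!EFinB; congr EFin; ring.
  by apply/seteqP; split=> u /=; rewrite !in_itv/= ltrBlDr lerBrDr.
transitivity (\int[pushforward lebesgue_measure phi]_(s in `[b, t[) f (s - b)%R)%E.
  by apply: eq_measure_integral => A mA _; exact: muE.
rewrite ge0_integral_pushforward//=.
- rewrite (_ : _ @^-1` _ = `[0, t - b[%classic).
    by apply: eq_integral => u _; rewrite addrK.
  by apply/seteqP; split=> u /=; rewrite !in_itv/= lerDr ltrBrDr.
- apply: measurable_funTS; apply: (measurableT_comp mf).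
  by apply: measurable_funB; [exact: measurable_id|exact: measurable_cst].
Qed.

(** The options are the letters of a label: [None] for a scattering, [Some (j, k)] for the [k]-th
    emission of type [j] released. *)
Lemma esum_option (R : realType) (m : nat) (f : option ('I_m * nat) -> \bar R) :
  (forall a, 0 <= f a)%E ->
  (\esum_(a in setT) f a = f None + \sum_(j < m) \sum_(k <oo) f (Some (j, k)))%E.
Proof.
move=> f0; rewrite (esumID [set None])// !setTI esum_set1//; congr (_ + _)%E.
rewrite (@reindex_esum _ _ _ [set: 'I_m * nat] _ (fun b => Some (b.1, b.2))); last first.
  split=> [a _|[j k] [j' k'] _ _ [-> ->]|[[j k]|] na]; [by []|by []|by exists (j, k)|by case: na].
have -> : [set: 'I_m * nat] = [set: 'I_m] `*`` (fun=> [set: nat]).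
  by apply/seteqP; split.
rewrite -(esum_esum (a := fun j k => f (Some (j, k))))//.
rewrite esum_fset; [|exact: finite_finset|by move=> j _; exact: esum_ge0].
rewrite (@fsbigE _ _ _ _ _ (index_enum 'I_m)) ?index_enum_uniq//; last first.
  by move=> j _; rewrite mem_index_enum.
by apply: eq_big => [j|j _]; [rewrite in_setT|rewrite nneseries_esumT].
Qed.

Section states.
Context (R : realType) (m : nat).
Implicit Types e : option (R * 'I_m * conf R).

Definition of_type (i : 'I_m) e : bool := if e is Some (_, j, _) then j == i else false.

Definition birth e : R * conf R := if e is Some (b, _, x) then (b, x) else point.

Lemma of_typeP i e : reflect (e = Some ((birth e).1, i, (birth e).2)) (of_type i e).
Proof.
case: e => [[[b j] x]|]/=; last by constructor.
by apply: (iffP eqP) => [->|[]].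
Qed.

(** A state is an option, so its measurability is expressed by coordinates: one event per type, and
    the pair of birth time and configuration, with value [point] when no particle exists. *)
Definition state_measurable d (T : measurableType d) (e : T -> option (R * 'I_m * conf R)) :=
  (forall i, measurable [set w | of_type i (e w)]) /\ measurable_fun setT (birth \o e).

Lemma of_type_uniq i j e : of_type i e -> of_type j e -> i = j.
Proof. by case: e => [[[b k] x]|]//= /eqP <- /eqP. Qed.

End states.

Lemma measurable_sub_sigma dT (T : measurableType dT) (H H' : set (set T)) d
    (U : measurableType d) (f : T -> U) :
  sigma_algebra setT H -> sigma_algebra setT H' -> H `<=` H' ->
  measurable_fun setT (f : g_sigma_algebraType H -> U) ->
  measurable_fun setT (f : g_sigma_algebraType H' -> U).
Proof.
move=> sH sH' HH' mf mT B mB; apply/(sub_measurableE sH')/HH'.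
by apply/(sub_measurableE sH); exact: mf.
Qed.

Section alive.
Variables (R : realType) (m l : nat) (D : set (vec3 R)) (oD : open D).

Definition alive (i : 'I_m) (x : conf R) (S : \bar R) : bool :=
  (S < exit_time l D i x)%E && (S < +oo)%E.

Lemma aliveE i x S : (0 <= S)%E ->
  alive i x S = (S < +oo)%E && ((fine S)%:E < exit_time l D i x)%E.
Proof.
move=> S0; rewrite /alive andbC; case: ltP => //= Soo.
by rewrite fineK// ge0_fin_numE.
Qed.

Lemma measurable_alive d (T : measurableType d) i (x : T -> conf R) (S : T -> \bar R) :
  measurable_fun setT x -> measurable_fun setT S -> (forall w, 0 <= S w)%E ->
  measurable [set w | alive i (x w) (S w)].
Proof.
move=> mx mS S0.
rewrite (_ : [set w | _] = [set w | (S w < +oo)%E] `&` [set w | ((fine (S w))%:E < exit_time l D i (x w))%E]).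
  apply: measurableI.
    by rewrite -[X in measurable X]setTI; exact: emeasurable_fun_infty_o.
  apply: measurable_bool_set.
  by apply: (measurable_fun_pair_comp (measurable_lt_exit_time l oD i) mx); exact: measurableT_comp.
by apply/seteqP; split=> w /=; rewrite aliveE// => /andP.
Qed.

End alive.

Section particle.
Variables (R : realType) (m l : nat) (D : set (vec3 R)) (oD : open D).
Local Notation flight := (flight l).
Context dT (T : measurableType dT) (P : probability T R).
Variable F : set (set T).
Hypotheses (sF : sigma_algebra setT F) (Fm : F `<=` measurable).
Local Notation TF := (g_sigma_algebraType F).
Variable e : T -> option (R * 'I_m * conf R).
Hypothesis me : state_measurable (e : TF -> _).
Local Notation st w := (birth (e w)).2.
Implicit Types i : 'I_m.

Let mstF : measurable_fun setT ((fun w => st w) : TF -> conf R).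
Proof. exact: (measurableT_comp measurable_snd me.2). Qed.

Let mst : measurable_fun setT (fun w => st w).
Proof. exact: (sub_measurable_fun sF Fm mstF). Qed.

Let mtyp i : F [set w | of_type i (e w)].
Proof. by apply/(sub_measurableE sF); exact: me.1. Qed.

Let mst1 : measurable_fun setT (fun z : TF * R => st z.1).
Proof. exact: (measurableT_comp mstF measurable_fst). Qed.

Lemma measurable_flight_age i : measurable_fun setT (fun z : TF * R => flight i (st z.1) z.2).
Proof. exact: (measurable_fun_pair_comp (@measurable_flight R m l i) mst1 measurable_snd). Qed.

(* probability that the particle e, if it is of type i, has neither left D nor
   undergone an event of rate k at the age z.2 *)
Definition flight_surv (k : conf R -> R) (i : 'I_m) (z : TF * R) : R :=
  if of_type i (e z.1) && (z.2%:E < exit_time l D i (st z.1))%E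
  then survival_rate (fun u => along l k i (st z.1, u)) z.2 else 0.

Lemma measurable_flight_surv k i : bounded_nonneg k -> measurable_fun setT (flight_surv k i).
Proof.
move=> bk; have [mk k0 [c kc]] := bounded_along l i bk.
apply: measurable_fun_ifT => //; last first.
  exact: (measurable_fun_pair_comp (measurable_survival_rate mk k0 kc) mst1 measurable_snd).
apply: measurable_and; last first.
  exact: (measurable_fun_pair_comp (measurable_lt_exit_time l oD i) mst1 measurable_snd).
apply: (measurable_fun_bool true); rewrite setTI.
rewrite (_ : _ @^-1` _ = [set w | of_type i (e w)] `*` setT); last first.
  by apply/seteqP; split=> -[w s] //= [].
by apply: measurableX => //; exact/(sub_measurableE sF).
Qed.

Lemma flight_surv_ge0 k i z : 0 <= flight_surv k i z.
Proof. by rewrite /flight_surv; case: ifP => // _; rewrite ltW// survival_rate_gt0. Qed.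

(** * First event of a particle *)

Section race.
Variables (i : 'I_m) (S S' : T -> \bar R) (k k' r : conf R -> R) (first ev : T -> bool).
Hypotheses (mS : measurable_fun setT S) (mS' : measurable_fun setT S').
Hypotheses (S0 : forall w, (0 <= S w)%E) (bk : bounded_nonneg k) (bk' : bounded_nonneg k').
Hypothesis rE : forall y, k y + k' y = r y.
Hypothesis mfirst : measurable [set w | first w].
Hypothesis firstS : forall w, first w -> (S w <= S' w)%E.
Hypothesis Sfirst : forall w, (S w < S' w)%E -> first w.
Hypothesis evE : forall w, ev w = [&& of_type i (e w), alive l D i (st w) (S w) & first w].
Hypothesis clocks : forall A a b, F A -> A `<=` [set w | of_type i (e w)] -> 0 <= a -> 0 <= b ->
  P (A `&` [set w | (a%:E < S w)%E /\ (b%:E < S' w)%E]) =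
  (\int[P]_(w in A) (survival_rate (fun u => along l k i (st w, u)) a *
     survival_rate (fun u => along l k' i (st w, u)) b)%:E)%E.

(** Used with the sojourn of the walk against a clock that never rings, and with the scattering and
    removal clocks in either order. The product of the two survival functions is the survival
    function of the total rate [r]. *)
Lemma particle_race A I (q : conf R -> \bar R) : F A -> measurable I ->
  measurable_fun setT q -> (forall y, 0 <= q y)%E ->
  (\int[P]_(w in A `&` [set w | ev w] `&` [set w | I (fine (S w))])
     q (flight i (st w) (fine (S w))) =
   \int[P]_(w in A) \int[leb1]_(s in `[0%R, +oo[ `&` I) ((flight_surv r i (w, s))%:E *
     ((k (flight i (st w) s))%:E * q (flight i (st w) s))))%E.
Proof.
move=> FA mI mq q0.
(* That the flight is still in [D] at the event depends on the initial state and the age only, so it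
   goes into the test function of [race], as do [A] and [I]. *)
pose Psi (z : TF * R) : \bar R :=
  if (z.1 \in A) && (z.2 \in I) && (z.2%:E < exit_time l D i (st z.1))%E
  then q (flight i (st z.1) z.2) else 0%E.
have mPsi : measurable_fun setT Psi.
  apply: measurable_fun_ifT => //; last exact: (measurableT_comp mq (measurable_flight_age i)).
  apply: measurable_and; last first.
    exact: (measurable_fun_pair_comp (measurable_lt_exit_time l oD i) mst1 measurable_snd).
  apply: measurable_and.
    apply: (@measurableT_comp _ _ _ _ _ _ (fun w : TF => w \in A)); last exact: measurable_fst.
    by apply: measurable_in_set; exact/(sub_measurableE sF).
  apply: (@measurableT_comp _ _ _ _ _ _ (fun s : R => s \in I)) => //.
  exact: measurable_in_set.
have Psi0 z : (0 <= Psi z)%E by rewrite /Psi; case: ifP.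
have [ma a0 [c ac]] := bounded_along l i bk.
have [ma' a'0 [c' ac']] := bounded_along l i bk'.
pose h (z : T * R) := along l k i (st z.1, z.2).
pose h' (z : T * R) := along l k' i (st z.1, z.2).
have mst2 : measurable_fun setT (fun z : T * R => st z.1).
  exact: (measurableT_comp mst measurable_fst).
have mh : measurable_fun setT h by exact: (measurable_fun_pair_comp ma mst2 measurable_snd).
have mh' : measurable_fun setT h' by exact: (measurable_fun_pair_comp ma' mst2 measurable_snd).
have h0 z : 0 <= h z by exact: a0.
have h'0 z : 0 <= h' z by exact: a'0.
have hc z : h z <= Num.max c c' by rewrite le_max ac.
have h'c z : h' z <= Num.max c c' by rewrite le_max ac' orbT.
pose Q := [set w | first w] `&` [set w | (S w < +oo)%E].
have mQ : measurable Q.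
  apply: measurableI => //.
  by rewrite -[X in measurable X]setTI; exact: emeasurable_fun_infty_o.
have SQ w : (S w < S' w)%E -> Q w.
  by move=> lt; split; [exact: Sfirst|rewrite /= (lt_le_trans lt)// leey].
have := @race _ _ _ P F sF Fm S S' h h' (Num.max c c') [set w | of_type i (e w)] mS mS' S0
  mh mh' h0 h'0 hc h'c (@mtyp i) clocks Q mQ (fun w => @proj2 _ _)
  (fun w Qw => firstS Qw.1) SQ Psi mPsi Psi0.
have -> : (\int[P]_(w in [set w | of_type i (e w)] `&` Q) Psi (w, fine (S w)) =
    \int[P]_(w in A `&` [set w | ev w] `&` [set w | I (fine (S w))])
      q (flight i (st w) (fine (S w))))%E.
  rewrite [LHS]integral_mkcond [RHS]integral_mkcond; apply: eq_integral => w _.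
  rewrite !patchE; case: ifPn => [/set_mem[/= ty [fw Soo]]|nQ]; last first.
    rewrite memNset//= evE => -[[Aw /and3P[ty /andP[_ Soo] fw]] _]; move/negP: nQ; apply.
    exact/mem_set.
  have fS : (fine (S w))%:E = S w by rewrite fineK// ge0_fin_numE.
  rewrite /Psi/= fS; case: ifPn => [/andP[/andP[/set_mem Aw /set_mem Iw] Se]|nPsi].
    rewrite mem_set//; split => //; split => //=; rewrite evE; apply/and3P; split => //.
    by apply/andP; split.
  rewrite memNset//= evE => -[[Aw /and3P[_ /andP[Se _] _]] Iw]; move/negP: nPsi; apply.
  by rewrite (mem_set Aw) (mem_set (Iw : I (fine (S w)))).
move=> ->.
rewrite [LHS]integral_mkcond [RHS]integral_mkcond; apply: eq_integral => w _.
rewrite !patchE; case: ifPn => [/set_mem/= ty|nty]; last first.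
  case: ifPn => // _; rewrite integral0_eq// => s _; rewrite /flight_surv/=.
  case: ifP; last by rewrite mul0e.
  by move=> /andP[ty _]; move/negP: nty; case; exact/mem_set.
case: ifPn => [Aw|nAw]; last first.
  by rewrite integral0_eq// => s _; rewrite /Psi/= (negbTE nAw) mul0e.
rewrite [LHS]integral_mkcond [RHS]integral_mkcond; apply: eq_integral => s _.
rewrite !patchE; case: ifPn => [s0|ns0]; last first.
  by rewrite memNset// => -[s0 _]; move/negP: ns0; apply; exact/mem_set.
case: ifPn => [/set_mem[_ Is]|nIs]; last first.
  rewrite /Psi/=; case: ifP; last by rewrite mul0e.
  move=> /andP[/andP[_ /set_mem Is] _]; move/negP: nIs; case; apply/mem_set.
  by split => //; exact/set_mem.
rewrite /Psi /flight_surv/= Aw (mem_set Is) ty/=.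
case: ifPn => [sexit|_]; last by rewrite !mul0e.
have mhw := measurable_snd_section w mh; have mhw' := measurable_snd_section w mh'.
have -> : survival_rate (fun u => along l r i (st w, u)) s =
    survival_rate (fun u => h (w, u)) s * survival_rate (fun u => h' (w, u)) s.
  rewrite -(@survival_rateDr _ _ _ (Num.max c c'))//; congr (survival_rate _ s).
  by apply/funext => u; rewrite /h /h' /along/= rE.
by rewrite muleC mulrC EFinM -muleA.
Qed.

End race.

(** * Observation of a particle at time [t] *)

Section observation.
Variables (vmin vmax : R) (xs : cross_sections R m).
Hypothesis hxs : admissible_cross_sections l D (shell vmin vmax) xs.
Variables (g : 'I_m -> conf R -> R) (t : R).
Hypothesis hg : forall j, bounded_nonneg (g j).
Local Notation total_rate := (total_rate l D vmin vmax xs).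

(* G_i(z) in the notation of the header *)
Definition mean_value i (z : R * conf R) : \bar R :=
  if z.1 <= t
  then (surv l D vmin vmax xs i z.2 (t - z.1) * g i (flight i z.2 (t - z.1)))%:E else 0%E.

Let mgap : measurable_fun setT (fun z : R * conf R => t - z.1).
Proof. by apply: measurable_funB; [exact: measurable_cst|exact: measurable_fst]. Qed.

Let mg_end i : measurable_fun setT (fun z : R * conf R => g i (flight i z.2 (t - z.1))).
Proof.
have [mg _ _] := hg i; apply: (measurableT_comp mg).
exact: (measurable_fun_pair_comp (@measurable_flight R m l i) measurable_snd mgap).
Qed.

Lemma measurable_mean_value i : measurable_fun setT (mean_value i).
Proof.
apply: measurable_fun_ifT => //; first exact: measurable_fun_ler.
apply/measurable_EFinP; apply: measurable_funM => //.
exact: (measurable_fun_pair_comp (measurable_surv oD hxs i) measurable_snd mgap).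
Qed.

Lemma mean_value_ge0 i z : (0 <= mean_value i z)%E.
Proof.
rewrite /mean_value; case: ifP => // _; have [_ g0 _] := hg i.
by rewrite lee_fin mulr_ge0 ?surv_ge0.
Qed.

Variables (S : T -> \bar R) (wt : T -> R) (k : 'I_m -> conf R -> R) (c : 'I_m -> conf R * R -> R).

(** [wt] is the weight accumulated before the flight and [c] the weight along it. Both are 1 for an
    emission. For the walk, [c] turns a survival function of rate [k] into one of rate [total_rate],
    which is the hypothesis [survivalM]. *)
Definition observed_value w : R :=
  if e w is Some (b, i, x) then
    if [&& b <= t, ((t - b)%:E < S w)%E & ((t - b)%:E < exit_time l D i x)%E]
    then wt w * (c i (x, t - b) * g i (flight i x (t - b))) else 0
  else 0.

Hypotheses (mS : measurable_fun setT S) (S0 : forall w, (0 <= S w)%E).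
Hypotheses (mwt : measurable_fun setT (wt : TF -> R)) (wt0 : forall w, 0 <= wt w).
Hypotheses (mc : forall i, measurable_fun setT (c i)) (c0 : forall i z, 0 <= c i z).
Hypothesis bk : forall i, bounded_nonneg (k i).
Hypothesis survivalM : forall i z,
  survival_rate (fun u => along l (k i) i (z.1, u)) z.2 * c i z =
  survival_rate (fun u => along l (total_rate i) i (z.1, u)) z.2.
Hypothesis clock : forall i A a, F A -> A `<=` [set w | of_type i (e w)] -> 0 <= a ->
  P (A `&` [set w | (a%:E < S w)%E]) =
  (\int[P]_(w in A) (survival_rate (fun u => along l (k i) i (st w, u)) a)%:E)%E.

Let present (i : 'I_m) (z : R * conf R) := (z.1 <= t) && ((t - z.1)%:E < exit_time l D i z.2)%E.

Let known i := [set w | of_type i (e w) && present i (birth (e w))].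

Let mknown i : F (known i).
Proof.
apply/(sub_measurableE sF).
rewrite (_ : known i = [set w | of_type i (e w)] `&` [set w | present i (birth (e w))]).
  apply: measurableI; first exact: me.1.
  have mp : measurable_fun setT (present i).
    apply: measurable_and; first exact: measurable_fun_ler.
    exact: (measurable_fun_pair_comp (measurable_lt_exit_time l oD i) measurable_snd mgap).
  by apply: measurable_bool_set; exact: (measurableT_comp mp me.2).
by apply/seteqP; split=> w /= => /andP.
Qed.

Let mbirth : measurable_fun setT (fun w => birth (e w)).
Proof. exact: (sub_measurable_fun sF Fm me.2). Qed.

Let cases i w := of_type i (e w) && present i (birth (e w)) &&
  ((t - (birth (e w)).1)%:E < S w)%E.

Let casesE i : [set w | cases i w] = known i `&` [set w | ((t - (birth (e w)).1)%:E < S w)%E].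
Proof. by apply/seteqP; split=> w /= => /andP. Qed.

Let mcases i : measurable [set w | cases i w].
Proof.
rewrite casesE; apply: measurableI; first exact: Fm (@mknown i).
rewrite -[X in measurable X]setTI; apply: measurable_lte => //.
by apply/measurable_EFinP; exact: (measurableT_comp mgap mbirth).
Qed.

Let value i w := wt w * (c i (st w, t - (birth (e w)).1) * g i (flight i (st w) (t - (birth (e w)).1))).

Let casesP i w : cases i w -> observed_value w = value i w.
Proof.
rewrite /cases /observed_value /value; case: (e w) => [[[b j] x]|//]/=.
by move=> /andP[/andP[/eqP -> /andP[-> ->]] ->].
Qed.

Let not_cases w : (forall i, ~~ cases i w) -> observed_value w = 0.
Proof.
rewrite /cases /observed_value; case: (e w) => [[[b i] x]|//] /(_ i)/=.
rewrite eqxx /present/=; case: ifP => // /and3P[-> -> ->].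
by [].
Qed.

Let mvalueF i : measurable_fun setT (value i : TF -> R).
Proof.
apply: measurable_funM => //; apply: measurable_funM.
  exact: (measurable_fun_pair_comp (mc i) mstF (measurableT_comp mgap me.2)).
exact: (measurableT_comp (@mg_end i) me.2).
Qed.

Let value_ge0 i w : 0 <= value i w.
Proof. by have [_ g0 _] := hg i; apply: mulr_ge0 => //; apply: mulr_ge0. Qed.

Lemma observed_value_ge0 w : 0 <= observed_value w.
Proof.
have [[i ci]|nc] := pselect (exists i, cases i w); first by rewrite (casesP ci).
by rewrite not_cases// => i; apply/negP => ci; apply: nc; exists i.
Qed.

Lemma measurable_observed_value : measurable_fun setT observed_value.
Proof.
apply: (measurable_fun_cases (p := cases) (c := 0) (f := value)) => //.
- by move=> i; exact: (sub_measurable_fun sF Fm (@mvalueF i)).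
Qed.

(** That the particle is born before [t] and that its flight does not leave [D] by then are known at
    birth. Only the clock is random, and [survival_at] evaluates it at the age [t - b]. *)
Lemma observed_value_mean : (\int[P]_w (observed_value w)%:E =
  \sum_(i < m) \int[P]_(w in [set w | of_type i (e w)]) ((wt w)%:E * mean_value i (birth (e w))))%E.
Proof.
rewrite (@integral_cases 'I_m _ T R P setT cases)//; last 4 first.
- exact/measurable_EFinP/measurable_observed_value.
- by move=> w; rewrite lee_fin observed_value_ge0.
- by move=> i j w /andP[/andP[oi _] _] /andP[/andP[oj _] _]; exact: of_type_uniq oi oj.
- by move=> w _ /not_cases ->.
apply: eq_bigr => i _.
have [ma a0 [b ab]] := bounded_along l i (bk i).
have mh : measurable_fun setT (fun z : T * R => along l (k i) i (st z.1, z.2)).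
  exact: (measurable_fun_pair_comp ma (measurableT_comp mst measurable_fst) measurable_snd).
have clk A a : F A -> A `<=` known i -> 0 <= a -> P (A `&` [set w | (a%:E < S w)%E]) =
    (\int[P]_(w in A) (survival_rate (fun u => along l (k i) i (st w, u)) a)%:E)%E.
  by move=> FA Ai a'0; apply: clock => // w /Ai /andP[].
have gap0 w : known i w -> 0 <= t - (birth (e w)).1.
  by move=> /andP[_ /andP[bt _]]; rewrite subr_ge0.
have mv : measurable_fun setT ((fun w => (value i w)%:E) : TF -> \bar R).
  by apply/measurable_EFinP; exact: mvalueF.
have v0 w : (0 <= (value i w)%:E)%E by rewrite lee_fin.
have E := @survival_at _ _ _ P _ sF Fm S _ b (known i) mS S0 mh (fun=> a0 _) (fun=> ab _)
  (@mknown i) clk (fun w => t - (birth (e w)).1) (fun w => (value i w)%:E)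
  (measurableT_comp mgap me.2) gap0 mv v0.
rewrite casesE (eq_integral (fun w => (value i w)%:E)); last first.
  by move=> w; rewrite -casesE => /set_mem /casesP ->.
rewrite E.
rewrite [LHS]integral_mkcond [RHS]integral_mkcond; apply: eq_integral => w _.
rewrite !patchE; case: ifPn => [/set_mem/andP[ty /andP[bt ex]]|nA0].
  rewrite mem_set// /mean_value bt /surv ex -(survivalM i (st w, t - (birth (e w)).1))/=.
  by rewrite -!EFinM /value; congr EFin; ring.
case: ifPn => // /set_mem /= ty; rewrite /mean_value; case: ifP => bt; last by rewrite mule0.
rewrite /surv; case: ifP => ex; last by rewrite mul0r mule0.
by move/negP: nA0; case; apply/mem_set; rewrite /known/= ty /present bt.
Qed.

End observation.
End particle.

(** * The random walk *)

Section random_walk.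
Variables (R : realType) (m l : nat) (hl : (1 <= l < m)%N).
Variables (D : set (vec3 R)) (oD : open D) (vmin vmax : R).
Local Notation V := (shell vmin vmax).
Variable xs : cross_sections R m.
Hypothesis hxs : admissible_cross_sections l D V xs.
Local Notation DV := (D `*` V).
Local Notation flight := (flight l).
Variable pi : 'I_m -> 'I_m -> R.-ker (conf R) ~> vec3 R.
Hypothesis hpi : is_jump_kernel l D V xs pi.
Context dT (T : measurableType dT) (P : probability T R).
Variables (i0 : 'I_m) (x0 : conf R) (Y : mnrw l D V xs pi P i0 x0).
Hypothesis DVx0 : DV x0.
Local Notation walk := (walk l D Y i0 x0).
Local Notation S := (sojourn Y).
Local Notation F := (mnrw_F Y).
Local Notation G := (mnrw_G Y).
Local Notation TF n := (g_sigma_algebraType (F n)).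
Local Notation TG n := (g_sigma_algebraType (G n)).
Local Notation alp := (alp l D vmin vmax xs).
Local Notation total_density := (total_density l D vmin vmax xs).
Local Notation isotope_rate := (isotope_rate l D vmin vmax xs).
Local Notation next_event := (next_event l D vmin vmax xs).
Local Notation total_rate := (total_rate l D vmin vmax xs).
Local Notation alive := (alive l D).
Local Notation walk_at := (walk_at l D Y i0 x0).

Let sF n : sigma_algebra setT (F n) := F_sigma_algebra (mnrw_filtration Y) n.
Let sG n : sigma_algebra setT (G n) := G_sigma_algebra (mnrw_filtration Y) n.
Let Fm n : F n `<=` measurable := @F_measurable _ _ _ _ (mnrw_filtration Y) n.
Let FG n : F n `<=` G n := @F_sub_G _ _ _ _ (mnrw_filtration Y) n.
Let GF n : G n `<=` F n.+1 := @G_sub_F _ _ _ _ (mnrw_filtration Y) n.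
Let Gm n : G n `<=` measurable. Proof. by move=> A /GF/Fm. Qed.

Local Arguments Defs.walk : simpl never.

Lemma walkS n w : walk n.+1 w =
  if walk n w is Some (b, i, x) then
    if alive i x (S n w) then
      Some (b + fine (S n w), new_type Y n w,
            ((flight i x (fine (S n w))).1, new_velocity Y n w))
    else None
  else None.
Proof. by []. Qed.

Lemma walk_valid n w b i x : walk n w = Some (b, i, x) -> 0 <= b /\ DV x.
Proof.
elim: n b i x => [b i x [<- _ <-]//|n IH b i x].
rewrite walkS; case E : (walk n w) => [[[b' i'] x']|//].
have [b'0 [Dx' Vx']] := IH _ _ _ E.
rewrite aliveE ?(sojourn_ge0 Y)//; case: ifP => // /andP[Soo Se] [<- _ <-].
have S0 : 0 <= fine (S n w) by rewrite fine_ge0// (sojourn_ge0 Y).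
split; first by rewrite addr_ge0.
split => /=; last exact: new_velocity_in_V.
exact: (flight_in oD S0 Se).
Qed.

Lemma measurable_sojourn_G n : measurable_fun setT (S n : TG n -> \bar R).
Proof.
by move=> _ B mB; rewrite setTI; apply/(sub_measurableE (sG n)); exact: sojourn_G.
Qed.

Lemma measurable_sojourn_F n : measurable_fun setT (S n : TF n.+1 -> \bar R).
Proof. exact: (measurable_sub_sigma (sG n) (sF n.+1) (GF (n := n)) (@measurable_sojourn_G n)). Qed.

Lemma measurable_new_velocity n : measurable_fun setT (new_velocity Y n : TF n.+1 -> vec3 R).
Proof.
by move=> _ B mB; rewrite setTI; apply/(sub_measurableE (sF n.+1)); exact: new_velocity_F.
Qed.

Lemma measurable_new_type n j : measurable ([set w | new_type Y n w = j] : set (TF n.+1)).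
Proof. by apply/(sub_measurableE (sF n.+1)); exact: new_type_F. Qed.

Lemma measurable_walk n : state_measurable (walk n : TF n -> _).
Proof.
elim: n => [|n [mi mb]].
  split=> [i|]; last exact: measurable_cst.
  have [ii|ii] := eqVneq i0 i.
    by rewrite (_ : [set w | _] = setT)//; apply/seteqP; split=> // w _ /=; rewrite ii.
  by rewrite (_ : [set w | _] = set0)//; apply/seteqP; split=> // w /=; rewrite (negbTE ii).
have FF : F n `<=` F n.+1 by move=> A /FG/GF.
have mi' i : measurable ([set w | of_type i (walk n w)] : set (TF n.+1)).
  by apply/(sub_measurableE (sF n.+1))/FF/(sub_measurableE (sF n)).
have mb' : measurable_fun setT ((fun w => birth (walk n w)) : TF n.+1 -> R * conf R).
  exact: (measurable_sub_sigma (sF n) (sF n.+1) FF mb).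
have mx' : measurable_fun setT (fun w : TF n.+1 => (birth (walk n w)).2).
  exact: (measurableT_comp measurable_snd mb').
have mS := @measurable_sojourn_F n.
pose p i (w : TF n.+1) := of_type i (walk n w) && alive i (birth (walk n w)).2 (S n w).
have mp i : measurable [set w | p i w].
  rewrite (_ : [set w | _] = [set w | of_type i (walk n w)] `&`
      [set w | alive i (birth (walk n w)).2 (S n w)]).
    apply: measurableI; first exact: mi'.
    by apply: (measurable_alive _ oD) => // w; exact: sojourn_ge0.
  by apply/seteqP; split=> w /=; rewrite /p => /andP.
split.
  move=> j; rewrite (_ : [set w | _] = \bigcup_(i in [set: 'I_m])
      ([set w | p i w] `&` [set w | new_type Y n w = j])).
    apply: fin_bigcup_measurable => // i _; apply: measurableI; first exact: mp.
    exact: measurable_new_type.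
  apply/seteqP; split=> w /=; rewrite walkS.
    case E : (walk n w) => [[[b i] x]|//]; case: ifP => // al /eqP nt.
    by exists i => //; split => //=; rewrite /p E /= eqxx.
  by move=> [i _ [/andP[/of_typeP -> al] <-]]; rewrite al/=.
have mfine : measurable_fun setT (fun w : TF n.+1 => fine (S n w)).
  exact: measurableT_comp.
apply: (measurable_fun_cases (p := p) (c := point) (f := fun i w =>
  ((birth (walk n w)).1 + fine (S n w),
   ((flight i (birth (walk n w)).2 (fine (S n w))).1, new_velocity Y n w)))) => //.
- move=> i; apply: measurable_fun_pair.
    by apply: measurable_funD => //; exact: (measurableT_comp measurable_fst mb').
  apply: measurable_fun_pair; last exact: measurable_new_velocity.
  apply: (measurableT_comp measurable_fst).
  exact: (measurable_fun_pair_comp (@measurable_flight R m l i) mx' mfine).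
- move=> i w /andP[/of_typeP E al]; rewrite /comp walkS E /=.
  by rewrite al.
- move=> w np; rewrite /comp walkS.
  case E : (walk n w) => [[[b i] x]|//]; case: ifP => // al.
  by have := np i; rewrite /p E/= eqxx al.
Qed.

(* e^{int beta} over one leg of the walk, as a ratio of survival functions *)
Definition leg_weight (i : 'I_m) (z : conf R * R) : R :=
  survival_rate (fun u => along l (total_rate i) i (z.1, u)) z.2 /
  survival_rate (fun u => along l (alp i) i (z.1, u)) z.2.

Lemma leg_weight_ge0 i z : 0 <= leg_weight i z.
Proof. by rewrite divr_ge0// ltW// survival_rate_gt0. Qed.

Lemma measurable_leg_weight i : measurable_fun setT (leg_weight i).
Proof.
have [mt t0 [c tc]] := bounded_along l i (bounded_total_rate oD hxs i).
have [ma a0 [c' ac]] := bounded_along l i (bounded_alp oD hxs i).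
apply: measurable_funM; first exact: (measurable_survival_rate mt t0 tc).
pose k z : R := - cumulative_rate (fun u => along l (alp i) i (z.1, u)) z.2.
rewrite (_ : (fun z => _) = (fun z : conf R * R => expR (- k z))).
  apply: measurableT_comp => //; apply: measurableT_comp => //; apply: measurableT_comp => //.
  exact: (measurable_cumulative_rate ma a0 ac).
by apply/funext => z; rewrite /k survival_rate.unlock expRN invrK opprK.
Qed.

(** The weight is defined leg by leg, and not as the exponential of an integral along the path, so
    that it is visibly a function of the information [F n]. [expR_path] makes the link. *)
Fixpoint weight (n : nat) (w : T) : R :=
  if n is n'.+1 then
    if walk n' w is Some (_, i, x) then weight n' w * leg_weight i (x, fine (S n' w)) else 0
  else 1.

Lemma weight_ge0 n w : 0 <= weight n w.
Proof.
elim: n => //= n IH; case: (walk n w) => [[[b i] x]|//].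
by rewrite mulr_ge0// leg_weight_ge0.
Qed.

Lemma measurable_weight n : measurable_fun setT (weight n : TF n -> R).
Proof.
elim: n => [|n IH]; first exact: measurable_cst.
have FF : F n `<=` F n.+1 by move=> A /FG/GF.
have [mi mb] := measurable_walk n.
have mb' : measurable_fun setT ((fun w => birth (walk n w)) : TF n.+1 -> R * conf R).
  exact: (measurable_sub_sigma (sF n) (sF n.+1) FF mb).
apply: (measurable_fun_cases (p := fun i (w : TF n.+1) => of_type i (walk n w)) (c := 0)
  (f := fun i (w : TF n.+1) => weight n w * leg_weight i ((birth (walk n w)).2, fine (S n w)))) => //.
- by move=> i; apply/(sub_measurableE (sF n.+1))/FF/(sub_measurableE (sF n)).
- move=> i; apply: measurable_funM.
    exact: (measurable_sub_sigma (sF n) (sF n.+1) FF IH).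
  apply: (measurable_fun_pair_comp (measurable_leg_weight i)).
    exact: (measurableT_comp measurable_snd mb').
  by apply: measurableT_comp => //; exact: measurable_sojourn_F.
- by move=> i w /of_typeP E /=; rewrite E.
- by move=> w np /=; case E : (walk n w) => [[[b i] x]|//]; have := np i; rewrite E/= eqxx.
Qed.

Lemma total_density_out i j y v : ~ V v -> total_density i j (y, v) = 0.
Proof.
move=> nV; have nDVV : ~ (DV `*` V) (y, v) by move=> [].
rewrite /total_density /scat_density /fission_density /pscat /pfis !zero_off_out//.
by rewrite !mulr0 !if_same addr0.
Qed.

Let st n w := (birth (walk n w)).2.
Let typ n i := [set w | of_type i (walk n w)].

Let mtyp n i : F n (typ n i).
Proof. by apply/(sub_measurableE (sF n)); exact: (measurable_walk n).1. Qed.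

Let mst n : measurable_fun setT (st n : TF n -> conf R).
Proof. exact: (measurableT_comp measurable_snd (measurable_walk n).2). Qed.

Let st_DV n i w : typ n i w -> DV (st n w).
Proof. by move=> /of_typeP /(walk_valid)[]. Qed.

Let mS n : measurable_fun setT (S n).
Proof.
by apply: (sub_measurable_fun (sG n) (@Gm n)); exact: measurable_sojourn_G.
Qed.

Local Notation walk_surv n i := (@flight_surv R m l D dT T (F n) (walk n) (alp i) i).

Let mwalk_surv n i : measurable_fun setT (walk_surv n i).
Proof.
exact: (@measurable_flight_surv R m l D oD dT T (F n) (sF n) _ (measurable_walk n) _ i (bounded_alp oD hxs i)).
Qed.

Let walk_surv0 n i z : 0 <= walk_surv n i z. Proof. exact: flight_surv_ge0. Qed.

Definition jump_event n i j : set T :=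
  [set w | of_type i (walk n w) && alive i (st n w) (S n w) && (new_type Y n w == j)].

Let alive_G n i : G n [set w | of_type i (walk n w) && alive i (st n w) (S n w)].
Proof.
apply/(sub_measurableE (sG n)).
rewrite (_ : [set w | _] = typ n i `&` [set w | alive i (st n w) (S n w)]); last first.
  by apply/seteqP; split=> w /= => /andP.
apply: measurableI; first by apply/(sub_measurableE (sG n))/FG.
apply: (measurable_alive _ oD); last by move=> w; exact: sojourn_ge0.
  exact: (measurable_sub_sigma (sF n) (sG n) (FG (n := n)) (mst (n := n))).
exact: measurable_sojourn_G.
Qed.

Lemma measurable_jump_event n i j : measurable (jump_event n i j).
Proof.
rewrite (_ : jump_event n i j = [set w | of_type i (walk n w) && alive i (st n w) (S n w)] `&`
   new_type Y n @^-1` [set j]); last first.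
  apply/seteqP; split=> w; rewrite /jump_event/=; first by move=> /andP[al /eqP].
  by move=> [-> ->]; rewrite eqxx.
by apply: measurableI; [exact: Gm|apply: (Fm (n := n.+1)); exact: new_type_F].
Qed.

Let clock n i A a : F n A -> A `<=` typ n i -> 0 <= a ->
  P (A `&` [set w | (a%:E < S n w)%E]) =
  (\int[P]_(w in A) (survival_rate (fun u => along l (alp i) i (st n w, u)) a)%:E)%E.
Proof.
move=> FA Ai a0; rewrite (mnrw_sojourns a0 FA); last by move=> w /Ai /of_typeP ->.
apply: eq_integral => w /set_mem Aw; rewrite /sojourn_law.
have /of_typeP -> := Ai _ Aw; congr EFin.
apply: (@survivalE R m l D vmin vmax _ _ i _ a (bounded_alp oD hxs i)) => //.
- by move=> y; exact: alphaE.
- by move=> y; exact: alp_out.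
- exact: (st_DV (Ai _ Aw)).2.
Qed.

Let clocks n i A a b : F n A -> A `<=` typ n i -> 0 <= a -> 0 <= b ->
  P (A `&` [set w | (a%:E < S n w)%E /\ (b%:E < +oo)%E]) =
  (\int[P]_(w in A) (survival_rate (fun u => along l (alp i) i (st n w, u)) a *
     survival_rate (fun=> 0) b)%:E)%E.
Proof.
move=> FA Ai a0 b0.
rewrite (_ : [set w | _ /\ _] = [set w | (a%:E < S n w)%E]); last first.
  by apply/seteqP; split=> w /= => [[]//|]; split => //; rewrite ltry.
by rewrite (clock FA Ai a0); apply: eq_integral => w _; rewrite survival_rate_cst0 mulr1.
Qed.

(** The two prescribed laws are used backwards along the filtration: first that of the jump, on an
    event of [G n] where the sojourn is known; then that of the sojourn, on an event of [F n],
    through [particle_race]. *)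
Lemma walk_rect n i j A I B : F n A -> measurable I -> measurable B ->
  P (jump_event n i j `&` A `&` [set w | I (fine (S n w)) /\ B (new_velocity Y n w)]) =
  (\int[P]_(w in A) \int[leb1]_(s in `[0%R, +oo[ `&` I) ((walk_surv n i (w, s))%:E *
    (\int[leb3]_(v in B) (total_density i j (flight i (st n w) s, v))%:E +
     (isotope_rate i j (flight i (st n w) s))%:E * (\1_B (st n w).2)%:E)))%E.
Proof.
move=> FA mI mB.
(* The jump kernel is described on [V] only. Replacing [B] by its trace on [V] costs nothing, as all
   new velocities lie in [V]. *)
have mBV : measurable (B `&` V) by apply: measurableI => //; exact: measurable_shell.
pose A' := A `&` [set w | of_type i (walk n w) && alive i (st n w) (S n w)] `&`
  [set w | I (fine (S n w))].
have GA' : G n A'.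
  apply/(sub_measurableE (sG n)); apply: measurableI; first apply: measurableI.
  - exact/(sub_measurableE (sG n))/FG.
  - exact/(sub_measurableE (sG n))/alive_G.
  - rewrite -[X in measurable X]setTI.
    have mfine : measurable_fun setT (fun w : TG n => fine (S n w)).
      by apply: measurableT_comp => //; exact: measurable_sojourn_G.
    exact: mfine.
rewrite (_ : _ `&` _ `&` _ = A' `&` [set w | new_type Y n w = j /\ (B `&` V) (new_velocity Y n w)]); last first.
  apply/seteqP; split=> w /=; rewrite /jump_event/=.
    move=> [[/andP[a /eqP nt] Aw] [Iw Bw]]; split => //; split => //; split => //.
    exact: new_velocity_in_V.
  by move=> [[[Aw a] Iw] [nt [Bw _]]]; rewrite a nt eqxx.
rewrite (mnrw_jumps _ mBV (@subIsetr _ _ _) GA'); last first.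
  move=> w [[_ /andP[/of_typeP E al] _]]; rewrite walkS E.
  by move: al; rewrite /st => ->.
transitivity (\int[P]_(w in A') pi i j (flight i (st n w) (fine (S n w))) (B `&` V))%E.
  apply: eq_integral => w /set_mem[[_ /andP[/of_typeP E _]] _].
  by rewrite /jump_law {1}E.
have mQ : measurable [set w : T | true] by rewrite (_ : [set _ | _] = setT)//; apply/seteqP; split.
have := @particle_race _ _ _ _ oD _ _ P _ (sF n) (@Fm n) _ (measurable_walk n) i (S n) (fun=> +oo%E)
  (alp i) (fun=> 0) (alp i) (fun=> true) _ (@mS n) (measurable_cst _) (sojourn_ge0 Y n)
  (bounded_alp oD hxs i) (bounded_nonneg_cst _ (lexx 0)) (fun=> addr0 _) mQ (fun w _ => leey _)
  (fun _ _ => isT) _ (@clocks n i) A I (fun y => pi i j y (B `&` V)) FA mI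
  (measurable_kernel (pi i j) _ mBV) (fun=> measure_ge0 _ _).
move=> ->; last by move=> w; rewrite andbT.
apply: eq_integral => w _; apply: eq_integral => s /set_mem[/= s0 _].
rewrite /flight_surv/=; case: ifPn => [/andP[typw sexit]|_]; last by rewrite !mul0e.
move: s0; rewrite in_itv/= andbT => s0; have [Dst Vst] := st_DV typw.
have DVy : DV (flight i (st n w) s).
  by split; [exact: (flight_in oD s0 sexit)|rewrite /= flight_snd].
rewrite (jumpE hl oD hxs i j hpi DVy mBV (@subIsetr _ _ _)).
congr (_ * (_ + _ * _))%E.
- rewrite [LHS]integral_mkcond [RHS]integral_mkcond; apply: eq_integral => v _.
  rewrite !patchE in_setI; case: (v \in B) => //=; case: ifPn => // nV.
  by rewrite total_density_out// => Vv; move/negP: nV; apply; exact/mem_set.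
- rewrite flight_snd diracE in_setI (mem_set Vst) andbT.
  by rewrite indicE.
Qed.

(** A prompt type is created with a density in the velocity and an isotope with an atom, so for each
    [j] one of the two terms is 0 and one of the two event laws applies. *)
Lemma walk_event n i j (Phi : TF n * (R * vec3 R) -> \bar R) :
  measurable_fun setT Phi -> (forall z, (0 <= Phi z)%E) ->
  (\int[P]_(w in jump_event n i j) Phi (w, (fine (S n w), new_velocity Y n w)) =
   \int[P]_w \int[leb1]_(s in `[0%R, +oo[) ((walk_surv n i (w, s))%:E *
    (\int[leb3]_v ((total_density i j (flight i (st n w) s, v))%:E * Phi (w, (s, v))) +
     (isotope_rate i j (flight i (st n w) s))%:E * Phi (w, (s, (st n w).2)))))%E.
Proof.
move=> mPhi Phi0.
(* The event laws are about sequences of events: a single one is followed by empty sets. *)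
pose Q k := if k == 0%N then jump_event n i j else set0.
have mQ k : measurable (Q k) by rewrite /Q; case: ifP => // _; exact: measurable_jump_event.
have mfS : measurable_fun setT (fun w => fine (S n w)) by exact: measurableT_comp.
have mvel (k : nat) : measurable_fun setT (new_velocity Y n).
  by apply: (sub_measurable_fun (sF n.+1) (@Fm n.+1)); exact: measurable_new_velocity.
have Qfin : (\sum_(k <oo) P (Q k) < +oo)%E.
  rewrite (@nneseries_only0 _ (P \o Q))/=.
  - by rewrite (le_lt_trans (probability_le1 _ _)) ?ltry//; exact: measurable_jump_event.
  - exact: measure_ge0.
  - by move=> [|k]//= _; rewrite measure0.
have <- : (\sum_(k <oo) \int[P]_(w in Q k) Phi (w, (fine (S n w), new_velocity Y n w)) =
    \int[P]_(w in jump_event n i j) Phi (w, (fine (S n w), new_velocity Y n w)))%E.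
  rewrite (@nneseries_only0 _ (fun k => \int[P]_(w in Q k) _)%E)//=.
    exact: integral_ge0.
  by move=> [|k]//= _; rewrite integral_set0.
have QE A I B : (\sum_(k <oo) P (Q k `&` A `&`
    [set w | I (fine (S n w)) /\ B (new_velocity Y n w)]) =
    P (jump_event n i j `&` A `&` [set w | I (fine (S n w)) /\ B (new_velocity Y n w)]))%E.
  rewrite (@nneseries_only0 _ (fun k => P (Q k `&` A `&` _)))//=.
  by move=> [|k]//= _; rewrite !set0I measure0.
have mfl : measurable_fun setT (fun z : TF n * R => flight i (st n z.1) z.2).
  exact: (measurable_flight_age l (measurable_walk n) i).
have [mtd td0 _] := bounded_total_density oD hxs i j.
have [mir ir0 _] := bounded_isotope_rate oD hxs i j.
have mws := @mwalk_surv n i.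
have ws0 := @walk_surv0 n i.
have [jl|lj] := ltnP j l.
  have irE x : isotope_rate i j x = 0.
    by rewrite /isotope_rate leqNgt jl andbF.
  rewrite (event_law_density (sF n) (@Fm n) mQ mfS mvel Qfin mws ws0 mtd td0 mfl _ mPhi Phi0).
    apply: eq_integral => w _; apply: eq_integral => s _.
    by rewrite irE mul0e adde0.
  move=> A I B FA mI mB; rewrite QE (walk_rect i j FA mI mB).
  apply: eq_integral => w _; apply: eq_integral => s _.
  by rewrite irE mul0e adde0.
have tdE z : total_density i j z = 0.
  rewrite /total_density /fission_density ltnNge lj/= addr0; case: eqP => // ij.
  by rewrite /scat_density scat_isotope ?mul0r// ij.
pose g (z : TF n * R) := walk_surv n i z * isotope_rate i j (flight i (st n z.1) z.2).
have mg : measurable_fun setT g.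
  by apply: measurable_funM => //; exact: (measurableT_comp mir mfl).
have g0 z : 0 <= g z by rewrite mulr_ge0.
have mth : measurable_fun setT (fun w : TF n => (st n w).2).
  exact: (measurableT_comp measurable_snd (mst (n := n))).
transitivity (\int[P]_w \int[leb1]_(s in `[0%R, +oo[)
    ((g (w, s))%:E * Phi (w, (s, (st n w).2))))%E; last first.
  apply: eq_integral => w _; apply: eq_integral => s _.
  rewrite integral0_eq ?add0e; last by move=> v _; rewrite tdE mul0e.
  by rewrite /g EFinM muleA.
apply: (event_law_atom (sF n) (@Fm n) mQ mfS mvel Qfin mg g0 mth _ mPhi Phi0).
move=> A I B FA mI mB; rewrite QE (walk_rect i j FA mI mB).
apply: eq_integral => w _; apply: eq_integral => s _.
rewrite integral0_eq ?add0e; last by move=> v _; rewrite tdE.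
by rewrite /g EFinM muleA.
Qed.

(** * Recursion for the weighted means of the walk *)

Definition walk_mean (n : nat) (H : 'I_m -> R * conf R -> \bar R) : \bar R :=
  (\sum_(i < m) \int[P]_(w in [set w | of_type i (walk n w)])
     ((weight n w)%:E * H i (birth (walk n w))))%E.

Let mbirthF n : measurable_fun setT (fun w : TF n => birth (walk n w)).
Proof. exact: (measurable_walk n).2. Qed.

Let mbirth n : measurable_fun setT (fun w => birth (walk n w)).
Proof. exact: (sub_measurable_fun (sF n) (@Fm n) (@mbirthF n)). Qed.

Let mweight n : measurable_fun setT (weight n).
Proof. exact: (sub_measurable_fun (sF n) (@Fm n) (@measurable_weight n)). Qed.

(** The change of clocks happens here. The new factor of [weight n.+1] is [leg_weight] at the age of
    the jump. It cancels the survival function of rate [alp], which governs the sojourns, and puts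
    that of [total_rate], hence [surv], in its place. *)
Lemma walk_mean_jump n i j (h : R * conf R -> \bar R) :
  measurable_fun setT h -> (forall z, 0 <= h z)%E ->
  (\int[P]_(w in jump_event n i j) ((weight n.+1 w)%:E * h (birth (walk n.+1 w))) =
   \int[P]_(w in [set w | of_type i (walk n w)]) ((weight n w)%:E *
     (flight_density l D vmin vmax xs (total_density i j) i h (birth (walk n w)) +
      flight_atom l D vmin vmax xs (isotope_rate i j) i h (birth (walk n w)))))%E.
Proof.
move=> mh h0.
pose Phi (z : TF n * (R * vec3 R)) : \bar R :=
  ((weight n z.1 * leg_weight i (st n z.1, z.2.1))%:E *
   h (((birth (walk n z.1)).1 + z.2.1)%R, ((flight i (st n z.1) z.2.1).1, z.2.2)))%E.
have mb1 : measurable_fun setT (fun z : TF n * (R * vec3 R) => birth (walk n z.1)).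
  exact: (measurableT_comp (mbirthF (n := n)) measurable_fst).
have mst2 : measurable_fun setT (fun z : TF n * (R * vec3 R) => st n z.1).
  exact: (measurableT_comp measurable_snd mb1).
have ms : measurable_fun setT (fun z : TF n * (R * vec3 R) => z.2.1).
  by apply: measurableT_comp => //; exact: measurable_snd.
have mv : measurable_fun setT (fun z : TF n * (R * vec3 R) => z.2.2).
  by apply: measurableT_comp => //; exact: measurable_snd.
have mPhi : measurable_fun setT Phi.
  apply: emeasurable_funM.
    apply/measurable_EFinP; apply: measurable_funM.
      exact: (measurableT_comp (@measurable_weight n) measurable_fst).
    exact: (measurable_fun_pair_comp (measurable_leg_weight i) mst2 ms).
  apply: (measurableT_comp mh); apply: measurable_fun_pair.
    by apply: measurable_funD => //; exact: (measurableT_comp measurable_fst mb1).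
  apply: measurable_fun_pair => //; apply: (measurableT_comp measurable_fst).
  exact: (measurable_fun_pair_comp (@measurable_flight R m l i) mst2 ms).
have W0 w s : 0 <= weight n w * leg_weight i (st n w, s).
  by rewrite mulr_ge0 ?weight_ge0 ?leg_weight_ge0.
have Phi0 z : (0 <= Phi z)%E by rewrite mule_ge0 ?lee_fin.
transitivity (\int[P]_(w in jump_event n i j) Phi (w, (fine (S n w), new_velocity Y n w)))%E.
  apply: eq_integral => w /set_mem /andP[/andP[/of_typeP E al] nt].
  rewrite /Phi/= walkS /st E/=; move: al; rewrite /st => ->/=.
  by [].
rewrite walk_event// [RHS]integral_mkcond; apply: eq_integral => w _; rewrite patchE.
case: ifPn => [/set_mem typw|ntyp]; last first.
  rewrite integral0_eq// => s _; rewrite /flight_surv/=.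
  case: ifP; last by rewrite mul0e.
  by move=> /andP[typw _]; move/negP: ntyp; case; exact/mem_set.
have btd := bounded_total_density oD hxs i j.
have bir := bounded_isotope_rate oD hxs i j.
have [mtd td0 _] := btd; have [mir ir0 _] := bir.
have mA := measurable_snd_section (birth (walk n w)) (measurable_flight_inner l i mh h0 btd).
have mSv := measurable_snd_section (birth (walk n w)) (measurable_surv_post oD hxs i).
have mfl := measurable_snd_section (birth (walk n w)) (@measurable_flight_post R m l i).
have mB := measurable_snd_section (birth (walk n w)) (measurable_flight_post_state l i mh).
pose W := (weight n w)%:E.
have Wge0 : (0 <= W)%E by rewrite lee_fin weight_ge0.
pose a s : \bar R := (\int[leb3]_v ((total_density i j (flight i (st n w) s, v))%:E *
  h (((birth (walk n w)).1 + s)%R, ((flight i (st n w) s).1, v))))%E.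
pose b s : \bar R := ((isotope_rate i j (flight i (st n w) s))%:E *
  h (((birth (walk n w)).1 + s)%R, flight i (st n w) s))%E.
pose sv s : \bar R := (surv l D vmin vmax xs i (st n w) s)%:E.
have a0 s : (0 <= a s)%E by apply: integral_ge0 => v _; rewrite mule_ge0 ?lee_fin.
have b0 s : (0 <= b s)%E by rewrite mule_ge0 ?lee_fin.
have sv0 s : (0 <= sv s)%E by rewrite lee_fin surv_ge0.
have ma : measurable_fun setT a by exact: mA.
have mb : measurable_fun setT b.
  apply: emeasurable_funM => //; apply/measurable_EFinP; exact: (measurableT_comp mir mfl).
have msv : measurable_fun setT sv by exact: mSv.
rewrite (_ : flight_density _ _ _ _ _ _ _ _ _ = \int[leb1]_(s in `[0%R, +oo[) (sv s * a s))%E//.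
rewrite (_ : flight_atom _ _ _ _ _ _ _ _ _ = \int[leb1]_(s in `[0%R, +oo[) (sv s * b s))%E//.
rewrite -ge0_integralD//; first last.
- by apply: measurable_funTS; exact: emeasurable_funM.
- by move=> s _; rewrite mule_ge0.
- by apply: measurable_funTS; exact: emeasurable_funM.
- by move=> s _; rewrite mule_ge0.
rewrite -ge0_integralZl//; first last.
- by move=> s _; apply: adde_ge0; apply: mule_ge0.
- by apply: measurable_funTS; apply: emeasurable_funD; exact: emeasurable_funM.
apply: eq_integral => s /set_mem; rewrite /= in_itv/= andbT => s0.
rewrite -ge0_muleDr//.
have -> : (\int[leb3]_v ((total_density i j (flight i (st n w) s, v))%:E * Phi (w, (s, v))) =
    (weight n w * leg_weight i (st n w, s))%:E * a s)%E.
  rewrite -ge0_integralZl_EFin//.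
  - by apply: eq_integral => v _; rewrite /Phi/= muleCA.
  - by move=> v _; rewrite mule_ge0 ?lee_fin.
  - apply: emeasurable_funM.
      by apply/measurable_EFinP; exact: (measurable_snd_section (flight i (st n w) s) mtd).
    apply: (measurableT_comp mh).
    exact: (measurable_fun_pair (measurable_cst _) (measurable_fun_pair (measurable_cst _) (@measurable_id _ _ _))).
have -> : ((isotope_rate i j (flight i (st n w) s))%:E * Phi (w, (s, (st n w).2)) =
    (weight n w * leg_weight i (st n w, s))%:E * b s)%E.
  rewrite /Phi/= muleCA /b; congr (_ * (_ * h (_, _)))%E.
  (* A flight keeps its velocity, so position at the jump and initial velocity together make up the
     current configuration. *)
  by rewrite [RHS]surjective_pairing flight_snd.
rewrite -ge0_muleDr// muleA -EFinM /W /sv muleA -EFinM; congr ((_)%:E * _)%E.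
rewrite mulrCA; congr (_ * _); rewrite /flight_surv /surv/=.
have -> /= : of_type i (walk n w) by exact: typw.
case: ifP => _; last by rewrite mul0r.
rewrite /leg_weight/= mulrC divfK//.
by rewrite gt_eqF// survival_rate_gt0.
Qed.

(** A walk of type [j] after the jump comes from exactly one type [i] before it. The mean is split
    over the pairs [(i, j)], and the sum over [j] is what [next_event] collects. *)
Lemma walk_meanS n (H : 'I_m -> R * conf R -> \bar R) :
  (forall j, measurable_fun setT (H j)) -> (forall j z, 0 <= H j z)%E ->
  walk_mean n.+1 H = walk_mean n (next_event H).
Proof.
move=> mH H0; rewrite /walk_mean.
have mW k j : measurable_fun setT (fun w => (weight k w)%:E * H j (birth (walk k w)))%E.
  apply: emeasurable_funM; first exact/measurable_EFinP.
  exact: (measurableT_comp (mH j) (@mbirth k)).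
have W0 k j w : (0 <= (weight k w)%:E * H j (birth (walk k w)))%E.
  by rewrite mule_ge0 ?lee_fin ?weight_ge0.
transitivity (\sum_(j < m) \sum_(i < m) \int[P]_(w in jump_event n i j)
    ((weight n.+1 w)%:E * H j (birth (walk n.+1 w))))%E.
  apply: eq_bigr => j _; apply: (@integral_cases 'I_m _ T R P [set w | of_type j (walk n.+1 w)]
     (fun i w => of_type i (walk n w) && alive i (birth (walk n w)).2 (S n w) &&
       (new_type Y n w == j))
     (fun w => (weight n.+1 w)%:E * H j (birth (walk n.+1 w)))%E) => //.
  - by move=> i; exact: (measurable_jump_event n i j).
  - move=> i w; rewrite /= walkS; case: (walk n w) => [[[b k] x]|]//=.
    by move=> /andP[/andP[/eqP -> ->]].
  - by move=> i k w /andP[/andP[oi _] _] /andP[/andP[ok _] _]; exact: of_type_uniq oi ok.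
  - move=> w /=; rewrite walkS; case E : (walk n w) => [[[b i] x]|//]; case: ifP => //= al nt.
    by move=> /(_ i)/=; rewrite eqxx al nt.
rewrite exchange_big/=; apply: eq_bigr => i _; have mti := Fm (mtyp n i).
have mK j : measurable_fun setT (fun z => flight_density l D vmin vmax xs
    (total_density i j) i (H j) z +
    flight_atom l D vmin vmax xs (isotope_rate i j) i (H j) z)%E.
  apply: emeasurable_funD.
    by apply: (measurable_flight_density oD hxs) => //; exact: (bounded_total_density oD hxs).
  by apply: (measurable_flight_atom oD hxs) => //; exact: (bounded_isotope_rate oD hxs).
under eq_bigr do rewrite (walk_mean_jump n i _ (mH _) (H0 _)).
rewrite -ge0_integral_sum//; last 2 first.
- move=> j; apply: measurable_funTS; apply: emeasurable_funM; first exact/measurable_EFinP.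
  exact: (measurableT_comp (mK j) (@mbirth n)).
- move=> j w _; rewrite mule_ge0 ?lee_fin ?weight_ge0// adde_ge0//.
    by apply: flight_density_ge0 => //; exact: (bounded_total_density oD hxs).
  by apply: flight_atom_ge0 => //; exact: (bounded_isotope_rate oD hxs).
apply: eq_integral => w _; rewrite -ge0_sume_distrr// => j _; rewrite adde_ge0//.
  by apply: flight_density_ge0 => //; exact: (bounded_total_density oD hxs).
by apply: flight_atom_ge0 => //; exact: (bounded_isotope_rate oD hxs).
Qed.

Lemma walk_mean0 (H : 'I_m -> R * conf R -> \bar R) :
  walk_mean 0 H = H i0 (0, x0).
Proof.
rewrite /walk_mean (bigD1 i0)//= big1 ?adde0; last first.
  move=> i ii; rewrite (_ : [set w | _] = set0) ?integral_set0//.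
  by apply/seteqP; split=> // w /=; rewrite eq_sym (negbTE ii).
rewrite (_ : [set w | _] = setT); last by apply/seteqP; split=> // w _ /=; rewrite eqxx.
by rewrite mul1e integral_cst//= probability_setT mule1.
Qed.

Lemma walk_meanE n (H : 'I_m -> R * conf R -> \bar R) :
  (forall j, measurable_fun setT (H j)) -> (forall j z, 0 <= H j z)%E ->
  walk_mean n H = iter n next_event H i0 (0, x0).
Proof.
elim: n H => [|n IH] H mH H0; first exact: walk_mean0.
rewrite walk_meanS// IH ?iterSr// => [j|j z].
  exact: (measurable_next_event oD hxs).
exact: (next_event_ge0 oD hxs).
Qed.

(** * Legs of one path and the integral of the potential *)

Definition leg_present (s : R) n w : bool :=
  if walk n w is Some (b, i, x) then
    [&& b <= s, ((s - b)%:E < S n w)%E & ((s - b)%:E < exit_time l D i x)%E]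
  else false.

Section path.
Variable w : T.

Lemma leg_presentP s n : leg_present s n w -> exists b i x,
  [/\ walk n w = Some (b, i, x), b <= s, ((s - b)%:E < S n w)%E &
      ((s - b)%:E < exit_time l D i x)%E].
Proof.
rewrite /leg_present; case: (walk n w) => [[[b i] x]|//] /and3P[bs sS se].
by exists b, i, x.
Qed.

(** Each jump adds a non-negative sojourn to the time, so distinct legs occupy disjoint time
    intervals. *)
Lemma walk_birth_after n k b i x b' i' x' : (n < k)%N ->
  walk n w = Some (b, i, x) -> walk k w = Some (b', i', x') ->
  ((b' - b)%:E >= S n w)%E.
Proof.
elim: k b' i' x' => // k IH b' i' x'; rewrite ltnS leq_eqVlt => /orP[/eqP <-|nk] En.
  rewrite walkS En; case: ifP => // /andP[_ Soo] [<- _ _].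
  by rewrite addrAC subrr add0r fineK// ge0_fin_numE// (sojourn_ge0 Y).
rewrite walkS; case E : (walk k w) => [[[bk ik] xk]|//]; case: ifP => // _ [<- _ _].
apply: (le_trans (IH _ _ _ nk En E)); rewrite lee_fin lerD2r lerDl.
by rewrite fine_ge0// (sojourn_ge0 Y).
Qed.

Lemma leg_present_uniq s n k : leg_present s n w -> leg_present s k w -> n = k.
Proof.
wlog nk : n k / (n < k)%N.
  move=> W pn pk; case: (ltngtP n k) => // h; first exact: W.
  by apply/esym; exact: W.
move=> /leg_presentP[b [i [x [En bs sS _]]]] /leg_presentP[b' [i' [x' [Ek bs' _ _]]]].
have := walk_birth_after nk En Ek; rewrite leNgt => /negP; case.
by apply: le_lt_trans sS; rewrite lee_fin lerD2r.
Qed.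

(** The choice made by [xget] is harmless because at most one leg is present at a given time. *)
Lemma walk_at_present s n b i x : leg_present s n w -> walk n w = Some (b, i, x) ->
  walk_at s w = Some (i, flight i x (s - b)).
Proof.
move=> pn En; rewrite /Defs.walk_at.
have legE k : observe l D (walk k w) (S k w) s = leg_present s k w :> bool.
  rewrite /observe /leg_present; case: (walk k w) => [[[b' i'] x']|//].
  by case: ifP.
set Q := [set k | _].
have Qn : Q n by rewrite /Q/= legE.
have : Q (xget 0%N Q) by apply: xgetPex; exists n.
rewrite {1}/Q/= legE => /leg_present_uniq /(_ pn) ->.
rewrite En /observe; move: pn; rewrite /leg_present En => /and3P[-> ->].
by move=> ->.
Qed.

Lemma walk_at_none s : (forall n, ~~ leg_present s n w) -> walk_at s w = None.
Proof.
move=> np; rewrite /Defs.walk_at; set k := xget _ _; have := np k.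
rewrite /observe /leg_present; case: (walk k w) => [[[b' i'] x']|//].
by case: ifP.
Qed.

Lemma walk_at_DV s i y : walk_at s w = Some (i, y) -> DV y.
Proof.
have [[n pn]|np] := pselect (exists n, leg_present s n w); last first.
  by rewrite walk_at_none// => n; apply/negP => pn; apply: np; exists n.
have [b [j [x [En bs sS se]]]] := leg_presentP pn.
rewrite (walk_at_present pn En) => -[_ <-].
have [_ [_ Vx]] := walk_valid En.
split; last by rewrite /= flight_snd.
by apply: (flight_in oD) se; rewrite subr_ge0.
Qed.

(** Every leg starts where the previous one ends, so a walk that makes its [n]-th jump was never in
    the cemetery before. [lt_tau] rests on this. *)
Lemma legs_before n b i x s : walk n w = Some (b, i, x) -> 0 <= s < b ->
  exists k, leg_present s k w.
Proof.
elim: n b i x => [b i x [<- _ _] /andP[s0 /(le_lt_trans s0)]|n IH b i x].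
  by rewrite ltxx.
rewrite walkS; case E : (walk n w) => [[[b' i'] x']|//].
case: ifP => // al; have [Se Soo] := andP al => -[bE _ _] /andP[s0 sb].
have [sb'|b's] := ltP s b'; first by apply: (IH _ _ _ E); rewrite s0.
have SE : (fine (S n w))%:E = S n w by rewrite fineK// ge0_fin_numE// (sojourn_ge0 Y).
exists n; rewrite /leg_present E b's/=.
have sS : ((s - b')%:E < S n w)%E by rewrite -SE lte_fin ltrBlDl bE.
by rewrite sS (lt_trans sS Se).
Qed.

Section rates.
Variable f : 'I_m -> conf R -> R.
Hypothesis hf : forall i, bounded_nonneg (f i).

Let path (s : R) := at_walk l D Y i0 x0 f s w.

Lemma at_walk_ge0 s : 0 <= path s.
Proof.
rewrite /path /at_walk; case: (walk_at s w) => [[i y]|//].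
by have [_ + _] := hf i; apply.
Qed.

Fixpoint path_rate (n : nat) : R :=
  if n is n'.+1 then
    if walk n' w is Some (_, i, x) then
      path_rate n' + cumulative_rate (fun u => along l (f i) i (x, u)) (fine (S n' w))
    else 0
  else 0.

Let path_leg n b i x t : walk n w = Some (b, i, x) -> b <= t ->
  (forall s, b <= s < t -> leg_present s n w) ->
  measurable_fun (`[b, t[ : set R) path /\
  (\int[lebesgue_measure]_(s in `[b, t[) (path s)%:E =
    (cumulative_rate (fun u => along l (f i) i (x, u)) (t - b))%:E)%E.
Proof.
move=> En bt pn; have [ma a0 [c ac]] := bounded_along l i (hf i).
pose k u := along l (f i) i (x, u).
have mk : measurable_fun setT k by exact: (measurable_snd_section x ma).
have pathE s : s \in (`[b, t[%classic : set R) -> path s = k (s - b).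
  move=> /set_mem; rewrite /= in_itv/= => /pn p.
  by rewrite /path /at_walk (walk_at_present p En).
split.
  apply: (@eq_measurable_fun _ _ R R _ (fun s : R => k (s - b))); first by move=> s /pathE ->.
  apply: measurable_funTS; apply: (measurableT_comp mk).
  by apply: measurable_funB; [exact: measurable_id|exact: measurable_cst].
rewrite (cumulative_rateE mk (fun u => a0 (x, u)) (fun u => ac (x, u))).
rewrite -ge0_integral_leb1//; last 2 first.
- by apply: measurable_funTS; exact/measurable_EFinP.
- by move=> u _; rewrite lee_fin; exact: (a0 (x, u)).
rewrite -integral_itv_bndo_bndc; last first.
  by apply: measurable_funTS; exact/measurable_EFinP.
rewrite -(lebesgue_translate b (f := fun u => (k u)%:E)); last 2 first.
- exact/measurable_EFinP.
- by move=> u; rewrite lee_fin; exact: (a0 (x, u)).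
by apply: eq_integral => s /pathE ->.
Qed.

(** Half-open intervals glue without overlap. Measurability of the path is carried along with the
    value of the integral because it, too, is only accessible leg by leg. *)
Let path_append n b i x t : walk n w = Some (b, i, x) -> b <= t ->
  (forall s, b <= s < t -> leg_present s n w) ->
  measurable_fun (`[0, b[ : set R) path /\
    (\int[lebesgue_measure]_(s in `[0%R, b[) (path s)%:E = (path_rate n)%:E)%E ->
  measurable_fun (`[0, t[ : set R) path /\
  (\int[lebesgue_measure]_(s in `[0%R, t[) (path s)%:E = (path_rate n +
    cumulative_rate (fun u => along l (f i) i (x, u)) (t - b))%:E)%E.
Proof.
move=> En bt pn [mb Ib]; have [mt It] := path_leg En bt pn.
have [b0 _] := walk_valid En.
have UE : (`[0, t[%classic : set R) = `[0, b[ `|` `[b, t[.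
  apply/seteqP; split=> s /=; rewrite !in_itv/=.
    by move=> /andP[-> ->]; case: (ltP s b); [left|right].
  move=> [/andP[-> /lt_le_trans ->]//|/andP[bs ->]].
  by rewrite (le_trans b0 bs).
have mU : measurable_fun (`[0, b[ `|` `[b, t[ : set R) path.
  by apply/measurable_funU => //; exact: measurable_itv.
rewrite UE; split => //; rewrite ge0_integral_setU//.
- by rewrite Ib It EFinD.
- exact/measurable_EFinP.
- by move=> s _; rewrite lee_fin at_walk_ge0.
- rewrite disj_set2E; apply/eqP/seteqP; split=> // s [/=]; rewrite !in_itv/=.
  by move=> /andP[_ sb] /andP[]; rewrite leNgt sb.
Qed.

Let path_walk n b i x : walk n w = Some (b, i, x) ->
  measurable_fun (`[0, b[ : set R) path /\
    (\int[lebesgue_measure]_(s in `[0%R, b[) (path s)%:E = (path_rate n)%:E)%E.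
Proof.
elim: n b i x => [b i x [<- _ _]|n IH b i x].
  by rewrite set_itvco0; split; [exact: measurable_fun_set0|rewrite integral_set0].
rewrite walkS; case E : (walk n w) => [[[b' i'] x']|//].
case: ifP => // al; have [Se Soo] := andP al => -[<- _ _] /=; rewrite E.
have S0 : 0 <= fine (S n w) by rewrite fine_ge0// (sojourn_ge0 Y).
have SE : (fine (S n w))%:E = S n w by rewrite fineK// ge0_fin_numE// (sojourn_ge0 Y).
have -> : fine (S n w) = (b' + fine (S n w)) - b' by rewrite addrAC subrr add0r.
rewrite -[in X in `[0, X[](_ : b' + fine (S n w) = b' + (b' + fine (S n w) - b')); last by ring.
apply: (path_append E) (IH _ _ _ E); first by rewrite lerDl.
move=> s /andP[bs sb]; rewrite /leg_present E bs/=.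
have sS : ((s - b')%:E < S n w)%E by rewrite -SE lte_fin ltrBlDl.
by rewrite sS (lt_trans sS Se).
Qed.

Lemma path_integral t n b i x : leg_present t n w -> walk n w = Some (b, i, x) ->
  measurable_fun (`[0, t] : set R) path /\
  (\int[lebesgue_measure]_(s in `[0%R, t]) (path s)%:E = (path_rate n +
    cumulative_rate (fun u => along l (f i) i (x, u)) (t - b))%:E)%E.
Proof.
move=> pn En; have [b' [i' [x' [En' bt tS te]]]] := leg_presentP pn.
move: En'; rewrite En => -[? ? ?]; subst b' i' x'.
have [|mt It] := path_append En bt _ (path_walk En).
  move=> s /andP[bs lt_st]; rewrite /leg_present En bs/=.
  have sb : ((s - b)%:E < (t - b)%:E)%E by rewrite lte_fin ltrD2r.
  by rewrite (lt_trans sb tS) (lt_trans sb te).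
have mt' : measurable_fun (`[0, t] : set R) path by exact/measurable_fun_itv_bndo_bndcP.
by split=> //; rewrite -integral_itv_bndo_bndc//; exact/measurable_EFinP.
Qed.

End rates.

Lemma weightE n b i x : walk n w = Some (b, i, x) ->
  weight n w = expR (path_rate alp n - path_rate total_rate n).
Proof.
elim: n b i x => [b i x _|n IH b i x]; first by rewrite subrr expR0.
rewrite walkS /=; case E : (walk n w) => [[[b' i'] x']|//] _.
rewrite (IH _ _ _ E) /leg_weight !survival_rate.unlock/= -expRN opprK -!expRD.
by congr expR; ring.
Qed.

(** Along the path, which stays in [D * V], [beta] is [alp] minus [total_rate]. Each of these is
    non-negative with a finite integral up to [t], so the integrals may be subtracted and compared
    with the exponents of the leg weights. *)
Lemma expR_path t n b i x : 0 <= t -> leg_present t n w -> walk n w = Some (b, i, x) ->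
  expR (\int[lebesgue_measure]_(s in `[0, t]) at_walk l D Y i0 x0 (beta l V xs) s w) =
  weight n w * leg_weight i (x, t - b).
Proof.
move=> t0 pn En.
have balp i' := bounded_alp oD hxs i'.
have btot i' := bounded_total_rate oD hxs i'.
have [ma Ia] := path_integral balp pn En.
have [mt It] := path_integral btot pn En.
have bE s : at_walk l D Y i0 x0 (beta l V xs) s w =
    at_walk l D Y i0 x0 alp s w - at_walk l D Y i0 x0 total_rate s w.
  rewrite /at_walk; case E : (walk_at s w) => [[i' y]|]; last by rewrite subr0.
  by rewrite (betaE hl xs i' (walk_at_DV E)) /total_rate; ring.
under eq_Rintegral do rewrite bE.
have int f : measurable_fun (`[0, t] : set R) (fun s => at_walk l D Y i0 x0 f s w) ->
    (forall i', bounded_nonneg (f i')) ->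
    (\int[lebesgue_measure]_(s in `[0%R, t]) (at_walk l D Y i0 x0 f s w)%:E < +oo)%E ->
    lebesgue_measure.-integrable (`[0, t] : set R) (EFin \o (fun s => at_walk l D Y i0 x0 f s w)).
  move=> mf bf fin; apply/integrableP; split; first exact/measurable_EFinP.
  move: fin; congr (_ < _)%E; apply: eq_integral => s _.
  by rewrite /= ger0_norm// at_walk_ge0.
rewrite RintegralB//; last 2 first.
- by apply: int => //; rewrite Ia ltry.
- by apply: int => //; rewrite It ltry.
rewrite /Rintegral Ia It/= (weightE En) /leg_weight !survival_rate.unlock/=.
by rewrite -expRN opprK -!expRD; congr expR; ring.
Qed.

(** The conditions for presence are strict, so the leg is still present at all times up to and
    including some [t' > t]. Earlier times are covered by [legs_before]. Hence no positive time
    before [t'] is in the set whose infimum is [tau], and the indicator in [phi] is 1. *)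
Lemma lt_tau t n : 0 <= t -> leg_present t n w -> (t%:E < tau l D Y i0 x0 w)%E.
Proof.
move=> t0 pn; have [b [i [x [En bt tS te]]]] := leg_presentP pn.
have [t' [tt' t'S t'e]] : exists t', [/\ t < t', ((t' - b)%:E < S n w)%E &
    ((t' - b)%:E < exit_time l D i x)%E].
  have : ((t - b)%:E < Order.min (S n w) (exit_time l D i x))%E by rewrite lt_min tS.
  (* For a finite minimum [r], the witness is the midpoint of [t] and of the end [b + r] of the leg;
     otherwise any later time will do. *)
  case E : (Order.min _ _) => [r| |]; rewrite ?ltNge ?leNye//.
    rewrite -ltNge lte_fin => tr; exists (b + (t - b + r) / 2).
    have r1 : ((b + (t - b + r) / 2 - b)%:E < Order.min (S n w) (exit_time l D i x))%E.
      by rewrite E lte_fin; lra.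
    by move: r1; rewrite lt_min => /andP[? ?]; split => //; lra.
  move=> _; exists (t + 1).
  have : ((t + 1 - b)%:E < Order.min (S n w) (exit_time l D i x))%E by rewrite E ltry.
  by rewrite lt_min => /andP[? ?]; split => //; lra.
apply: (@lt_le_trans _ _ t'%:E); first by rewrite lte_fin.
apply: le_ereal_inf_tmp => _ [s [s0 nD] <-]; rewrite lee_fin leNgt; apply/negP => st'.
apply: nD; have [k pk] : exists k, leg_present s k w.
  have [sb|bs] := ltP s b; first by apply: (legs_before En); rewrite (ltW s0).
  exists n; rewrite /leg_present En bs/=.
  have ss : ((s - b)%:E < (t' - b)%:E)%E by rewrite lte_fin ltrD2r.
  by rewrite (lt_trans ss t'S) (lt_trans ss t'e).
have [bk [ik [xk [Ek _ _ _]]]] := leg_presentP pk.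
have E := walk_at_present pk Ek; rewrite E.
by have [] := walk_at_DV E.
Qed.

End path.

(** * Expansion of [phi] *)

Section semigroup.
Variables (g : 'I_m -> conf R -> R) (t : R).
Hypotheses (hg : forall j, Lpos DV (g j)) (t0 : 0 <= t).
Local Arguments Defs.walk : simpl never.

Let gD j := zero_off DV (g j).

Let hgD j : bounded_nonneg (gD j).
Proof. by apply: bounded_nonneg_zero_off => //; exact: measurable_DV. Qed.

Let value n := observed_value l D (walk n) gD t (S n) (weight n) leg_weight.

Let value_ge0 n w : (0 <= (value n w)%:E)%E.
Proof.
by rewrite lee_fin; apply: observed_value_ge0; [exact: hgD|exact: weight_ge0|exact: leg_weight_ge0].
Qed.

Let survivalM i (z : conf R * R) :
  survival_rate (fun u => along l (alp i) i (z.1, u)) z.2 * leg_weight i z =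
  survival_rate (fun u => along l (total_rate i) i (z.1, u)) z.2.
Proof. by rewrite /leg_weight mulrC divfK// gt_eqF// survival_rate_gt0. Qed.

(** At most one leg is present at time [t], so the integrand is the sum over [n] of the values
    observed on the legs. A path with no leg at [t] contributes 0 to both sides, whether the walk
    was killed or its jumps accumulate before [t]. *)
Lemma phiE : phi Y t g =
  (\sum_(n <oo) iter n next_event (mean_value l D vmin vmax xs gD t) i0 (0%R, x0))%E.
Proof.
transitivity (\sum_(n <oo) \int[P]_w (value n w)%:E)%E; last first.
  apply: eq_eseriesr => n _.
  rewrite (observed_value_mean oD (sF n) (@Fm n) (measurable_walk n) t hgD (@mS n) (sojourn_ge0 Y n)
    (@measurable_weight n) (@weight_ge0 n) measurable_leg_weight leg_weight_ge0
    (fun i => bounded_alp oD hxs i) survivalM (@clock n)).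
  apply: walk_meanE => [j|j z].
    exact: (measurable_mean_value oD hxs).
  exact: mean_value_ge0.
rewrite -integral_nneseries//; last first.
  move=> n; apply/measurable_EFinP.
  exact: (measurable_observed_value l oD (sF n) (@Fm n) (measurable_walk n) t hgD (@mS n)
    (@measurable_weight n) measurable_leg_weight).
rewrite /phi unlock; apply: eq_integral => w _.
have [[n pn]|np] := pselect (exists n, leg_present t n w); last first.
  have np' n : ~~ leg_present t n w by apply/negP => pn; apply: np; exists n.
  rewrite eseries0 => [|n _ _].
    by rewrite {2}/at_walk (walk_at_none np') mulr0 mul0r.
  have := np' n; rewrite /value /observed_value /leg_present.
  by case: (walk n w) => [[[b i] x]|//] /negbTE ->.
have [b [i [x [En bt tS te]]]] := leg_presentP pn.
rewrite (@nneseriesD1 _ _ n)//.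
rewrite eseries0 ?adde0; last first.
  move=> k _ kn; have : ~~ leg_present t k w.
    by apply: contra kn => pk; rewrite (leg_present_uniq pk pn).
  rewrite /value /observed_value /leg_present.
  by case: (walk k w) => [[[b' i'] x']|//] /negbTE ->.
rewrite (expR_path t0 pn En) (lt_tau t0 pn) mulr1.
have E := walk_at_present pn En; rewrite /at_walk E /value /observed_value En bt tS te mulrA.
by rewrite /gD zero_offE//; exact: (walk_at_DV E).
Qed.

End semigroup.
End random_walk.

(** * The branching process *)

Section branching.
Variables (R : realType) (m l : nat).
Variables (D : set (vec3 R)) (oD : open D) (vmin vmax : R).
Local Notation V := (shell vmin vmax).
Variable xs : cross_sections R m.
Hypothesis hxs : admissible_cross_sections l D V xs.
Local Notation DV := (D `*` V).
Local Notation flight := (flight l).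
Variables (nmax : nat) (dO : measure_display) (O : measurableType dO) (off : offspring R m O).
Hypothesis hoff : admissible_offspring l D V xs nmax off.
Context dT (T : measurableType dT) (P : probability T R).
Variables (i0 : 'I_m) (x0 : conf R) (X : mnbp l D V xs off P i0 x0).
Hypothesis DVx0 : DV x0.
Local Notation emission := (emission l D off X i0 x0).
Local Notation F := (mnbp_F X).
Local Notation G := (mnbp_G X).
Local Notation TF n := (g_sigma_algebraType (F n)).
Local Notation TG n := (g_sigma_algebraType (G n)).
Local Notation total_rate := (total_rate l D vmin vmax xs).
Local Notation next_event := (next_event l D vmin vmax xs).
Local Notation flight_density := (flight_density l D vmin vmax xs).
Local Notation flight_atom := (flight_atom l D vmin vmax xs).
Local Notation scat_density := (scat_density l D vmin vmax xs).
Local Notation fission_density := (fission_density l D vmin vmax xs).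
Local Notation isotope_rate := (isotope_rate l D vmin vmax xs).
Local Notation off_law := (offspring_law off).
Local Notation mark := (offspring_mark X).
Local Notation vel := (offspring_velocity off).
Local Notation count := (offspring_count off).
Local Arguments Defs.emission : simpl never.
Implicit Types p : label m.

Let sF n : sigma_algebra setT (F n) := F_sigma_algebra (mnbp_filtration X) n.
Let sG n : sigma_algebra setT (G n) := G_sigma_algebra (mnbp_filtration X) n.
Let Fm n : F n `<=` measurable := @F_measurable _ _ _ _ (mnbp_filtration X) n.
Let FG n : F n `<=` G n := @F_sub_G _ _ _ _ (mnbp_filtration X) n.
Let GF n : G n `<=` F n.+1 := @G_sub_F _ _ _ _ (mnbp_filtration X) n.
Let Gm n : G n `<=` measurable. Proof. by move=> A /GF/Fm. Qed.

(* c = true stands for scattering, c = false for fission or decay *)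
Definition clock (c : bool) p (w : T) : \bar R :=
  if c then scatter_clock X p w else removal_clock X p w.

Definition event_rate (c : bool) (i : 'I_m) : conf R -> R :=
  if c then scat l D vmin vmax xs i else remo l D vmin vmax xs i.

(** The asymmetry reproduces the tie rule of [fate_of], for which simultaneous rings count as a
    removal. *)
Definition rings_first (c : bool) p (w : T) : bool :=
  if c then (clock true p w < clock false p w)%E else (clock false p w <= clock true p w)%E.

Definition event (c : bool) p (i : 'I_m) (w : T) : bool :=
  [&& of_type i (emission p w), alive l D i (birth (emission p w)).2 (clock c p w) &
      rings_first c p w].

Lemma clock_ge0 c p w : (0 <= clock c p w)%E.
Proof. by rewrite /clock; case: c; [exact: scatter_clock_ge0|exact: removal_clock_ge0]. Qed.

Lemma measurable_clock_G c p : measurable_fun setT (clock c p : TG (size p) -> \bar R).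
Proof.
move=> _ B mB; rewrite setTI; apply/(sub_measurableE (sG (size p))).
by rewrite /clock; case: c; [exact: scatter_clock_G|exact: removal_clock_G].
Qed.

Lemma measurable_clock c p : measurable_fun setT (clock c p).
Proof. exact: (sub_measurable_fun (sG (size p)) (@Gm (size p)) (@measurable_clock_G c p)). Qed.

Lemma bounded_event_rate c i : bounded_nonneg (event_rate c i).
Proof. by case: c; [exact: (bounded_scat oD hxs)|exact: (bounded_remo oD hxs)]. Qed.

Let st p w := (birth (emission p w)).2.
Let age c p w := fine (clock c p w).

Lemma fate_event c p i w : event c p i w -> emission_fate l D off X i0 x0 p w =
  (if c then @Scattered R else @Removed R) (age c p w) (flight i (st p w) (age c p w)).
Proof.
rewrite /event /emission_fate /st /age; case: (emission p w) => [[[b j] x]|//]/=.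
move=> /and3P[/eqP <- /andP[ce coo]]; rewrite /fate_of /rings_first /clock; move: ce coo.
by rewrite /clock; case: c => ce coo; [move=> ->|rewrite leNgt => /negbTE ->/=]; rewrite ce.
Qed.

Lemma emission_scattered p i w : event true p i w ->
  emission (None :: p) w = Some ((birth (emission p w)).1 + age true p w, i,
    ((flight i (st p w) (age true p w)).1, scatter_velocity X p w)).
Proof.
move=> ev; have := fate_event ev; move: ev => /and3P[ty _ _].
rewrite [emission (None :: p) w]/Defs.emission -/(emission p w).
move: ty; rewrite /emission_fate /st; case: (emission p w) => [[[b j] x]|//]/= /eqP ->.
by move=> ->.
Qed.

Lemma emission_released p i j k w : event false p i w -> releases l i j ->
  (k < count j (mark p w))%N ->
  emission (Some (j, k) :: p) w = Some ((birth (emission p w)).1 + age false p w, j,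
    ((flight i (st p w) (age false p w)).1,
     if (j < l)%N then vel j k (mark p w) else (st p w).2)).
Proof.
move=> ev rel kc; have := fate_event ev; move: ev => /and3P[ty _ _].
rewrite [emission (Some _ :: p) w]/Defs.emission -/(emission p w).
move: ty; rewrite /emission_fate /st; case: (emission p w) => [[[b i'] x]|//]/= /eqP ->.
by move=> ->; rewrite rel kc/= flight_snd.
Qed.

(** Converse of [emission_scattered] and [emission_released]: together they describe exactly when a
    label is born. *)
Lemma emission_cons a p w e : emission (a :: p) w = Some e ->
  if a is Some (j, k) then exists i, [/\ event false p i w, releases l i j &
    (k < count j (mark p w))%N]
  else exists i, event true p i w.
Proof.
rewrite [emission (a :: p) w]/Defs.emission -/(emission p w) /event.
case: (emission p w) => [[[b i] x]|//]/=; rewrite /fate_of.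
case: ifPn => [/andP[lt se]|nlt].
  case: a => [[j k]//|_]; exists i; rewrite eqxx/= /rings_first /clock lt andbT.
  by rewrite /alive se/= (lt_le_trans lt)// leey.
case: ifPn => [te|//]; last by case: a => [[]|].
case: a => [[j k]|//]; case: ifPn => // /andP[rel kc] _; exists i; split => //.
(* If the scattering clock rang strictly first, it would also ring before the exit, as the removal
   clock does, and the fate would be a scattering. *)
have le : (removal_clock X p w <= scatter_clock X p w)%E.
  rewrite leNgt; apply: contra nlt => lt; rewrite lt/=.
  exact: lt_trans lt te.
rewrite eqxx /rings_first /clock le andbT/= /alive te/=.
by rewrite (lt_le_trans te)// leey.
Qed.

Lemma event_type c p i w : event c p i w ->
  emission p w = Some ((birth (emission p w)).1, i, st p w).
Proof. by move=> /and3P[/of_typeP E _ _]. Qed.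

Lemma event_age c p i w : event c p i w ->
  [/\ 0 <= age c p w, (clock c p w < +oo)%E & ((age c p w)%:E < exit_time l D i (st p w))%E].
Proof.
move=> /and3P[_ al _]; have := al; rewrite aliveE ?clock_ge0// => /andP[coo ce].
by split => //; rewrite fine_ge0// clock_ge0.
Qed.

Lemma emission_valid p w b i x : emission p w = Some (b, i, x) -> 0 <= b /\ DV x.
Proof.
elim: p b i x => [b i x [<- _ <-]//|a p IH b i x E].
have valid c i' : event c p i' w -> [/\ 0 <= (birth (emission p w)).1 + age c p w,
    D (flight i' (st p w) (age c p w)).1 & V (st p w).2].
  move=> ev; have [a0 _ ce] := event_age ev.
  have [b0 [_ Vx]] := IH _ _ _ (event_type ev).
  by split => //; [rewrite addr_ge0|exact: (flight_in oD a0 ce)].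
have := emission_cons E; case: a E => [[j k]|] E.
  move=> [i' [ev rel kc]]; have [b0 Dy Vx] := valid _ _ ev.
  move: E; rewrite (emission_released ev rel kc) => -[<- _ <-]; split => //; split => //=.
  by case: ltnP => // jl; exact: (velocity_in_V hoff).
move=> [i' ev]; have [b0 Dy Vx] := valid _ _ ev.
move: E; rewrite (emission_scattered ev) => -[<- _ <-]; split => //; split => //=.
exact: scatter_velocity_in_V.
Qed.

Lemma event_DV c p i w : event c p i w -> DV (flight i (st p w) (age c p w)).
Proof.
move=> ev; have [a0 _ ce] := event_age ev.
have [_ [_ Vx]] := emission_valid (event_type ev).
by split; [exact: (flight_in oD a0 ce)|rewrite /= flight_snd].
Qed.

Section measurable_event.
Variable p : label m.
Hypothesis mp : state_measurable (emission p : TF (size p) -> _).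

Let mst_G : measurable_fun setT (st p : TG (size p) -> conf R).
Proof.
apply: (measurableT_comp measurable_snd).
exact: (measurable_sub_sigma (sF (size p)) (sG (size p)) (FG (n := size p)) mp.2).
Qed.

(** An event is decided by the state and the clocks, before its outcome is drawn. Being in [G] is
    what allows the law of the outcomes to be applied on it. *)
Lemma measurable_event_G c i : measurable ([set w | event c p i w] : set (TG (size p))).
Proof.
rewrite (_ : [set w | _] = [set w | of_type i (emission p w)] `&`
    [set w | alive l D i (st p w) (clock c p w)] `&` [set w | rings_first c p w]); last first.
  by apply/seteqP; split=> w /=; [move=> /and3P[? ? ?]|move=> [[? ?] ?]; apply/and3P].
apply: measurableI; first apply: measurableI.
- by apply/(sub_measurableE (sG (size p)))/FG/(sub_measurableE (sF (size p))); exact: mp.1.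
- apply: (measurable_alive _ oD) => // [|w]; last exact: clock_ge0.
  exact: measurable_clock_G.
- rewrite /rings_first -[X in measurable X]setTI.
  case: c; [apply: measurable_lte|apply: measurable_lee] => //; exact: measurable_clock_G.
Qed.

Lemma measurable_age_G c : measurable_fun setT (age c p : TG (size p) -> R).
Proof. by apply: measurableT_comp => //; exact: measurable_clock_G. Qed.

Lemma measurable_flight_G c (i : 'I_m) :
  measurable_fun setT ((fun w => flight i (st p w) (age c p w)) : TG (size p) -> conf R).
Proof. exact: (measurable_fun_pair_comp (@measurable_flight R m l i) mst_G (@measurable_age_G c)). Qed.

End measurable_event.

Let FF n : F n `<=` F n.+1. Proof. by move=> A /FG/GF. Qed.

(** The size of a label is its generation. A child depends on the clocks of its parent, known at the
    stage [G] of the parent, and on the outcome, known at the next stage [F]. *)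
Lemma measurable_emission u : state_measurable (emission u : TF (size u) -> _).
Proof.
elim: u => [|a p mp].
  split=> [i|]; last exact: measurable_cst.
  have [ii|ii] := eqVneq i0 i.
    by rewrite (_ : [set w | _] = setT)//; apply/seteqP; split=> // w _ /=; rewrite ii.
  by rewrite (_ : [set w | _] = set0)//; apply/seteqP; split=> // w /=; rewrite (negbTE ii).
pose n := size p.
have mev c i : measurable ([set w | event c p i w] : set (TF n.+1)).
  by apply/(sub_measurableE (sF n.+1))/GF/(sub_measurableE (sG n)); exact: measurable_event_G.
have mfl c (i : 'I_m) : measurable_fun setT ((fun w => flight i (st p w) (age c p w)) : TF n.+1 -> conf R).
  exact: (measurable_sub_sigma (sG n) (sF n.+1) (GF (n := n)) (measurable_flight_G mp c i)).
have mage c : measurable_fun setT (age c p : TF n.+1 -> R).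
  exact: (measurable_sub_sigma (sG n) (sF n.+1) (GF (n := n)) (@measurable_age_G p c)).
have mb : measurable_fun setT ((fun w => birth (emission p w)) : TF n.+1 -> R * conf R).
  exact: (measurable_sub_sigma (sF n) (sF n.+1) (@FF n) mp.2).
have mpost c (i : 'I_m) (v : T -> vec3 R) : measurable_fun setT (v : TF n.+1 -> vec3 R) ->
    measurable_fun setT ((fun w => ((birth (emission p w)).1 + age c p w,
      ((flight i (st p w) (age c p w)).1, v w))) : TF n.+1 -> R * conf R).
  move=> mv; apply: measurable_fun_pair.
    by apply: measurable_funD => //; exact: (measurableT_comp measurable_fst mb).
  by apply: measurable_fun_pair => //; exact: (measurableT_comp measurable_fst (mfl c i)).
have mmark : measurable_fun setT (mark p : TF n.+1 -> O).
  by move=> _ B mB; rewrite setTI; apply/(sub_measurableE (sF n.+1)); exact: offspring_mark_F.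
case: a => [[j k]|].
  pose q i (w : TF n.+1) := [&& event false p i w, releases l i j & (k < count j (mark p w))%N].
  have mq i : measurable [set w | q i w].
    rewrite (_ : [set w | _] = [set w | event false p i w] `&`
       ([set _ | releases l i j] `&` (mark p @^-1` [set o | (k < count j o)%N]))); last first.
      by apply/seteqP; split=> w; rewrite /q/=; [move=> /and3P[]|move=> [-> [-> ->]]].
    apply: measurableI => //; apply: measurableI.
      by apply: (measurable_bool_set (b := fun=> releases l i j)); exact: measurable_cst.
    rewrite -[X in measurable X]setTI; apply: mmark => //.
    have mc : measurable_fun setT (count j) by exact: (count_measurable hoff).
    by rewrite -[X in measurable X]setTI; exact: (mc measurableT [set n | (k < n)%N]).
  have qE i w : q i w -> emission (Some (j, k) :: p) w =
      Some ((birth (emission p w)).1 + age false p w, j, ((flight i (st p w) (age false p w)).1,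
        if (j < l)%N then vel j k (mark p w) else (st p w).2)).
    by move=> /and3P[]; exact: emission_released.
  split=> [j'|].
    have [jj|jj] := eqVneq j j'; last first.
      rewrite (_ : [set w | _] = set0)//; apply/seteqP; split=> // w /= /of_typeP E.
      have [i [ev rel kc]] := emission_cons E.
      by move: E; rewrite (emission_released ev rel kc) => -[jj']; rewrite jj' eqxx in jj.
    rewrite (_ : [set w | _] = \bigcup_(i in [set: 'I_m]) [set w | q i w]).
      by apply: fin_bigcup_measurable => // i _; exact: mq.
    apply/seteqP; split=> w /=.
      by move=> /of_typeP /emission_cons[i [ev rel kc]]; exists i => //; exact/and3P.
    by move=> [i _ /qE ->] /=; rewrite jj.
  apply: (measurable_fun_cases (p := q) (c := point) (f := fun i w =>
    ((birth (emission p w)).1 + age false p w, ((flight i (st p w) (age false p w)).1,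
        if (j < l)%N then vel j k (mark p w) else (st p w).2)))) => //.
  - move=> i; apply: mpost; case: (j < l)%N.
      exact: (measurableT_comp (velocity_measurable hoff j k) mmark).
    by apply: (measurableT_comp measurable_snd); exact: (measurableT_comp measurable_snd mb).
  - by move=> i w /qE; rewrite /comp => ->.
  - move=> w np; rewrite /comp; case E : (emission _ w) => [e|//].
    have [i [ev rel kc]] := emission_cons E.
    by have /negP := np i; case; apply/and3P.
split=> [j|].
  rewrite (_ : [set w | _] = [set w | event true p j w]); first exact: mev.
  apply/seteqP; split=> w /=; last by move=> /emission_scattered ->/=.
  move=> /of_typeP E; have [i ev] := emission_cons E.
  by move: E; rewrite (emission_scattered ev) => -[<-].
apply: (measurable_fun_cases (p := fun i (w : TF n.+1) => event true p i w) (c := point) (f := fun i w =>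
    ((birth (emission p w)).1 + age true p w, ((flight i (st p w) (age true p w)).1,
        scatter_velocity X p w)))) => //.
- move=> i; apply: mpost => _ B mB; rewrite setTI.
  by apply/(sub_measurableE (sF n.+1)); exact: scatter_velocity_F.
- by move=> i w /emission_scattered; rewrite /comp => ->.
- move=> w np; rewrite /comp; case E : (emission _ w) => [e|//].
  by have [i ev] := emission_cons E; have /negP := np i.
Qed.

Let mp p := measurable_emission p.

Let mstF p : measurable_fun setT (st p : TF (size p) -> conf R).
Proof. exact: (measurableT_comp measurable_snd (mp p).2). Qed.

Let mst p : measurable_fun setT (st p).
Proof. exact: (sub_measurable_fun (sF (size p)) (@Fm (size p)) (@mstF p)). Qed.

Let typ p i := [set w | of_type i (emission p w)].

Let mtyp p i : F (size p) (typ p i).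
Proof. by apply/(sub_measurableE (sF (size p))); exact: (mp p).1. Qed.

Local Notation event_surv p i := (@flight_surv R m l D dT T (F (size p)) (emission p) (total_rate i) i).

Let mes p i : measurable_fun setT (event_surv p i).
Proof.
exact: (@measurable_flight_surv R m l D oD dT T _ (sF (size p)) _ (mp p) _ i (bounded_total_rate oD hxs i)).
Qed.

Let es0 p i z : 0 <= event_surv p i z. Proof. exact: flight_surv_ge0. Qed.

Lemma measurable_event c p i : measurable [set w | event c p i w].
Proof.
by apply: (@Gm (size p)); apply/(sub_measurableE (sG (size p))); exact: measurable_event_G.
Qed.

(** * Laws of the events of one emission *)

Lemma clocks_survival p i A a b : F (size p) A -> A `<=` typ p i -> 0 <= a -> 0 <= b ->
  P (A `&` [set w | (a%:E < clock true p w)%E /\ (b%:E < clock false p w)%E]) =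
  (\int[P]_(w in A) (survival_rate (fun u => along l (event_rate true i) i (st p w, u)) a *
     survival_rate (fun u => along l (event_rate false i) i (st p w, u)) b)%:E)%E.
Proof.
move=> FA Ai a0 b0.
(* A mean over a generation is a sum of means over single labels, so the joint law is taken at the
   list [[:: p]]. *)
have := @mnbp_clocks _ _ _ _ _ _ _ _ _ _ _ _ _ _ X (size p) [:: p] (fun=> a) (fun=> b) A.
rewrite (_ : [set w | forall u, _] =
    [set w | (a%:E < clock true p w)%E /\ (b%:E < clock false p w)%E]); last first.
  apply/seteqP; split=> w /=; first by apply; rewrite inE.
  by move=> ab u; rewrite inE => /eqP ->.
move=> -> //; last 2 first.
- by move=> u; rewrite inE => /eqP ->.
- by move=> u w; rewrite inE => /eqP -> /Ai /of_typeP ->.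
apply: eq_integral => w /set_mem Aw; rewrite big_seq1 /clock_law.
have /of_typeP E := Ai _ Aw; rewrite {1}E; congr EFin.
have [_ [_ Vx]] := emission_valid E.
congr (_ * _).
  apply: (@survivalE R m l D vmin vmax _ _ i _ a (bounded_scat oD hxs i)) => //.
  - by move=> y DVy; rewrite /scat zero_offE.
  - by move=> y nDVy; rewrite /scat zero_off_out.
apply: (@survivalE R m l D vmin vmax _ _ i _ b (bounded_remo oD hxs i)) => //.
- by move=> y DVy; rewrite /remo zero_offE.
- by move=> y nDVy; rewrite /remo zero_off_out.
Qed.

(** For both values of [c], [rings_first c] lies between the strict and the large comparison of the
    clocks, so ties cause no distinction between scattering and removal. *)
Lemma event_race c p i A I (q : conf R -> \bar R) : F (size p) A -> measurable I ->
  measurable_fun setT q -> (forall y, 0 <= q y)%E ->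
  (\int[P]_(w in A `&` [set w | event c p i w] `&` [set w | I (age c p w)])
     q (flight i (st p w) (age c p w)) =
   \int[P]_(w in A) \int[leb1]_(s in `[0%R, +oo[ `&` I) ((event_surv p i (w, s))%:E *
     ((event_rate c i (flight i (st p w) s))%:E * q (flight i (st p w) s))))%E.
Proof.
move=> FA mI mq q0.
have mc b := @measurable_clock b p.
apply: (@particle_race _ _ _ _ oD _ _ P _ (sF (size p)) (@Fm (size p)) _ (mp p) i (clock c p)
  (clock (~~ c) p) (event_rate c i) (event_rate (~~ c) i) _ (rings_first c p) (event c p i)
  (mc c) (mc (~~ c)) (clock_ge0 c p) (bounded_event_rate c i) (bounded_event_rate (~~ c) i)) => //.
- by move=> y; rewrite /total_rate; case: (c) => //=; rewrite addrC.
- rewrite /rings_first -[X in measurable X]setTI.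
  by case: (c); [apply: measurable_lte|apply: measurable_lee].
- by rewrite /rings_first => w; case: (c) => // /ltW.
- by rewrite /rings_first => w; case: (c) => // /ltW.
- move=> A1 a b FA1 A1i a0 b0; case: (c); first exact: (clocks_survival FA1 A1i a0 b0).
  rewrite (_ : [set w | _ /\ _] =
      [set w | (b%:E < clock true p w)%E /\ (a%:E < clock false p w)%E]); last first.
    by apply/seteqP; split=> w /= [].
  by rewrite (clocks_survival FA1 A1i b0 a0); apply: eq_integral => w _; rewrite mulrC.
Qed.

Let fl c p (i : 'I_m) w := flight i (st p w) (age c p w).

Let mevent_G c p i : measurable ([set w | event c p i w] : set (TG (size p))).
Proof. exact: measurable_event_G. Qed.

Let mfl c p (i : 'I_m) : measurable_fun setT (fl c p i).
Proof.
apply: (sub_measurable_fun (sG (size p)) (@Gm (size p))).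
exact: (measurable_flight_G (mp p) c i).
Qed.

Lemma scatter_outcome p (i : 'I_m) A B : (i < l)%N -> G (size p) A ->
  A `<=` [set w | event true p i w] -> measurable B ->
  P (A `&` [set w | B (scatter_velocity X p w)]) =
  (\int[P]_(w in A) \int[leb3]_(v in B) (pscat D vmin vmax xs i (fl true p i w, v))%:E)%E.
Proof.
move=> il GA Aev mB.
have := @mnbp_outcomes _ _ _ _ _ _ _ _ _ _ _ _ _ _ X (size p) [:: p] (fun=> B) (fun=> set0) A.
rewrite (_ : A `&` [set w | forall u, _] = A `&` [set w | B (scatter_velocity X p w)]); last first.
  apply/seteqP; split=> w /= [Aw H]; split => //.
    by have := H p; rewrite inE eqxx /outcome_in (fate_event (Aev _ Aw)); apply.
  by move=> u; rewrite inE => /eqP ->; rewrite /outcome_in (fate_event (Aev _ Aw)).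
move=> ->//; last 2 first.
- by move=> u; rewrite inE => /eqP ->.
- by move=> u w; rewrite inE => /eqP -> /Aev /fate_event ->.
apply: eq_integral => w /set_mem Aw; rewrite big_seq1 /outcome_law.
rewrite (fate_event (Aev _ Aw)) (event_type (Aev _ Aw)).
have DVy := event_DV (Aev _ Aw).
rewrite -/(fl true p i w) in DVy *; move: (fl _ _ _ _) DVy => y DVy.
have mBV : measurable (B `&` V) by apply: measurableI => //; exact: measurable_shell.
have [mps ps0 _] := bounded_pscat oD hxs il.
have mpsy := measurable_snd_section y mps.
have psE v : V v -> pscat D vmin vmax xs i (y, v) = pi_s xs i y v.
  by move=> Vv; rewrite /pscat zero_offE.
have BVE : (\int[leb3]_(v in B `&` V) (pi_s xs i y v)%:E =
    \int[leb3]_(v in B `&` V) (pscat D vmin vmax xs i (y, v))%:E)%E.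
  by apply: eq_integral => v /set_mem[_ Vv]; rewrite psE.
(* Finite because [pi_s] integrates to 1 over [V]. *)
rewrite /Rintegral BVE fineK; last first.
  rewrite ge0_fin_numE; last by apply: integral_ge0 => v _; rewrite lee_fin.
  apply: (@le_lt_trans _ _ 1%E); last exact: ltry.
  rewrite -(pi_s_density hxs il DVy).
  rewrite [leRHS](eq_integral (fun v => (pscat D vmin vmax xs i (y, v))%:E)); last first.
    by move=> v /set_mem Vv; rewrite psE.
  apply: ge0_subset_integral => //.
  - exact: measurable_shell.
  - by apply: measurable_funTS; exact/measurable_EFinP.
  - by move=> v _; rewrite lee_fin.
rewrite [LHS]integral_mkcond [RHS]integral_mkcond; apply: eq_integral => v _.
rewrite !patchE in_setI; case: (v \in B) => //=; case: ifPn => // nV.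
by rewrite /pscat zero_off_out// => -[_ Vv]; move/negP: nV; apply; exact/mem_set.
Qed.

Lemma offspring_law_le1 i y C : measurable C -> (off_law i y C <= 1)%E.
Proof.
move=> mC; apply: le_trans (sprob_kernel_le1 (off_law i) y).
by apply: le_measure; rewrite ?inE.
Qed.

Lemma removal_outcome p i A C : G (size p) A ->
  A `<=` [set w | event false p i w] -> measurable C ->
  P (A `&` [set w | C (mark p w)]) = (\int[P]_(w in A) off_law i (fl false p i w) C)%E.
Proof.
move=> GA Aev mC.
have := @mnbp_outcomes _ _ _ _ _ _ _ _ _ _ _ _ _ _ X (size p) [:: p] (fun=> set0) (fun=> C) A.
rewrite (_ : A `&` [set w | forall u, _] = A `&` [set w | C (mark p w)]); last first.
  apply/seteqP; split=> w /= [Aw H]; split => //.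
    by have := H p; rewrite inE eqxx /outcome_in (fate_event (Aev _ Aw)); apply.
  by move=> u; rewrite inE => /eqP ->; rewrite /outcome_in (fate_event (Aev _ Aw)).
move=> ->//; last 2 first.
- by move=> u; rewrite inE => /eqP ->.
- by move=> u w; rewrite inE => /eqP -> /Aev /fate_event ->.
apply: eq_integral => w /set_mem Aw; rewrite big_seq1 /outcome_law.
rewrite (fate_event (Aev _ Aw)) (event_type (Aev _ Aw)) -/(fl false p i w) fineK//.
rewrite ge0_fin_numE//; apply: (@le_lt_trans _ _ 1%E); last exact: ltry.
exact: offspring_law_le1.
Qed.

(** The scattering clock of an isotope has rate 0 but may still ring on a null set. [event_race]
    with a null rate gives the value 0. [scatter_rect] needs this, as [scatter_outcome] is about
    prompt types. *)
Lemma scatter_isotope p (i : 'I_m) : (l <= i)%N -> P [set w | event true p i w] = 0%E.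
Proof.
move=> il.
have := event_race true i (@mtyp p i) measurableT
  (measurable_cst (1%E : \bar R)) (fun _ : conf R => lee01).
rewrite integral_cst; last first.
  rewrite (_ : [set w | setT _] = setT)// setIT.
  by apply: measurableI; [exact/Fm/mtyp|exact: measurable_event].
rewrite mul1e (_ : _ `&` _ `&` _ = [set w | event true p i w]); last first.
  apply/seteqP; split=> [w [[]]//|w /= ev].
  by have /and3P[ty _ _] := ev.
move=> ->; rewrite integral0_eq// => w _; rewrite integral0_eq// => s _.
by rewrite /event_rate scat_isotope// mul0e mule0.
Qed.

Lemma scatter_rect p i A I B : F (size p) A -> measurable I -> measurable B ->
  P ([set w | event true p i w] `&` A `&`
    [set w | I (age true p w) /\ B (scatter_velocity X p w)]) =
  (\int[P]_(w in A) \int[leb1]_(s in `[0%R, +oo[ `&` I) ((event_surv p i (w, s))%:E *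
    \int[leb3]_(v in B) (scat_density i (flight i (st p w) s, v))%:E))%E.
Proof.
move=> FA mI mB.
have [il|il] := ltnP i l; last first.
  rewrite integral0_eq => [|w _]; last first.
    rewrite integral0_eq// => s _; rewrite integral0_eq ?mule0// => v _.
    by rewrite /scat_density scat_isotope// mul0r.
  apply/eqP; rewrite eq_le measure_ge0 andbT -(scatter_isotope p il).
  apply: le_measure; rewrite ?inE.
  - apply: measurableI; first by apply: measurableI; [exact: measurable_event|exact: (Fm FA)].
    apply: measurableI; rewrite -[X in measurable X]setTI.
      have ma : measurable_fun setT (age true p).
        by apply: measurableT_comp => //; exact: measurable_clock.
      exact: ma.
    have mv : measurable_fun setT (scatter_velocity X p).
      apply: (sub_measurable_fun (sF (size p).+1) (@Fm (size p).+1)) => _ C mC.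
      by rewrite setTI; apply/(sub_measurableE (sF (size p).+1)); exact: scatter_velocity_F.
    exact: mv.
  - exact: measurable_event.
  - by move=> w [[]].
have [mps ps0 _] := bounded_pscat oD hxs il.
pose q (y : conf R) : \bar R := (\int[leb3]_(v in B) (pscat D vmin vmax xs i (y, v))%:E)%E.
have mq : measurable_fun setT q.
  rewrite (_ : q = fubini_F leb3 (fun z => ((pscat D vmin vmax xs i z) * \1_B z.2)%:E)); last first.
    apply/funext => y; rewrite /q integral_mkcond; apply: eq_integral => v _.
    by rewrite patchE indicE/=; case: (v \in B); rewrite ?mulr1 ?mulr0.
  apply: measurable_fun_fubini_tonelli_F; last by move=> z; rewrite lee_fin mulr_ge0.
  apply/measurable_EFinP; apply: measurable_funM => //.
  exact: (measurableT_comp (measurable_indic mB) measurable_snd).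
have q0 y : (0 <= q y)%E by apply: integral_ge0 => v _; rewrite lee_fin.
pose A' := A `&` [set w | event true p i w] `&` [set w | I (age true p w)].
have GA' : G (size p) A'.
  apply/(sub_measurableE (sG (size p))); apply: measurableI; first apply: measurableI.
  - exact/(sub_measurableE (sG (size p)))/FG.
  - exact: mevent_G.
  - rewrite -[X in measurable X]setTI.
    exact: (@measurable_age_G p true).
rewrite (_ : _ `&` _ `&` _ = A' `&` [set w | B (scatter_velocity X p w)]); last first.
  by apply/seteqP; split=> w; [move=> [[? ?] [? ?]]|move=> [[[? ?] ?] ?]].
rewrite (scatter_outcome il GA')//; last by move=> w [[]].
rewrite (event_race true i FA mI mq q0).
apply: eq_integral => w _; apply: eq_integral => s _; congr (_ * _)%E.
rewrite /q -ge0_integralZl_EFin//.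
- by move=> v _; rewrite lee_fin.
- apply: measurable_funTS; apply/measurable_EFinP.
  exact: (measurable_snd_section (flight i (st p w) s) mps).
- by have [_ + _] := bounded_event_rate true i; apply.
Qed.

Definition release_event p i j k : set T :=
  [set w | [&& event false p i w, releases l i j & (k < count j (mark p w))%N]].

Definition release_velocity p (j : 'I_m) k w : vec3 R :=
  if (j < l)%N then vel j k (mark p w) else (st p w).2.

Let mcount j k : measurable [set o | (k < count j o)%N].
Proof.
have mc : measurable_fun setT (count j) by exact: (count_measurable hoff).
by rewrite -[X in measurable X]setTI; exact: (mc measurableT [set n | (k < n)%N]).
Qed.

Let mmark p : measurable_fun setT (mark p).
Proof.
apply: (sub_measurable_fun (sF (size p).+1) (@Fm (size p).+1)) => _ C mC.
by rewrite setTI; apply/(sub_measurableE (sF (size p).+1)); exact: offspring_mark_F.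
Qed.

Lemma measurable_release_event p i j k : measurable (release_event p i j k).
Proof.
rewrite (_ : release_event p i j k = [set w | event false p i w] `&`
    ([set _ | releases l i j] `&` (mark p @^-1` [set o | (k < count j o)%N]))); last first.
  by apply/seteqP; split=> w; rewrite /release_event/=; [move=> /and3P[]|move=> [-> [-> ->]]].
apply: measurableI; first exact: measurable_event.
apply: measurableI.
  by apply: (measurable_bool_set (b := fun=> releases l i j)); exact: measurable_cst.
by rewrite -[X in measurable X]setTI; exact: mmark.
Qed.

(** By Tonelli, the probabilities that a [k]-th emission is released with a given property add up to
    the mean number of such emissions, which is the quantity that [prompt_mean] and [isotope_meanE]
    prescribe. *)
Lemma mark_series (C : (set O)^nat) (N : O -> nat) (f : nat -> O -> R) i y :
  (forall k, measurable (C k)) -> (forall k o, \1_(C k) o = if (k < N o)%N then f k o else 0) ->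
  (\sum_(k <oo) off_law i y (C k) = \int[off_law i y]_o (\sum_(k < N o) f k o)%:E)%E.
Proof.
move=> mC CE.
transitivity (\sum_(k <oo) \int[off_law i y]_o (\1_(C k) o)%:E)%E.
  by apply: eq_eseriesr => k _; rewrite integral_indic// setIT.
rewrite -integral_nneseries//; last first.
  by move=> k; apply/measurable_EFinP; exact: measurable_indic.
apply: eq_integral => o _; rewrite (nneseries_split 0 (N o))// add0n.
rewrite eseries0 ?adde0; last by move=> k Nk _; rewrite CE ltnNge (Nk : (N o <= k)%N).
rewrite big_mkord sumEFin; congr EFin; apply: eq_bigr => k _.
by rewrite CE ltn_ord.
Qed.

Lemma removal_series p i A (C : (set O)^nat) (q : conf R -> \bar R) :
  G (size p) A -> A `<=` [set w | event false p i w] ->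
  (forall k, measurable (C k)) -> (forall y, DV y -> \sum_(k <oo) off_law i y (C k) = q y)%E ->
  (\sum_(k <oo) P (A `&` [set w | C k (mark p w)]) = \int[P]_(w in A) q (fl false p i w))%E.
Proof.
move=> GA Aev mC Cq.
under eq_eseriesr do rewrite (removal_outcome GA Aev (mC _)).
rewrite -integral_nneseries//; last 2 first.
- exact: Gm GA.
- move=> k; apply: measurable_funTS.
  exact: (measurableT_comp (measurable_kernel (off_law i) _ (mC k)) (@mfl false p i)).
apply: eq_integral => w /set_mem /Aev ev; apply: Cq.
exact: (event_DV ev).
Qed.

Let GA' p (i : 'I_m) A I : F (size p) A -> measurable I ->
  G (size p) (A `&` [set w | event false p i w] `&` [set w | I (age false p w)]).
Proof.
move=> FA mI; apply/(sub_measurableE (sG (size p))); apply: measurableI; first apply: measurableI.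
- exact/(sub_measurableE (sG (size p)))/FG.
- exact: mevent_G.
- rewrite -[X in measurable X]setTI.
  exact: (@measurable_age_G p false).
Qed.

Lemma prompt_rect p i (j : 'I_m) A I B : (j < l)%N ->
  F (size p) A -> measurable I -> measurable B ->
  (\sum_(k <oo) P (release_event p i j k `&` A `&`
     [set w | I (age false p w) /\ B (release_velocity p j k w)]) =
  \int[P]_(w in A) \int[leb1]_(s in `[0%R, +oo[ `&` I) ((event_surv p i (w, s))%:E *
    \int[leb3]_(v in B) (fission_density i j (flight i (st p w) s, v))%:E))%E.
Proof.
move=> jl FA mI mB.
have [mpf pf0 _] := bounded_pfis oD hxs i jl.
pose q (y : conf R) : \bar R := (\int[leb3]_(v in B) (pfis D vmin vmax xs i j (y, v))%:E)%E.
have mq : measurable_fun setT q.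
  rewrite (_ : q = fubini_F leb3 (fun z => ((pfis D vmin vmax xs i j z) * \1_B z.2)%:E)); last first.
    apply/funext => y; rewrite /q integral_mkcond; apply: eq_integral => v _.
    by rewrite patchE indicE/=; case: (v \in B); rewrite ?mulr1 ?mulr0.
  apply: measurable_fun_fubini_tonelli_F; last by move=> z; rewrite lee_fin mulr_ge0.
  apply/measurable_EFinP; apply: measurable_funM => //.
  exact: (measurableT_comp (measurable_indic mB) measurable_snd).
have q0 y : (0 <= q y)%E by apply: integral_ge0 => v _; rewrite lee_fin.
have mBV : measurable (B `&` V) by apply: measurableI => //; exact: measurable_shell.
(* Marks for which a [k]-th emission of type [j] exists with velocity in [B]; the trace on [V] is
   taken because [prompt_mean] is stated for subsets of [V]. *)
pose C k := [set o | (k < count j o)%N] `&` vel j k @^-1` (B `&` V).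
have mC k : measurable (C k).
  apply: measurableI; first exact: mcount.
  by rewrite -[X in measurable X]setTI; exact: (velocity_measurable hoff).
have CE y : DV y -> (\sum_(k <oo) off_law i y (C k) = q y)%E.
  move=> DVy; rewrite (mark_series (N := count j) (f := fun k o => \1_(B `&` V) (vel j k o)))//.
    rewrite (prompt_mean hoff i jl DVy mBV (@subIsetr _ _ _)).
    rewrite -(integral_pfis _ _ _ DVy (@subIsetr _ _ _)) /q.
    rewrite [LHS]integral_mkcond [RHS]integral_mkcond; apply: eq_integral => v _.
    rewrite !patchE in_setI; case: (v \in B) => //=; case: ifPn => // nV.
    by rewrite /pfis zero_off_out// => -[_ Vv]; move/negP: nV; apply; exact/mem_set.
  move=> k o; rewrite /C !indicE in_setI.
  have -> : (o \in [set o | (k < count j o)%N]) = (k < count j o)%N.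
    by apply/idP/idP => [/set_mem|/mem_set].
  have -> : (o \in vel j k @^-1` (B `&` V)) = (vel j k o \in B `&` V).
    by apply/idP/idP => /set_mem /mem_set.
  by case: ltnP.
have := removal_series (GA' i FA mI) _ mC CE.
rewrite (event_race false i FA mI mq q0) => H.
transitivity (\int[P]_(w in A) \int[leb1]_(s in `[0%R, +oo[ `&` I) ((event_surv p i (w, s))%:E *
     ((event_rate false i (flight i (st p w) s))%:E * q (flight i (st p w) s))))%E; last first.
  apply: eq_integral => w _; apply: eq_integral => s _; congr (_ * _)%E.
  rewrite /q -ge0_integralZl_EFin//.
  - by apply: eq_integral => v _; rewrite /fission_density jl EFinM.
  - by move=> v _; rewrite lee_fin.
  - apply: measurable_funTS; apply/measurable_EFinP.
    exact: (measurable_snd_section (flight i (st p w) s) mpf).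
  - by have [_ + _] := bounded_event_rate false i; apply.
rewrite -H; last by move=> w [[]].
apply: eq_eseriesr => k _; congr (P _); apply/seteqP; split=> w.
  rewrite /release_event /release_velocity jl => -[[/= /and3P[ev _ kc] Aw] [Iw Bw]].
  by split=> //; split => //; split => //; exact: (velocity_in_V hoff).
rewrite /release_event /release_velocity jl => -[[[Aw ev] Iw] [/= kc [Bw _]]].
by split=> //; split => //=; rewrite ev kc /releases jl.
Qed.

Lemma isotope_rect p i (j : 'I_m) A I B : (l <= j)%N ->
  F (size p) A -> measurable I -> measurable B ->
  (\sum_(k <oo) P (release_event p i j k `&` A `&`
     [set w | I (age false p w) /\ B (release_velocity p j k w)]) =
  \int[P]_(w in A) \int[leb1]_(s in `[0%R, +oo[ `&` I)
    ((event_surv p i (w, s) * isotope_rate i j (flight i (st p w) s))%:E *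
     (\1_B (st p w).2)%:E))%E.
Proof.
move=> lj FA mI mB.
have [i00|i00] := eqVneq (val i) 0%N; last first.
  rewrite eseries0 => [|k _ _]; last first.
    rewrite (_ : _ `&` _ = set0) ?measure0//; apply/seteqP; split=> // w [[/= /and3P[_ + _]]].
    by rewrite /releases ltnNge lj (negbTE i00).
  rewrite integral0_eq// => w _; rewrite integral0_eq// => s _.
  by rewrite /isotope_rate (negbTE i00) mulr0 mul0e.
have [mim im0 _] := bounded_imean oD hxs lj.
pose q (y : conf R) : \bar R := (imean D vmin vmax xs j y)%:E.
have mq : measurable_fun setT q by exact/measurable_EFinP.
have q0 y : (0 <= q y)%E by rewrite lee_fin.
(* An isotope inherits the velocity of its parent, which is known before the event: the condition on
   [B] is absorbed into the conditioning set. *)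
pose AB := A `&` [set w | B (st p w).2].
have FAB : F (size p) AB.
  apply/(sub_measurableE (sF (size p))); apply: measurableI.
    exact/(sub_measurableE (sF (size p))).
  rewrite -[X in measurable X]setTI.
  exact: (measurableT_comp measurable_snd (@mstF p)).
pose C k := [set o | (k < count j o)%N].
have CE y : DV y -> (\sum_(k <oo) off_law i y (C k) = q y)%E.
  move=> DVy; rewrite (mark_series (N := count j) (f := fun _ _ => 1))//.
    rewrite /q /imean zero_offE// -(isotope_meanE hoff i00 lj DVy).
    by apply: eq_integral => o _; rewrite sumr_const card_ord.
  - by move=> k; exact: mcount.
  move=> k o; rewrite /C indicE.
  have -> : (o \in [set o | (k < count j o)%N]) = (k < count j o)%N.
    by apply/idP/idP => [/set_mem|/mem_set].
  by case: ltnP.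
have := removal_series (GA' i FAB mI) _ (mcount j) CE.
rewrite (event_race false i FAB mI mq q0) => H.
transitivity (\int[P]_(w in AB) \int[leb1]_(s in `[0%R, +oo[ `&` I) ((event_surv p i (w, s))%:E *
     ((event_rate false i (flight i (st p w) s))%:E * q (flight i (st p w) s))))%E; last first.
  rewrite [LHS]integral_mkcondr; apply: eq_integral => w _; rewrite patchE indicE.
  have -> : (w \in [set w | B (st p w).2]) = ((st p w).2 \in B).
    by apply/idP/idP => /set_mem /mem_set.
  case: (_ \in B); last by rewrite integral0_eq// => s _; rewrite mule0.
  apply: eq_integral => s _; rewrite mule1 EFinM; congr (_ * _)%E.
  by rewrite /isotope_rate i00 eqxx lj EFinM.
rewrite -H; last by move=> w [[]].
apply: eq_eseriesr => k _; congr (P _); apply/seteqP; split=> w.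
  rewrite /release_event /release_velocity ltnNge lj => -[[/= /and3P[ev _ kc] Aw] [Iw Bw]].
  by [].
rewrite /release_event /release_velocity ltnNge lj => -[[[[Aw Bw] ev] Iw] /= kc].
by split=> //; split => //=; rewrite ev kc /releases i00 eqxx orbT.
Qed.

(** Ranks [k >= nmax] have probability 0 by [count_bounded], so the series is a finite sum of
    probabilities. This is the finiteness that the event laws require. *)
Lemma release_event_fin p i j : (\sum_(k <oo) P (release_event p i j k) < +oo)%E.
Proof.
have [rel|rel] := boolP (releases l i j); last first.
  rewrite eseries0 ?ltry// => k _ _; rewrite (_ : release_event p i j k = set0) ?measure0//.
  by apply/seteqP; split=> // w /= /and3P[_]; rewrite (negbTE rel).
have P0 k : (nmax <= k)%N -> P (release_event p i j k) = 0%E.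
  move=> nk; pose ev := [set w | event false p i w].
  have Gev : G (size p) ev by apply/(sub_measurableE (sG (size p))); exact: mevent_G.
  rewrite (_ : release_event p i j k = ev `&` [set w | [set o | (k < count j o)%N] (mark p w)]).
    rewrite (removal_outcome Gev (@subset_refl _ _) (mcount j k)).
    rewrite integral0_eq// => w evw; apply: measure_negligible => //.
    have := count_bounded hoff rel (event_DV evw).
    by apply: negligibleS => o /= kc; apply/negP; rewrite -ltnNge (leq_ltn_trans nk).
  apply/seteqP; split=> w; rewrite /release_event/ev/=; first by move=> /and3P[].
  by move=> [-> ->]; rewrite rel.
rewrite (nneseries_split 0 nmax)// add0n eseries0 ?adde0; last by move=> k nk _; exact: P0.
apply: lte_sum_pinfty => k _; rewrite (le_lt_trans (probability_le1 _ _)) ?ltry//.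
exact: measurable_release_event.
Qed.

Let mbirthF p : measurable_fun setT ((fun w => birth (emission p w)) : TF (size p) -> R * conf R).
Proof. exact: (mp p).2. Qed.

Let mbirth p : measurable_fun setT (fun w => birth (emission p w)).
Proof. exact: (sub_measurable_fun (sF (size p)) (@Fm (size p)) (@mbirthF p)). Qed.

Let mtypT p i : measurable [set w | of_type i (emission p w)].
Proof. exact/Fm/mtyp. Qed.

Let mage c p : measurable_fun setT (age c p).
Proof. by apply: measurableT_comp => //; exact: measurable_clock. Qed.

Let mrel_vel p j k : measurable_fun setT (release_velocity p j k).
Proof.
rewrite /release_velocity; case: (j < l)%N.
  exact: (measurableT_comp (velocity_measurable hoff j k) (@mmark p)).
exact: (measurableT_comp measurable_snd (@mst p)).
Qed.

Section one_event.
Variables (p : label m) (i : 'I_m) (h : R * conf R -> \bar R).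
Hypotheses (mh : measurable_fun setT h) (h0 : forall z, (0 <= h z)%E).

Let Phi (z : TF (size p) * (R * vec3 R)) : \bar R :=
  h ((birth (emission p z.1)).1 + z.2.1, ((flight i (st p z.1) z.2.1).1, z.2.2)).

Let mPhi : measurable_fun setT Phi.
Proof.
have mb1 : measurable_fun setT (fun z : TF (size p) * (R * vec3 R) => birth (emission p z.1)).
  exact: (measurableT_comp (@mbirthF p) measurable_fst).
have mst2 : measurable_fun setT (fun z : TF (size p) * (R * vec3 R) => st p z.1).
  exact: (measurableT_comp measurable_snd mb1).
have ms : measurable_fun setT (fun z : TF (size p) * (R * vec3 R) => z.2.1).
  by apply: measurableT_comp => //; exact: measurable_snd.
have mv : measurable_fun setT (fun z : TF (size p) * (R * vec3 R) => z.2.2).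
  by apply: measurableT_comp => //; exact: measurable_snd.
apply: (measurableT_comp mh); apply: measurable_fun_pair.
  by apply: measurable_funD => //; exact: (measurableT_comp measurable_fst mb1).
apply: measurable_fun_pair => //; apply: (measurableT_comp measurable_fst).
exact: (measurable_fun_pair_comp (@measurable_flight R m l i) mst2 ms).
Qed.

Let Phi0 z : (0 <= Phi z)%E. Proof. exact: h0. Qed.

Let integral_event_surv (a : T -> R -> \bar R) :
  (\int[P]_w \int[leb1]_(s in `[0%R, +oo[) ((event_surv p i (w, s))%:E * a w s) =
   \int[P]_(w in [set w | of_type i (emission p w)]) \int[leb1]_(s in `[0%R, +oo[)
     ((surv l D vmin vmax xs i (st p w) s)%:E * a w s))%E.
Proof.
rewrite [RHS]integral_mkcond; apply: eq_integral => w _; rewrite patchE.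
case: ifPn => [/set_mem/= ty|nty].
  by apply: eq_integral => s _; rewrite /flight_surv/= ty.
rewrite integral0_eq// => s _; rewrite /flight_surv/=; case: ifP; last by rewrite mul0e.
by move=> /andP[ty _]; move/negP: nty; case; exact/mem_set.
Qed.

Lemma scattered_mean :
  (\int[P]_(w in [set w | event true p i w]) h (birth (emission (None :: p) w)) =
   \int[P]_(w in [set w | of_type i (emission p w)])
     flight_density (scat_density i) i h (birth (emission p w)))%E.
Proof.
transitivity (\int[P]_(w in [set w | event true p i w]) Phi (w, (age true p w, scatter_velocity X p w)))%E.
  by apply: eq_integral => w /set_mem /emission_scattered ->.
have mev := measurable_event true p i.
pose Q k := if k == 0%N then [set w | event true p i w] else set0.
have mQ k : measurable (Q k) by rewrite /Q; case: ifP.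
have Qfin : (\sum_(k <oo) P (Q k) < +oo)%E.
  rewrite (@nneseries_only0 _ (P \o Q))/=.
  - by rewrite (le_lt_trans (probability_le1 _ _)) ?ltry.
  - exact: measure_ge0.
  - by move=> [|k]//= _; rewrite measure0.
have mvel (k : nat) : measurable_fun setT (scatter_velocity X p).
  apply: (sub_measurable_fun (sF (size p).+1) (@Fm (size p).+1)) => _ C mC.
  by rewrite setTI; apply/(sub_measurableE (sF (size p).+1)); exact: scatter_velocity_F.
have [mq q0 _] := bounded_scat_density oD hxs i.
have := event_law_density (sF (size p)) (@Fm (size p)) mQ (@mage true p) mvel Qfin
  (@mes p i) (@es0 p i) mq q0 (measurable_flight_age l (mp p) i) _ mPhi Phi0.
rewrite (@nneseries_only0 _ (fun k => \int[P]_(w in Q k) _)%E)/=; last 2 first.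
- exact: integral_ge0.
- by move=> [|k]//= _; rewrite integral_set0.
move=> ->; first by rewrite integral_event_surv.
move=> A I B FA mI mB.
rewrite (@nneseries_only0 _ (fun k => P (Q k `&` A `&` _)))//=.
  exact: (scatter_rect i FA mI mB).
by move=> [|k]//= _; rewrite !set0I measure0.
Qed.

(** As in [walk_event], a prompt type contributes the density term only and an isotope the atom
    only, and the two event laws apply to the whole series over [k]. *)
Lemma released_mean (j : 'I_m) :
  (\sum_(k <oo) \int[P]_(w in release_event p i j k) h (birth (emission (Some (j, k) :: p) w)) =
   \int[P]_(w in [set w | of_type i (emission p w)])
     (flight_density (fission_density i j) i h (birth (emission p w)) +
      flight_atom (isotope_rate i j) i h (birth (emission p w))))%E.
Proof.
transitivity (\sum_(k <oo) \int[P]_(w in release_event p i j k)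
    Phi (w, (age false p w, release_velocity p j k w)))%E.
  apply: eq_eseriesr => k _; apply: eq_integral => w /set_mem /and3P[ev rel kc].
  by rewrite (emission_released ev rel kc).
have mQ k := measurable_release_event p i j k.
have Qfin := release_event_fin p i j.
have [jl|lj] := ltnP j l.
  have -> : isotope_rate i j = fun=> 0.
    by apply/funext => y; rewrite /isotope_rate leqNgt jl andbF.
  under [RHS]eq_integral do rewrite flight_atom0 adde0.
  have [mq q0 _] := bounded_fission_density oD hxs i j.
  rewrite (event_law_density (sF (size p)) (@Fm (size p)) mQ (@mage false p)
    (@mrel_vel p j) Qfin (@mes p i) (@es0 p i) mq q0 (measurable_flight_age l (mp p) i) _ mPhi Phi0).
    by rewrite integral_event_surv.
  by move=> A I B FA mI mB; exact: (prompt_rect i jl FA mI mB).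
have -> : fission_density i j = fun=> 0.
  by apply/funext => y; rewrite /fission_density ltnNge lj.
under [RHS]eq_integral do rewrite flight_density0 add0e.
have [mir ir0 _] := bounded_isotope_rate oD hxs i j.
have mg : measurable_fun setT (fun z : TF (size p) * R =>
    event_surv p i z * isotope_rate i j (flight i (st p z.1) z.2)).
  by apply: measurable_funM => //; exact: (measurableT_comp mir (measurable_flight_age l (mp p) i)).
have mth : measurable_fun setT (fun w : TF (size p) => (st p w).2).
  exact: (measurableT_comp measurable_snd (@mstF p)).
rewrite (event_law_atom (sF (size p)) (@Fm (size p)) mQ (@mage false p)
  (@mrel_vel p j) Qfin mg _ mth _ mPhi Phi0).
- rewrite -integral_event_surv; apply: eq_integral => w _; apply: eq_integral => s _.
  rewrite EFinM -muleA; congr (_ * (_ * h (_, _)))%E.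
  by rewrite [RHS]surjective_pairing flight_snd.
- by move=> z; rewrite mulr_ge0.
- by move=> A I B FA mI mB; exact: (isotope_rect i lj FA mI mB).
Qed.

End one_event.

(** * From one emission to a generation *)

Definition emission_mean p (H : 'I_m -> R * conf R -> \bar R) : \bar R :=
  (\sum_(i < m) \int[P]_(w in [set w | of_type i (emission p w)]) H i (birth (emission p w)))%E.

(** The letters that can extend [p] are the terms of [next_eventE]: [None] gives the scattering
    term, and the letters [Some (j, k)], summed over [k], give the terms of type [j]. *)
Lemma children_mean p (H : 'I_m -> R * conf R -> \bar R) :
  (forall j, measurable_fun setT (H j)) -> (forall j z, 0 <= H j z)%E ->
  (emission_mean (None :: p) H + \sum_(j < m) \sum_(k <oo) emission_mean (Some (j, k) :: p) H =
   emission_mean p (next_event H))%E.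
Proof.
move=> mH H0.
have mHb u i : measurable_fun setT (fun w => H i (birth (emission u w))).
  exact: (measurableT_comp (mH i) (@mbirth u)).
have E1 : emission_mean (None :: p) H = (\sum_(i < m)
   \int[P]_(w in [set w | of_type i (emission p w)])
     flight_density (scat_density i) i (H i) (birth (emission p w)))%E.
  apply: eq_bigr => i _; rewrite -scattered_mean//; congr (integral _ _ _).
  apply/seteqP; split=> w /=; last by move=> /emission_scattered ->/=.
  move=> /of_typeP E; have [i' ev] := emission_cons E.
  by move: E; rewrite (emission_scattered ev) => -[<-].
have E2 j : (\sum_(k <oo) emission_mean (Some (j, k) :: p) H = \sum_(i < m)
    \int[P]_(w in [set w | of_type i (emission p w)])
     (flight_density (fission_density i j) i (H j) (birth (emission p w)) +
      flight_atom (isotope_rate i j) i (H j) (birth (emission p w))))%E.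
  transitivity (\sum_(k <oo) \sum_(i < m) \int[P]_(w in release_event p i j k)
      H j (birth (emission (Some (j, k) :: p) w)))%E.
    apply: eq_eseriesr => k _; rewrite /emission_mean (bigD1 j)//= [X in (_ + X)%E]big1 ?adde0.
      apply: (@integral_cases 'I_m _ T R P [set w | of_type j (emission (Some (j, k) :: p) w)]
        (fun i w => [&& event false p i w, releases l i j & (k < count j (mark p w))%N])
        (fun w => H j (birth (emission (Some (j, k) :: p) w)))) => //.
      - by move=> i; exact: (measurable_release_event p i j k).
      - by move=> i w /and3P[ev rel kc]; rewrite /= (emission_released ev rel kc)/=.
      - by move=> i i' w /and3P[/and3P[oi _ _] _ _] /and3P[/and3P[oi' _ _] _ _]; exact: of_type_uniq oi oi'.
      - move=> w /of_typeP /emission_cons[i [ev rel kc]] np; have /negP := np i.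
        by case; apply/and3P.
    move=> i ij; rewrite (_ : [set w | _] = set0) ?integral_set0//.
    apply/seteqP; split=> // w /= /of_typeP E; have [i' [ev rel kc]] := emission_cons E.
    by move: E; rewrite (emission_released ev rel kc) => -[ji]; rewrite ji eqxx in ij.
  rewrite nneseries_sum => [|i k _]; last by apply: integral_ge0 => w _; exact: H0.
  by apply: eq_bigr => i _; rewrite released_mean.
rewrite E1 (eq_bigr _ (fun j _ => E2 j)) exchange_big/= -big_split/=.
apply: eq_bigr => i _.
have mfd q : bounded_nonneg q -> forall j, measurable_fun setT (flight_density q i (H j)).
  by move=> bq j; exact: (measurable_flight_density oD hxs).
have mfa q : bounded_nonneg q -> forall j, measurable_fun setT (flight_atom q i (H j)).
  by move=> bq j; exact: (measurable_flight_atom oD hxs).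
have bs := bounded_scat_density oD hxs i.
have bf j := bounded_fission_density oD hxs i j.
have bi j := bounded_isotope_rate oD hxs i j.
have mj j : measurable_fun setT (fun w =>
    flight_density (fission_density i j) i (H j) (birth (emission p w)) +
    flight_atom (isotope_rate i j) i (H j) (birth (emission p w)))%E.
  apply: emeasurable_funD.
    exact: (measurableT_comp (mfd _ (bf j) j) (@mbirth p)).
  exact: (measurableT_comp (mfa _ (bi j) j) (@mbirth p)).
have j0 j w : (0 <= flight_density (fission_density i j) i (H j) (birth (emission p w)) +
    flight_atom (isotope_rate i j) i (H j) (birth (emission p w)))%E.
  by apply: adde_ge0; [exact: flight_density_ge0|exact: flight_atom_ge0].
rewrite -ge0_integral_sum//; last by move=> j; exact: measurable_funTS.
rewrite -ge0_integralD//; last 4 first.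
- by move=> w _; exact: flight_density_ge0.
- by apply: measurable_funTS; exact: (measurableT_comp (mfd _ bs i) (@mbirth p)).
- by move=> w _; apply: sume_ge0 => j _.
- by apply: measurable_funTS; exact: emeasurable_sum.
by apply: eq_integral => w _; rewrite (next_eventE oD hxs).
Qed.

Let emission_mean_ge0 p (H : 'I_m -> R * conf R -> \bar R) :
  (forall j z, 0 <= H j z)%E -> (0 <= emission_mean p H)%E.
Proof. by move=> H0; apply: sume_ge0 => i _; apply: integral_ge0 => w _; exact: H0. Qed.

(** A label of size [n.+1] is a letter in front of a label of size [n]. Summing over this youngest
    letter replaces [H] by [next_event H], so the induction peels the last generation off, and [H]
    is kept general. *)
Lemma generation_mean n (H : 'I_m -> R * conf R -> \bar R) :
  (forall j, measurable_fun setT (H j)) -> (forall j z, 0 <= H j z)%E ->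
  (\esum_(u in [set u : label m | size u = n]) emission_mean u H =
   iter n next_event H i0 (0%R, x0))%E.
Proof.
elim: n H => [|n IH] H mH H0.
  rewrite (_ : [set u : label m | size u = 0%N] = [set [::]]); last first.
    by apply/seteqP; split=> u /=; [exact: size0nil|move=> ->].
  rewrite esum_set1; last exact: emission_mean_ge0.
  rewrite /emission_mean (bigD1 i0)//= big1 ?adde0; last first.
    move=> i ii; rewrite (_ : [set w | _] = set0) ?integral_set0//.
    by apply/seteqP; split=> // w /=; rewrite eq_sym (negbTE ii).
  rewrite (_ : [set w | _] = setT); last by apply/seteqP; split=> // w _ /=; rewrite eqxx.
  by rewrite integral_cst//= probability_setT mule1.
rewrite iterSr -IH; last 2 first.
- by move=> j; exact: (measurable_next_event oD hxs).
- by move=> j z; exact: (next_event_ge0 oD hxs).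
rewrite (@reindex_esum _ _ _ ([set u : label m | size u = n] `*`` (fun=> setT)) _
    (fun k => k.2 :: k.1)); last first.
  split=> [[p a] [/= pn _]|[p a] [q b] _ _ [-> ->]//|[|a p]//= [pn]]; first by rewrite pn.
  by exists (p, a).
rewrite -(esum_esum (a := fun p a => emission_mean (a :: p) H)); last first.
  by move=> *; exact: emission_mean_ge0.
apply: eq_esum => p _; rewrite esum_option; last by move=> a; exact: emission_mean_ge0.
exact: (children_mean p mH H0).
Qed.

(** [population] runs over the integers that code labels. The terms are non-negative, so they may be
    regrouped by generation; an integer that codes no label contributes 0. *)
Lemma esum_generations (a : label m -> \bar R) : (forall u, 0 <= a u)%E ->
  (\sum_(k <oo) (if @pickle_inv (label m) k is Some u then a u else 0) =
   \sum_(n <oo) \esum_(u in [set u : label m | size u = n]) a u)%E.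
Proof.
move=> a0; rewrite -nneseries_sum_bigcup//; last first.
  by apply/trivIsetP => n k _ _ /eqP nk; apply/seteqP; split=> // u [/= un uk]; rewrite -un uk in nk.
rewrite (_ : \bigcup_n _ = setT); last by apply/seteqP; split=> // u _; exists (size u).
rewrite nneseries_esumT; last by move=> k; case: pickle_inv.
rewrite (esumID (range (@pickle (label m))))//; last by move=> k _; case: pickle_inv.
rewrite !setTI [X in (_ + X)%E]esum1 ?adde0; last first.
  move=> k nk; case E : (pickle_inv k) => [u|//]; case: nk; exists u => //.
  by have := @pickle_invK (label m) k; rewrite E.
rewrite (@reindex_esum _ _ _ setT _ (@pickle (label m))); last first.
  split=> // u v _ _; exact: (pcan_inj (@pickleK (label m))).
by apply: eq_esum => u _; rewrite pickleK_inv.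
Qed.

(** * Expansion of [psi] *)

Section semigroup.
Variables (g : 'I_m -> conf R -> R) (t : R).
Hypothesis hg : forall j, Lpos DV (g j).

Let gD j := zero_off DV (g j).

Let hgD j : bounded_nonneg (gD j).
Proof. by apply: bounded_nonneg_zero_off => //; exact: measurable_DV. Qed.

Let lifetime p w := mine (clock true p w) (clock false p w).

Let lifetime_ge0 p w : (0 <= lifetime p w)%E. Proof. by rewrite le_min !clock_ge0. Qed.

Let mlifetime p : measurable_fun setT (lifetime p).
Proof. by apply: measurable_mine; exact: measurable_clock. Qed.

Let one01 : 0 <= 1 :> R. Proof. exact: ler01. Qed.

Let value p := observed_value l D (emission p) gD t (lifetime p) (fun=> 1) (fun _ _ => 1).

Let value_ge0 p w : 0 <= value p w.
Proof. by apply: observed_value_ge0; [exact: hgD|move=> _|move=> _ _]. Qed.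

Let mvalue p : measurable_fun setT (value p).
Proof.
exact: (measurable_observed_value l oD (sF (size p)) (@Fm (size p)) (mp p) t hgD (@mlifetime p)
  (measurable_cst _) (fun=> measurable_cst _)).
Qed.

Let lifetime_survival p i A a : F (size p) A -> A `<=` typ p i -> 0 <= a ->
  P (A `&` [set w | (a%:E < lifetime p w)%E]) =
  (\int[P]_(w in A) (survival_rate (fun s => along l (total_rate i) i (st p w, s)) a)%:E)%E.
Proof.
move=> FA Ai a0.
rewrite (_ : [set w | (_ < _)%E] =
    [set w | (a%:E < clock true p w)%E /\ (a%:E < clock false p w)%E]); last first.
  by apply/seteqP; split=> w /=; rewrite /lifetime lt_min => /andP.
rewrite (clocks_survival FA Ai a0 a0); apply: eq_integral => w _; congr EFin.
have [ms s0 [c1 sc]] := bounded_along l i (bounded_scat oD hxs i).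
have [mr r0 [c2 rc]] := bounded_along l i (bounded_remo oD hxs i).
rewrite -(@survival_rateDr _ _ _ (Num.max c1 c2))//.
- exact: (measurable_snd_section (st p w) ms).
- by move=> s; rewrite le_max (sc (st p w, s)).
- exact: (measurable_snd_section (st p w) mr).
- by move=> s; rewrite le_max (rc (st p w, s)) orbT.
Qed.

Let value_mean p :
  (\int[P]_w (value p w)%:E = emission_mean p (mean_value l D vmin vmax xs gD t))%E.
Proof.
rewrite (observed_value_mean oD (sF (size p)) (@Fm (size p)) (mp p) t hgD (@mlifetime p)
  (@lifetime_ge0 p) (measurable_cst _) (fun=> one01) (fun=> measurable_cst _) (fun _ _ => one01)
  (fun i => bounded_total_rate oD hxs i) (fun _ _ => mulr1 _) (@lifetime_survival p)).
by apply: eq_bigr => i _; apply: eq_integral => w _; rewrite mul1e.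
Qed.

Let valueE p w : value p w =
  if emission_at l D off X i0 x0 p t w is Some (i, y) then g i y else 0.
Proof.
rewrite /value /observed_value /emission_at /observe.
case E : (emission p w) => [[[b i] x]|//]; case: ifP => // /and3P[bt _ ex].
rewrite !mul1r /gD zero_offE//; have [_ [_ Vx]] := emission_valid E.
by split; [apply: (flight_in oD _ ex); rewrite subr_ge0|rewrite /= flight_snd].
Qed.

(** Each emission alive contributes a Dirac mass at a configuration of [D * V], and the sum over [j]
    retains the one term of its own type. *)
Lemma pairingE w : pairing l D V off X i0 x0 g t w =
  (\sum_(k <oo) (if @pickle_inv (label m) k is Some u then (value u w)%:E else 0))%E.
Proof.
rewrite /pairing /population.
have gE j : (\int[population l D off X i0 x0 t j w]_(y in DV) (g j y)%:E =
  \sum_(k <oo) (if @pickle_inv (label m) k is Some u then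
    (if emission_at l D off X i0 x0 u t w is Some (i, y) then
       (if i == j then (g j y)%:E else 0) else 0) else 0))%E.
  have [mg g0 _] := hg j.
  rewrite ge0_integral_measure_series; [|exact: measurable_DV|by move=> y DVy; rewrite lee_fin g0|
    exact/measurable_EFinP].
  apply: eq_eseriesr => k _; case: pickle_inv => [u|]; last exact: integral_measure_zero.
  case E : emission_at => [[i y]|]; last exact: integral_measure_zero.
  case: ifP => _; last exact: integral_measure_zero.
  rewrite integral_dirac//; last 2 first.
  - exact: measurable_DV.
  - exact/measurable_EFinP.
  rewrite diracE mem_set ?mul1e//.
  move: E; rewrite /emission_at; case E : (emission u w) => [[[b i'] x]|//]/=.
  case: ifP => // /and3P[bt _ ex] [_ <-].
  have [_ [_ Vx]] := emission_valid E.
  by split; [apply: (flight_in oD _ ex); rewrite subr_ge0|rewrite /= flight_snd].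
under eq_bigr do rewrite gE.
rewrite -nneseries_sum.
  apply: eq_eseriesr => k _; case: pickle_inv => [u|]; last by rewrite big1.
  rewrite valueE; case: emission_at => [[i y]|]; last by rewrite big1.
  by rewrite (bigD1 i)//= eqxx big1 ?adde0// => j ji; rewrite eq_sym (negbTE ji).
move=> j k _; case: pickle_inv => [u|//]; case E : emission_at => [[i y]|//].
case: ifP => // /eqP ij; have := value_ge0 u w.
by rewrite valueE E -ij lee_fin.
Qed.

(** Expectation and sum over labels are exchanged by Tonelli. Each label contributes its
    [observed_value] with weights 1, the lifetime of an emission being a clock of rate
    [total_rate]. *)
Lemma psiE : psi X t g = (\sum_(n <oo)
  iter n next_event (mean_value l D vmin vmax xs gD t) i0 (0%R, x0))%E.
Proof.
rewrite /psi; under eq_integral do rewrite pairingE.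
rewrite integral_nneseries//; last 2 first.
- move=> k; case: pickle_inv => [u|]; last exact: measurable_cst.
  exact/measurable_EFinP.
- by move=> k w _; case: pickle_inv => [u|//]; rewrite lee_fin value_ge0.
transitivity (\sum_(k <oo) (if @pickle_inv (label m) k is Some u then
    emission_mean u (mean_value l D vmin vmax xs gD t) else 0))%E.
  apply: eq_eseriesr => k _; case: pickle_inv => [u|]; last by rewrite integral0.
  exact: value_mean.
rewrite esum_generations; last by move=> u; apply: emission_mean_ge0 => j z; exact: mean_value_ge0.
apply: eq_eseriesr => n _; apply: generation_mean => [j|j z].
  exact: (measurable_mean_value oD hxs).
exact: mean_value_ge0.
Qed.

End semigroup.
End branching.

Theorem lemma7p1 (R : realType) (m l : nat) (hl : (1 <= l < m)%N)
  (D : set (vec3 R)) (hD : admissible_domain D)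
  (vmin vmax : R) (hvmin : 0 < vmin) (hvmax : vmin < vmax)
  (xs : cross_sections R m)
  (hxs : admissible_cross_sections l D (shell vmin vmax) xs)
  (nmax : nat) (hnmax : (1 <= nmax)%N)
  (dO : measure_display) (O : measurableType dO) (off : offspring R m O)
  (hoff : admissible_offspring l D (shell vmin vmax) xs nmax off)
  (pi : 'I_m -> 'I_m -> R.-ker (conf R) ~> vec3 R)
  (hpi : is_jump_kernel l D (shell vmin vmax) xs pi)
  (g : 'I_m -> conf R -> R)
  (hg : forall j : 'I_m, Lpos (D `*` shell vmin vmax) (g j))
  (t : R) (ht : 0 <= t) (i : 'I_m) (r v : vec3 R)
  (hr : D r) (hv : shell vmin vmax v)
  (dW : measure_display) (W : measurableType dW) (PW : probability W R)
  (Y : mnrw l D (shell vmin vmax) xs pi PW i (r, v))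
  (dB : measure_display) (B : measurableType dB) (PB : probability B R)
  (X : mnbp l D (shell vmin vmax) xs off PB i (r, v)) :
  phi Y t g = psi X t g.
Proof.
have DVx0 : (D `*` shell vmin vmax) (r, v) by [].
by rewrite (phiE hl (domain_open hD) hxs hpi Y DVx0 hg ht)
  (psiE (domain_open hD) hxs hoff X DVx0 t hg).
Qed.
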